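(* Consider the system $$\dot x=y^3-x^{2k+1},\qquad \dot y=-x+my^{2s+1},\qquad m\in\mathbb R,\ k,s\in\mathbb N^+ .$$ Then: (i) If $s<2k$, the origin is an attractor when $m<0$ and a repeller when $m>0$. (ii) If $s>2k$, the origin is an attractor for every $m\in\mathbb R$. (iii) If $s=2k$, the origin is an attractor when $m<\frac{(2k+1)!!}{(4k+1)!!!!}$ and a repeller when $m>\frac{(2k+1)!!}{(4k+1)!!!!}$. Moreover, when $k=1$ (so $s=2$) and $m=3/5$ the origin is a repeller, and there exists $\varepsilon>0$ such that for every $m\in(3/5-\varepsilon,3/5)$ the system has at least one limit cycle in a neighbourhood of the origin (which shrinks to the origin as $m\to 3/5^-$).
   Context: For $n\in\mathbb N^+$, $n!!$ and $n!!!!$ are defined recursively by $n!!=n\cdot(n-2)!!$ with $1!!=1$, $2!!=2$, and $n!!!!=n\cdot(n-4)!!!!$ with $j!!!!=j$ for $1\le j\le 4$. The origin is an isolated monodromic singular point; ''attractor'' means locally asymptotically stable, ''repeller'' means locally asymptotically stable for the time-reversed flow. *)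

(* Defs.v *)
From Stdlib Require Import Reals Lra Lia.
Open Scope R_scope.

Fixpoint dfact (n : nat) : nat :=
  match n with
  | O => 1%nat
  | S O => 1%nat
  | S (S p as q) => (S q * dfact p)%nat
  end.

Fixpoint qfact (n : nat) : nat :=
  match n with
  | O => 1%nat
  | S O => 1%nat
  | S (S O) => 2%nat
  | S (S (S O)) => 3%nat
  | S (S (S (S p))) => (n * qfact p)%nat
  end.

Definition is_sol (f g : R -> R -> R) (x y : R -> R) (t : R) : Prop :=
  derivable_pt_lim x t (f (x t) (y t)) /\ derivable_pt_lim y t (g (x t) (y t)).

Definition lyap_stable (f g : R -> R -> R) : Prop :=
  forall eps, 0 < eps -> exists delta, 0 < delta /\
    forall (x y : R -> R) (T : R), 0 <= T ->
      (forall t, 0 <= t <= T -> is_sol f g x y t) ->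
      (x 0) ^ 2 + (y 0) ^ 2 < delta ->
      forall t, 0 <= t <= T -> (x t) ^ 2 + (y t) ^ 2 < eps.

Definition attractive (f g : R -> R -> R) : Prop :=
  exists eta, 0 < eta /\
    forall (x y : R -> R),
      (forall t, 0 <= t -> is_sol f g x y t) ->
      (x 0) ^ 2 + (y 0) ^ 2 < eta ->
      forall eps, 0 < eps -> exists T, forall t, T <= t ->
        (x t) ^ 2 + (y t) ^ 2 < eps.

Definition attractor (f g : R -> R -> R) : Prop :=
  lyap_stable f g /\ attractive f g.

Definition repeller (f g : R -> R -> R) : Prop :=
  attractor (fun a b => - f a b) (fun a b => - g a b).

Definition periodic_orbit (f g : R -> R -> R) (x y : R -> R) : Prop :=
  (forall t, is_sol f g x y t) /\
  (exists P, 0 < P /\ forall t, x (t + P) = x t /\ y (t + P) = y t) /\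
  (exists t1 t2, x t1 <> x t2 \/ y t1 <> y t2).

Definition near_orbit (nu : R) (x' y' x y : R -> R) : Prop :=
  forall t, exists u, (x' t - x u) ^ 2 + (y' t - y u) ^ 2 < nu.

Definition same_orbit (x' y' x y : R -> R) : Prop :=
  forall t, exists u, x' t = x u /\ y' t = y u.

Definition limit_cycle (f g : R -> R -> R) (x y : R -> R) : Prop :=
  periodic_orbit f g x y /\
  exists nu, 0 < nu /\ forall x' y' : R -> R,
    periodic_orbit f g x' y' -> near_orbit nu x' y' x y -> same_orbit x' y' x y.

Definition sysf (k : nat) : R -> R -> R := fun a b => b ^ 3 - a ^ (2 * k + 1).
Definition sysg (s : nat) (m : R) : R -> R -> R := fun a b => - a + m * b ^ (2 * s + 1).

Definition threshold (k : nat) : R :=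
  INR (dfact (2 * k + 1)) / INR (qfact (4 * k + 1)).

(* Main.v *)
Require Import Defs.
From Stdlib Require Import Reals Lra Lia ZArith.
From Coquelicot Require Import Coquelicot.
Open Scope R_scope.

(* Give x weight 2 and y weight 1, and let H = x^2/2 + y^4/4, so that
   H' = - x^(2k+2) + m y^(2s+4) along the flow.  A polynomial W of weight 4k+3 has derivative
   x^(2k+2) - T y^(4k+4) along the Hamiltonian flow, with T the threshold of the paper;
   hence H + alpha W is a strict Lyapunov function, for a suitable alpha, in all noncritical
   cases.  For k = 1, m = 3/5 the terms of weight 8 and 11 average out and the Lyapunov
   function is pushed to weight 14, whose average is positive.

   For the limit cycle, write x = r^2 S, y = r C with S' = C^3, C' = - S, 2 S^2 + C^4 = 1.
   In the variable Z = 1/r^3 - q, for the polynomial q = [rq] in S and C, the orbits satisfy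
   dZ/dphi = a + b/Z with a = [ra], b = [rb] polynomials in S and C.  After near-identity
   corrections built from A' = - b and B, the drift of Z over a turn is
   c1 (3/5 - m) - c2 / Z^2 up to higher order, with c1, c2 > 0: it is negative for Z of order
   one and positive for Z of order (3/5 - m)^(-1/2), so that the return map has a fixed point.
   The distance D between two solutions satisfies D'/D = - b / (Z1 Z2) exactly, and the same
   corrections make the renormalized distance strictly monotone; two periodic orbits close
   to the origin therefore coincide, and the limit cycle is isolated. *)

(** * Lyapunov functions comparable to the energy *)

(** The linear part at the origin is nilpotent, so orbits are compared not with circles but with the
    level curves of H, of which [energy] is four times the value. In the adapted coordinates dr/dphi
    = r^4 p / (1 - r^3 q), where p and q are the radial and tangential parts of the perturbation.
    Passing to 1/r^3 makes the leading drift independent of the size of the orbit, and the shift by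
    q clears the denominator; the equation for Z can then be cut off to a bounded, globally
    Lipschitz one, solvable for all phases. The fixed point reflects an exchange of stability: at m
    = 3/5 the origin repels weakly, while slightly below it attracts, but only at radii that shrink
    with 3/5 - m. A fixed point is not enough, since a limit cycle must be isolated among all
    periodic orbits near it. A competing orbit comes as a function of time with unknown period;
    hence the passage from an arbitrary solution back to the phase, and the use of a strictly
    monotone quantity in place of derivatives of the return map. *)

Definition energy (a b : R) : R := 2 * a ^ 2 + b ^ 4.

(** A size homogeneous for the weights 2 and 1, chosen as a maximum so that a monomial of weight n
    is bounded by its n-th power with constant one. *)
Definition gauge (a b : R) : R := Rmax (sqrt (Rabs a)) (Rabs b).

Lemma gauge_ge0 a b : 0 <= gauge a b.
Proof. eapply Rle_trans; [apply Rabs_pos | apply Rmax_r]. Qed.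

Lemma gauge_abs2 a b : Rabs b <= gauge a b.
Proof. apply Rmax_r. Qed.

Lemma gauge_abs1 a b : Rabs a <= gauge a b ^ 2.
Proof.
  rewrite <- (pow2_sqrt (Rabs a)) at 1 by apply Rabs_pos.
  apply pow_incr; split; [apply sqrt_pos | apply Rmax_l].
Qed.

Lemma Rabs_pow_even a n : Rabs a ^ (2 * n) = a ^ (2 * n).
Proof. rewrite !pow_mult, pow2_abs; reflexivity. Qed.

Lemma gauge_cases a b : gauge a b ^ 2 = Rabs a \/ gauge a b = Rabs b.
Proof.
  unfold gauge, Rmax; destruct (Rle_dec (sqrt (Rabs a)) (Rabs b)).
  - right; reflexivity.
  - left; apply pow2_sqrt, Rabs_pos.
Qed.

Lemma gauge_le_pows n a b : gauge a b ^ (4 * n) <= a ^ (2 * n) + b ^ (4 * n).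
Proof.
  assert (Ha : 0 <= a ^ (2 * n)) by (rewrite pow_mult; apply pow_le, pow2_ge_0).
  assert (Hb : 0 <= b ^ (4 * n)).
  { replace (4 * n)%nat with (2 * (2 * n))%nat by lia.
    rewrite pow_mult; apply pow_le, pow2_ge_0. }
  destruct (gauge_cases a b) as [E|E].
  - replace (4 * n)%nat with (2 * (2 * n))%nat at 1 by lia.
    rewrite pow_mult, E, Rabs_pow_even; lra.
  - rewrite E; replace (4 * n)%nat with (2 * (2 * n))%nat by lia.
    rewrite Rabs_pow_even.
    replace (4 * n)%nat with (2 * (2 * n))%nat in Hb by lia; lra.
Qed.

Lemma monomial_gauge i j a b : Rabs (a ^ i * b ^ j) <= gauge a b ^ (2 * i + j).
Proof.
  rewrite Rabs_mult, <- !RPow_abs, pow_add, pow_mult.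
  apply Rmult_le_compat; try (apply pow_le, Rabs_pos); apply pow_incr;
    split; auto using Rabs_pos, gauge_abs1, gauge_abs2.
Qed.

Lemma energy_gauge a b : gauge a b ^ 4 <= energy a b <= 3 * gauge a b ^ 4.
Proof.
  unfold energy; split.
  - pose proof (gauge_le_pows 1 a b) as E; simpl Nat.mul in E.
    pose proof (pow2_ge_0 a); lra.
  - pose proof (monomial_gauge 2 0 a b) as E1; pose proof (monomial_gauge 0 4 a b) as E2.
    simpl Nat.mul in *; simpl Nat.add in *.
    pose proof (Rle_abs (a ^ 2 * b ^ 0)); pose proof (Rle_abs (a ^ 0 * b ^ 4)).
    rewrite pow_O in *; lra.
Qed.

Lemma energy_ge0 a b : 0 <= energy a b.
Proof. pose proof (energy_gauge a b); pose proof (pow_le _ 4 (gauge_ge0 a b)); lra. Qed.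

(** Only the chain rule along differentiable curves is recorded: a Lyapunov derivative uses nothing
    more, and the property passes to sums and scalings. *)
Definition has_partials (V Vx Vy : R -> R -> R) : Prop :=
  forall (x y : R -> R) (t x' y' : R), is_derive x t x' -> is_derive y t y' ->
    is_derive (fun u => V (x u) (y u)) t (Vx (x t) (y t) * x' + Vy (x t) (y t) * y').

Lemma partials_monomial i j :
  has_partials (fun a b => a ^ i * b ^ j)
    (fun a b => INR i * a ^ pred i * b ^ j) (fun a b => INR j * a ^ i * b ^ pred j).
Proof.
  intros x y t x' y' Hx Hy.
  auto_derive.
  - split; [exists x'; auto | split; [exists y'; auto | auto]].
  - replace (Derive _ t) with x' by (symmetry; apply is_derive_unique; exact Hx).
    replace (Derive _ t) with y' by (symmetry; apply is_derive_unique; exact Hy). ring.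
Qed.

Lemma partials_plus V Vx Vy W Wx Wy : has_partials V Vx Vy -> has_partials W Wx Wy ->
  has_partials (fun a b => V a b + W a b) (fun a b => Vx a b + Wx a b)
    (fun a b => Vy a b + Wy a b).
Proof.
  intros HV HW x y t x' y' Hx Hy.
  pose proof (is_derive_plus _ _ t _ _ (HV x y t x' y' Hx Hy) (HW x y t x' y' Hx Hy)) as E.
  unfold plus in E; simpl in E.
  match type of E with is_derive _ _ ?l =>
    match goal with |- is_derive _ _ ?r => replace r with l by ring end end.
  exact E.
Qed.

Lemma partials_scal c V Vx Vy : has_partials V Vx Vy ->
  has_partials (fun a b => c * V a b) (fun a b => c * Vx a b) (fun a b => c * Vy a b).
Proof.
  intros HV x y t x' y' Hx Hy.
  pose proof (is_derive_scal _ t c _ (HV x y t x' y' Hx Hy)) as E.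
  match type of E with is_derive _ _ ?l =>
    match goal with |- is_derive _ _ ?r => replace r with l by ring end end.
  exact E.
Qed.

Lemma partials_energy : has_partials energy (fun a _ => 4 * a) (fun _ b => 4 * b ^ 3).
Proof.
  pose proof (partials_plus _ _ _ _ _ _ (partials_scal 2 _ _ _ (partials_monomial 2 0))
    (partials_monomial 0 4)) as E.
  intros x y t x' y' Hx Hy; specialize (E x y t x' y' Hx Hy); unfold energy.
  eapply is_derive_ext; [ | replace (4 * x t * x' + 4 * y t ^ 3 * y') with
   ((2 * (INR 2 * x t ^ Init.Nat.pred 2 * y t ^ 0) + INR 0 * x t ^ Init.Nat.pred 0 * y t ^ 4) * x' +
     (2 * (INR 0 * x t ^ 2 * y t ^ Init.Nat.pred 0) + INR 4 * x t ^ 0 * y t ^ Init.Nat.pred 4) * y')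
     by (simpl; ring); exact E].
  intros u; simpl; ring.
Qed.

Lemma is_derive_continuity_pt (h : R -> R) t l : is_derive h t l -> continuity_pt h t.
Proof.
  intros E; apply derivable_continuous_pt; exists l; apply is_derive_Reals; exact E.
Qed.

(** An intermediate value alone would not control the earlier times; the supremum of the times up to
    which h stays below c does, and continuity leaves h = c as its only possible value there. *)
Lemma first_crossing (h : R -> R) (c t0 t1 : R) : t0 <= t1 ->
  (forall t, t0 <= t <= t1 -> continuity_pt h t) -> h t0 < c -> c <= h t1 ->
  exists tau, t0 <= tau <= t1 /\ h tau = c /\ forall t, t0 <= t <= tau -> h t <= c.
Proof.
  intros Ht Hc H0 H1.
  set (P := fun s => t0 <= s <= t1 /\ forall t, t0 <= t <= s -> h t <= c).
  assert (P0 : P t0).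
  { split; [lra | intros t Hs; replace t with t0 by lra; lra]. }
  destruct (completeness P) as [s [Hub Hlub]].
  - exists t1; intros u [Hu _]; lra.
  - exists t0; exact P0.
  - assert (Hs0 : t0 <= s) by (apply Hub; exact P0).
    assert (Hs1 : s <= t1) by (apply Hlub; intros u [Hu _]; lra).
    assert (Hbelow : forall t, t0 <= t < s -> h t <= c).
    { intros t Hts; destruct (Rle_lt_dec (h t) c) as [|Hlt]; [assumption|exfalso].
      assert (s <= t); [|lra].
      apply Hlub; intros u [Hu1 Hu2]; destruct (Rle_lt_dec u t); [assumption|].
      specialize (Hu2 t); lra. }
    destruct (Rtotal_order (h s) c) as [Hlt|[Heq|Hgt]].
    + exfalso.
      assert (s < t1) by (destruct (Req_dec s t1) as [->|]; lra).
      destruct (Hc s ltac:(lra) (c - h s) ltac:(lra)) as [d [Hd Hcd]].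
      set (s' := Rmin (s + d / 2) t1).
      assert (Hs' : s < s' <= s + d / 2 /\ s' <= t1).
      { unfold s', Rmin; destruct (Rle_dec (s + d / 2) t1); lra. }
      assert (P s'); [|specialize (Hub s' H2); lra].
      split; [lra|]; intros t Hts.
      destruct (Rlt_le_dec t s) as [|Hst]; [apply Hbelow; lra|].
      destruct (Req_dec t s) as [->|Hne]; [lra|].
      assert (Hd' : Rabs (h t - h s) < c - h s).
      { apply Hcd; unfold D_x, no_cond; split; [split; [exact I | lra]|].
        simpl; unfold Rdist; rewrite Rabs_pos_eq; lra. }
      apply Rabs_def2 in Hd'; lra.
    + exists s; split; [lra|split; [assumption|]]; intros t Hts.
      destruct (Req_dec t s) as [->|]; [lra|apply Hbelow; lra].
    + exfalso.
      assert (t0 < s) by (destruct (Req_dec s t0) as [->|]; lra).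
      destruct (Hc s ltac:(lra) (h s - c) ltac:(lra)) as [d [Hd Hcd]].
      set (s' := Rmax (s - d / 2) t0).
      assert (Hs' : s - d / 2 <= s' < s /\ t0 <= s').
      { unfold s', Rmax; destruct (Rle_dec (s - d / 2) t0); lra. }
      assert (Hd' : Rabs (h s' - h s) < h s - c).
      { apply Hcd; unfold D_x, no_cond; split; [split; [exact I | lra]|].
        simpl; unfold Rdist; rewrite Rabs_left; lra. }
      apply Rabs_def2 in Hd'; specialize (Hbelow s'); lra.
Qed.

Lemma decay_of_derivative (h h' : R -> R) (t0 t1 e : R) : t0 <= t1 ->
  (forall t, t0 <= t <= t1 -> is_derive h t (h' t)) ->
  (forall t, t0 <= t <= t1 -> h' t <= e) -> h t1 <= h t0 + e * (t1 - t0).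
Proof.
  intros Ht Hd He.
  destruct (MVT_gen h t0 t1 h') as [xi [Hxi Heq]].
  - rewrite Rmin_left, Rmax_right by lra; intros; apply Hd; lra.
  - rewrite Rmin_left, Rmax_right by lra; intros.
    eapply is_derive_continuity_pt, Hd; lra.
  - rewrite Rmin_left, Rmax_right in Hxi by lra.
    specialize (He xi Hxi); nra.
Qed.

Lemma is_sol_is_derive f g x y t : is_sol f g x y t ->
  is_derive x t (f (x t) (y t)) /\ is_derive y t (g (x t) (y t)).
Proof. intros [H1 H2]; split; apply is_derive_Reals; assumption. Qed.

(** * Lyapunov's theorem for functions comparable to the energy *)

Section Lyapunov.

Variables (f g V Vx Vy : R -> R -> R) (c K h0 : R) (n : nat).
Hypotheses (Hc : 0 < c) (HcK : c <= K) (Hh0 : 0 < h0).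
Hypothesis HV : has_partials V Vx Vy.
Hypothesis Hlow : forall a b, energy a b <= h0 -> c * energy a b <= V a b.
Hypothesis Hup : forall a b, energy a b <= h0 -> V a b <= K * energy a b.
Hypothesis Hdot : forall a b, energy a b <= h0 ->
  Vx a b * f a b + Vy a b * g a b <= - (c * energy a b ^ n).

(** At the first time when the energy equals h, V would be at least c h, although it started below c
    h and has not increased. The level h is free: small levels give stability, and h0 gives the
    basin. *)
Lemma energy_trapped (x y : R -> R) t0 t1 h : h <= h0 -> t0 <= t1 ->
  (forall t, t0 <= t <= t1 -> is_sol f g x y t) ->
  K * energy (x t0) (y t0) < c * h -> energy (x t1) (y t1) < h.
Proof.
  intros Hh Ht Hs H0.
  destruct (Rlt_le_dec (energy (x t1) (y t1)) h) as [|Hge]; [assumption|exfalso].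
  pose proof (energy_ge0 (x t0) (y t0)) as Hpos.
  destruct (first_crossing (fun t => energy (x t) (y t)) h t0 t1) as [tau [Htau [Heq Hbel]]];
    auto.
  - intros t Htt; destruct (is_sol_is_derive _ _ _ _ _ (Hs t Htt)).
    eapply is_derive_continuity_pt, partials_energy; eassumption.
  - nra.
  - assert (Hdec : V (x tau) (y tau) <= V (x t0) (y t0) + 0 * (tau - t0)).
    { apply (decay_of_derivative (fun t => V (x t) (y t)) (fun t =>
        Vx (x t) (y t) * f (x t) (y t) + Vy (x t) (y t) * g (x t) (y t))); [lra| |].
      - intros t Htt; destruct (is_sol_is_derive _ _ _ _ _ (Hs t ltac:(lra))).
        apply HV; assumption.
      - intros t Htt; eapply Rle_trans; [apply Hdot, Rle_trans with h; auto|].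
        pose proof (pow_le _ n (energy_ge0 (x t) (y t))); nra. }
    assert (L := Hlow (x tau) (y tau) ltac:(lra)).
    assert (U := Hup (x t0) (y t0) ltac:(apply Rle_trans with h; [apply Hbel; lra|lra])).
    rewrite Heq in L; lra.
Qed.

Lemma energy_small eps : 0 < eps -> exists h, 0 < h <= h0 /\
  forall a b, energy a b < h -> a ^ 2 + b ^ 2 < eps.
Proof.
  (* Half of eps for each coordinate: [energy < eps] gives a^2 < eps/2, and [energy < eps ^ 2 / 4]
     gives b^2 < eps/2. *)
  intros He; exists (Rmin h0 (Rmin eps (eps ^ 2 / 4))).
  assert (0 < eps ^ 2 / 4) by nra.
  split.
  - split; [repeat apply Rmin_pos; lra | apply Rmin_l].
  - intros a b Hab.
    assert (energy a b < eps) by (eapply Rlt_le_trans; [exact Hab|];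
      eapply Rle_trans; [apply Rmin_r|apply Rmin_l]).
    assert (energy a b < eps ^ 2 / 4) by (eapply Rlt_le_trans; [exact Hab|];
      eapply Rle_trans; [apply Rmin_r|apply Rmin_r]).
    unfold energy in *.
    assert (b ^ 2 < eps / 2).
    { apply Rnot_le_lt; intros Hb. assert ((eps / 2) ^ 2 <= (b ^ 2) ^ 2) by
        (apply pow_incr; lra). pose proof (pow2_ge_0 a). nra. }
    pose proof (pow2_ge_0 (b ^ 2)); nra.
Qed.

Lemma small_energy h : 0 < h -> exists delta, 0 < delta /\
  forall a b, a ^ 2 + b ^ 2 < delta -> energy a b < h.
Proof.
  intros Hh; exists (Rmin 1 (h / 3)); split; [apply Rmin_pos; lra|].
  intros a b Hab.
  assert (a ^ 2 + b ^ 2 < 1) by (eapply Rlt_le_trans; [exact Hab | apply Rmin_l]).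
  assert (a ^ 2 + b ^ 2 < h / 3) by (eapply Rlt_le_trans; [exact Hab | apply Rmin_r]).
  unfold energy; pose proof (pow2_ge_0 a); pose proof (pow2_ge_0 b).
  replace (b ^ 4) with (b ^ 2 * b ^ 2) by ring; nra.
Qed.

(** For attraction, an energy that stayed above e would make V lose at least c e^n per unit of time
    and become negative. Hence the energy falls to e at some time, and the trap keeps it small from
    then on. *)
Theorem lyapunov_attractor : attractor f g.
Proof.
  assert (Hgoal : forall h, 0 < h -> h <= h0 -> exists delta, 0 < delta /\
    forall a b, a ^ 2 + b ^ 2 < delta -> K * energy a b < c * h).
  { intros h Hh _; destruct (small_energy (c * h / K)) as [d [Hd Hdd]].
    - apply Rdiv_lt_0_compat; nra.
    - exists d; split; auto; intros a b Hab; specialize (Hdd a b Hab).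
      apply Rmult_lt_compat_l with (r := K) in Hdd; [|lra].
      replace (K * (c * h / K)) with (c * h) in Hdd by (field; lra); exact Hdd. }
  split.
  - intros eps He; destruct (energy_small eps He) as [h [Hh Hsm]].
    destruct (Hgoal h) as [d [Hd Hdd]]; [lra|lra|].
    exists d; split; auto; intros x y T HT Hs H0 t Ht.
    apply Hsm, (energy_trapped x y 0 t h); auto; try lra.
    intros u Hu; apply Hs; lra.
  - destruct (Hgoal h0) as [d [Hd Hdd]]; [lra|lra|].
    exists d; split; auto; intros x y Hs H0 eps He.
    assert (Hin : forall t, 0 <= t -> energy (x t) (y t) < h0).
    { intros t Ht; apply (energy_trapped x y 0 t h0); auto; try lra.
      intros u Hu; apply Hs; lra. }
    destruct (energy_small eps He) as [h [Hh Hsm]].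
    (* Half of the level at which [energy_trapped] applies, because its hypothesis is strict. *)
    set (e := c * h / (2 * K)).
    assert (Hek : K * e = c * h / 2) by (unfold e; field; lra).
    assert (Hepos : 0 < e) by (unfold e; apply Rdiv_lt_0_compat; nra).
    assert (Hex : exists t0, 0 <= t0 /\ energy (x t0) (y t0) <= e).
    (* The time at which V, decreasing at rate c e^n, would have fallen to -1. *)
    { set (T := (V (x 0) (y 0) + 1) / (c * e ^ n)).
      assert (Hce : 0 < c * e ^ n) by (apply Rmult_lt_0_compat; [lra | apply pow_lt; lra]).
      assert (HV0 : 0 <= V (x 0) (y 0)).
      { eapply Rle_trans; [|apply Hlow; left; apply Hin; lra].
        pose proof (energy_ge0 (x 0) (y 0)); nra. }
      assert (HT : 0 <= T) by (apply Rdiv_le_0_compat; lra).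
      assert (HTe : c * e ^ n * T = V (x 0) (y 0) + 1) 
        by (unfold T, Rdiv; rewrite Rmult_comm, Rmult_assoc, Rinv_l, Rmult_1_r; lra).
      destruct (Classical_Prop.classic (exists t0, 0 <= t0 /\ energy (x t0) (y t0) <= e))
        as [|Hno]; [assumption|exfalso].
      assert (Hdec : V (x T) (y T) <= V (x 0) (y 0) + (- (c * e ^ n)) * (T - 0)).
      { apply (decay_of_derivative (fun t => V (x t) (y t)) (fun t =>
          Vx (x t) (y t) * f (x t) (y t) + Vy (x t) (y t) * g (x t) (y t))); [lra| |].
        - intros t Htt; destruct (is_sol_is_derive _ _ _ _ _ (Hs t ltac:(lra))).
          apply HV; assumption.
        - intros t Htt; eapply Rle_trans; [apply Hdot; left; apply Hin; lra|].
          apply Ropp_le_contravar, Rmult_le_compat_l; [lra|].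
          apply pow_incr; split; [lra|].
          destruct (Rle_lt_dec e (energy (x t) (y t))); [assumption|].
          exfalso; apply Hno; exists t; split; lra. }
      assert (0 <= V (x T) (y T)).
      { eapply Rle_trans; [|apply Hlow; left; apply Hin; lra].
        pose proof (energy_ge0 (x T) (y T)); nra. }
      lra. }
    destruct Hex as [t0 [Ht0 He0]].
    exists t0; intros t Ht; apply Hsm, (energy_trapped x y t0 t h); auto; try lra.
    + intros u Hu; apply Hs; lra.
    + assert (K * energy (x t0) (y t0) <= K * e) by (apply Rmult_le_compat_l; lra).
      assert (0 < c * h) by (apply Rmult_lt_0_compat; lra).
      rewrite Hek in H; lra.
Qed.

End Lyapunov.

(** * Averaging along the Hamiltonian flow *)

Lemma gauge_pow_le1 a b i j : gauge a b <= 1 -> (i <= j)%nat -> gauge a b ^ j <= gauge a b ^ i.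
Proof.
  intros Hg Hij; pose proof (gauge_ge0 a b) as Hp.
  replace j with (i + (j - i))%nat by lia; rewrite pow_add.
  assert (gauge a b ^ (j - i) <= 1).
  { rewrite <- (pow1 (j - i)); apply pow_incr; lra. }
  pose proof (pow_le _ i Hp); nra.
Qed.


(* The Lyapunov function is H + W, where W is negligible since H has weight 4. *)
Lemma gauge_attractor f g W Wx Wy (K r1 c : R) (n : nat) :
  0 < r1 -> 0 < c -> has_partials W Wx Wy ->
  (forall a b, gauge a b <= r1 -> Rabs (W a b) <= K * gauge a b ^ 5) ->
  (forall a b, gauge a b <= r1 ->
     (a + Wx a b) * f a b + (b ^ 3 + Wy a b) * g a b <= - (c * gauge a b ^ (4 * n))) ->
  attractor f g.
Proof.
  intros Hr1 Hc HW HWb Hdot.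
  (* Within this gauge W is at most energy / 8, half of H = energy / 4. *)
  set (r0 := Rmin r1 (/ (8 * (Rabs K + 1)))).
  assert (HK : 0 < Rabs K + 1) by (pose proof (Rabs_pos K); lra).
  assert (Hr0 : 0 < r0).
  { unfold r0; apply Rmin_pos; [lra | apply Rinv_0_lt_compat; lra]. }
  assert (Hr01 : r0 <= r1) by apply Rmin_l.
  assert (Hr02 : Rabs K * r0 <= 1 / 8).
  { assert (r0 <= / (8 * (Rabs K + 1))) as Hle by apply Rmin_r.
    apply Rmult_le_compat_l with (r := 8 * (Rabs K + 1)) in Hle; [|lra].
    rewrite Rinv_r in Hle by lra; lra. }
  assert (Hsmall : forall a b, energy a b <= r0 ^ 4 -> gauge a b <= r0).
  { intros a b Hab; apply Rnot_lt_le; intros Hlt.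
    pose proof (energy_gauge a b) as [E _].
    assert (r0 ^ 2 < gauge a b ^ 2) by nra.
    assert ((r0 ^ 2) ^ 2 < (gauge a b ^ 2) ^ 2) by (pose proof (pow2_ge_0 r0); nra).
    nra. }
  assert (HWe : forall a b, energy a b <= r0 ^ 4 -> Rabs (W a b) <= 1 / 8 * energy a b).
  { intros a b Hab; specialize (Hsmall a b Hab).
    pose proof (gauge_ge0 a b) as Hg; pose proof (energy_gauge a b) as [E _].
    eapply Rle_trans; [apply HWb; lra|].
    pose proof (pow_le _ 4 Hg).
    replace (K * gauge a b ^ 5) with (K * gauge a b * gauge a b ^ 4) by ring.
    assert (K * gauge a b <= 1 / 8).
    { pose proof (Rle_abs K); pose proof (Rabs_pos K); nra. }
    nra. }
  (* The factor 3^n converts a power of the gauge into a power of the energy, by [energy_gauge]. *)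
  set (c' := Rmin (1 / 8) (c / 3 ^ n)).
  assert (H3 : 0 < 3 ^ n) by (apply pow_lt; lra).
  assert (Hc' : 0 < c') by (apply Rmin_pos; [lra | apply Rdiv_lt_0_compat; lra]).
  apply (lyapunov_attractor f g (fun a b => 1 / 4 * energy a b + W a b)
    (fun a b => 1 / 4 * (4 * a) + Wx a b) (fun a b => 1 / 4 * (4 * b ^ 3) + Wy a b)
    c' 1 (r0 ^ 4) n); auto.
  - eapply Rle_trans; [apply Rmin_l | lra].
  - apply pow_lt; lra.
  - apply partials_plus; [|assumption].
    exact (partials_scal (1 / 4) _ _ _ partials_energy).
  - intros a b Hab; specialize (HWe a b Hab).
    pose proof (energy_ge0 a b).
    assert (c' * energy a b <= 1 / 8 * energy a b) by
      (apply Rmult_le_compat_r; [assumption | apply Rmin_l]).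
    pose proof (Rle_abs (- W a b)); rewrite Rabs_Ropp in *; lra.
  - intros a b Hab; specialize (HWe a b Hab).
    pose proof (energy_ge0 a b); pose proof (Rle_abs (W a b)); lra.
  - intros a b Hab; specialize (Hsmall a b Hab).
    replace ((1 / 4 * (4 * a) + Wx a b) * f a b + (1 / 4 * (4 * b ^ 3) + Wy a b) * g a b)
      with ((a + Wx a b) * f a b + (b ^ 3 + Wy a b) * g a b) by field.
    eapply Rle_trans; [apply Hdot; lra|].
    apply Ropp_le_contravar.
    assert (energy a b ^ n <= 3 ^ n * gauge a b ^ (4 * n)).
    { rewrite pow_mult, <- Rpow_mult_distr; apply pow_incr.
      split; [apply energy_ge0 | apply energy_gauge]. }
    assert (c' * energy a b ^ n <= c / 3 ^ n * energy a b ^ n).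
    { apply Rmult_le_compat_r; [apply pow_le, energy_ge0 | apply Rmin_r]. }
    eapply Rle_trans; [eassumption|].
    replace (c * gauge a b ^ (4 * n)) with (c / 3 ^ n * (3 ^ n * gauge a b ^ (4 * n)))
      by (field; lra).
    apply Rmult_le_compat_l; [|assumption].
    left; apply Rdiv_lt_0_compat; lra.
Qed.

(* Up to derivatives along the flow of H, the monomial x^(2i) y^j equals
   [avg_ratio i j] * y^(j+4i). *)
Fixpoint avg_ratio (i j : nat) : R :=
  match i with
  | O => 1
  | S p => INR (2 * p + 1) / INR (j + 1) * avg_ratio p (j + 4)
  end.

Lemma avg_ratio_pos i : forall j, 0 < avg_ratio i j.
Proof.
  induction i; intros j; simpl avg_ratio; [lra|].
  apply Rmult_lt_0_compat; [apply Rdiv_lt_0_compat; apply lt_0_INR; lia | apply IHi].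
Qed.

Lemma qfact_rec l : qfact (4 * (l + 1) + 1) = ((4 * l + 5) * qfact (4 * l + 1))%nat.
Proof.
  replace (4 * (l + 1) + 1)%nat with (S (S (S (S (4 * l + 1))))) by lia.
  replace (4 * l + 5)%nat with (S (S (S (S (4 * l + 1))))) by lia; reflexivity.
Qed.

Lemma dfact_rec i : dfact (2 * S i + 1) = ((2 * i + 3) * dfact (2 * i + 1))%nat.
Proof.
  replace (2 * S i + 1)%nat with (S (S (2 * i + 1))) by lia.
  replace (2 * i + 3)%nat with (S (S (2 * i + 1))) by lia; reflexivity.
Qed.

Lemma qfact_pos l : (0 < qfact (4 * l + 1))%nat.
Proof.
  induction l; [simpl; lia|].
  replace (S l) with (l + 1)%nat by lia; rewrite qfact_rec; lia.
Qed.

(** The recursion lowers i by one and raises j by four, so the induction needs every starting point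
    4l. The ratio is (2i+1)!! over (4l+1)(4l+5)...(4(i+l)+1), written without division. *)
Lemma avg_ratio_closed i : forall l,
  avg_ratio (S i) (4 * l) * INR (4 * l + 1) * INR (qfact (4 * (i + l) + 1)) =
  INR (dfact (2 * i + 1)) * INR (qfact (4 * l + 1)).
Proof.
  induction i; intros l.
  - change (avg_ratio 1 (4 * l)) with (INR 1 / INR (4 * l + 1) * 1).
    change (dfact (2 * 0 + 1)) with 1%nat; simpl Nat.add.
    assert (INR (4 * l + 1) <> 0) by (apply not_0_INR; lia).
    rewrite INR_1; field; assumption.
  - specialize (IHi (l + 1)%nat).
    rewrite qfact_rec, mult_INR in IHi.
    replace (4 * (i + (l + 1)) + 1)%nat with (4 * (S i + l) + 1)%nat in IHi by lia.
    change (avg_ratio (S (S i)) (4 * l)) with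
      (INR (2 * S i + 1) / INR (4 * l + 1) * avg_ratio (S i) (4 * l + 4)).
    replace (4 * (l + 1))%nat with (4 * l + 4)%nat in IHi by lia.
    replace (4 * l + 4 + 1)%nat with (4 * l + 5)%nat in IHi by lia.
    rewrite dfact_rec, mult_INR.
    replace (2 * S i + 1)%nat with (2 * i + 3)%nat by lia.
    assert (INR (4 * l + 1) <> 0) by (apply not_0_INR; lia).
    assert (INR (4 * l + 5) <> 0) by (apply not_0_INR; lia).
    apply Rmult_eq_reg_r with (INR (4 * l + 5)); [|assumption].
    transitivity (INR (2 * i + 3) * (avg_ratio (S i) (4 * l + 4) * INR (4 * l + 5) *
      INR (qfact (4 * (S i + l) + 1)))); [field; assumption|].
    rewrite IHi; ring.
Qed.

Lemma avg_ratio_threshold k : avg_ratio (S k) 0 = threshold k.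
Proof.
  unfold threshold; pose proof (avg_ratio_closed k 0) as E.
  change (4 * 0)%nat with 0%nat in E; change (qfact (0 + 1)) with 1%nat in E.
  change (INR (0 + 1)) with 1 in E; change (INR 1) with 1 in E.
  rewrite Nat.add_0_r, !Rmult_1_r in E; rewrite <- E.
  assert (INR (qfact (4 * k + 1)) <> 0) by (apply not_0_INR; pose proof (qfact_pos k); lia).
  field; assumption.
Qed.

Lemma weighted_bound K L i j a b n : 0 <= K -> Rabs L <= K -> (2 * i + j)%nat = n ->
  Rabs (L * (a ^ i * b ^ j)) <= K * gauge a b ^ n.
Proof.
  intros HK HL <-; rewrite Rabs_mult.
  apply Rmult_le_compat; auto using Rabs_pos, monomial_gauge.
Qed.

(** Integration by parts: along (b^3, -a) the monomial a^(2i+1) b^(j+1) has derivative (2i+1) a^(2i)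
    b^(j+4) - (j+1) a^(2i+2) b^j, which trades a^2 for b^4. The three bounds record the weights of W
    and of its partial derivatives. *)
Lemma averaging_potential i : forall j, exists (W Wx Wy : R -> R -> R) (K : R),
  0 <= K /\ has_partials W Wx Wy /\
  (forall a b, Wx a b * b ^ 3 - Wy a b * a =
     a ^ (2 * i) * b ^ j - avg_ratio i j * b ^ (j + 4 * i)) /\
  (forall a b, Rabs (W a b) <= K * gauge a b ^ (4 * i + j - 1)) /\
  (forall a b, Rabs (Wx a b) <= K * gauge a b ^ (4 * i + j - 3)) /\
  (forall a b, Rabs (Wy a b) <= K * gauge a b ^ (4 * i + j - 2)).
Proof.
  induction i; intros j.
  (* Here the subtractions in the exponents may be truncated, which is harmless for zero
     functions. *)
  - exists (fun _ _ => 0), (fun _ _ => 0), (fun _ _ => 0), 0.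
    split; [lra|split; [|split; [|split; [|split]]]].
    + intros x y t x' y' _ _; rewrite !Rmult_0_l, Rplus_0_l; apply @is_derive_const.
    + intros a b; simpl; replace (j + 0)%nat with j by lia; ring.
    + intros; rewrite Rabs_R0; lra.
    + intros; rewrite Rabs_R0; lra.
    + intros; rewrite Rabs_R0; lra.
  - destruct (IHi (j + 4)%nat) as (W & Wx & Wy & K & HK & HW & HX & Hb & Hbx & Hby).
    set (e := / INR (j + 1)); set (c := INR (2 * i + 1) / INR (j + 1)).
    assert (Hj : INR (j + 1) <> 0) by (apply not_0_INR; lia).
    pose proof (partials_plus _ _ _ _ _ _
      (partials_scal (- e) _ _ _ (partials_monomial (2 * i + 1) (j + 1)))
      (partials_scal c _ _ _ HW)) as HP; cbv beta in HP.
    replace (Init.Nat.pred (2 * i + 1)) with (2 * i)%nat in HP by lia.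
    replace (Init.Nat.pred (j + 1)) with j in HP by lia.
    set (K' := Rabs e + Rabs (e * INR (2 * i + 1)) + Rabs (e * INR (j + 1)) + Rabs c * K).
    assert (Hpos : 0 <= Rabs e /\ 0 <= Rabs (e * INR (2 * i + 1)) /\
      0 <= Rabs (e * INR (j + 1)) /\ 0 <= Rabs c * K).
    { repeat split; try apply Rabs_pos; apply Rmult_le_pos; auto using Rabs_pos. }
    assert (Hcomb : forall u v A G, Rabs u <= A * G -> Rabs v <= K * G -> 0 <= G ->
      A <= K' - Rabs c * K -> Rabs (u + c * v) <= K' * G).
    { intros u v A G Hu Hv HG HA; eapply Rle_trans; [apply Rabs_triang|].
      rewrite Rabs_mult.
      assert (Rabs c * Rabs v <= Rabs c * (K * G)) by
        (apply Rmult_le_compat_l; [apply Rabs_pos | assumption]).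
      nra. }
    eexists _, _, _, K'; split; [unfold K'; lra|split; [exact HP|]].
    split; [|split; [|split]]; intros a b.
    + transitivity (- e * (INR (2 * i + 1) * a ^ (2 * i) * b ^ (j + 4) -
        INR (j + 1) * (a ^ (2 * i + 2) * b ^ j)) + c * (Wx a b * b ^ 3 - Wy a b * a)).
      { replace (2 * i + 2)%nat with (2 * i + 1 + 1)%nat by lia; rewrite !pow_add; ring. }
      rewrite HX; change (avg_ratio (S i) j) with (c * avg_ratio i (j + 4)).
      replace (j + 4 + 4 * i)%nat with (j + 4 * S i)%nat by lia.
      replace (2 * S i)%nat with (2 * i + 2)%nat by lia.
      unfold c, e; field; assumption.
    + apply Hcomb with (A := Rabs e); [| | apply pow_le, gauge_ge0 | unfold K'; lra].
      * apply weighted_bound; [apply Rabs_pos | rewrite Rabs_Ropp; lra | lia].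
      * replace (4 * S i + j - 1)%nat with (4 * i + (j + 4) - 1)%nat by lia; apply Hb.
    + apply Hcomb with (A := Rabs (e * INR (2 * i + 1)));
        [| | apply pow_le, gauge_ge0 | unfold K'; lra].
      * replace (- e * (INR (2 * i + 1) * a ^ (2 * i) * b ^ (j + 1))) with
          (- (e * INR (2 * i + 1)) * (a ^ (2 * i) * b ^ (j + 1))) by ring.
        apply weighted_bound; [apply Rabs_pos | rewrite Rabs_Ropp; lra | lia].
      * replace (4 * S i + j - 3)%nat with (4 * i + (j + 4) - 3)%nat by lia; apply Hbx.
    + apply Hcomb with (A := Rabs (e * INR (j + 1)));
        [| | apply pow_le, gauge_ge0 | unfold K'; lra].
      * replace (- e * (INR (j + 1) * a ^ (2 * i + 1) * b ^ j)) with
          (- (e * INR (j + 1)) * (a ^ (2 * i + 1) * b ^ j)) by ring.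
        apply weighted_bound; [apply Rabs_pos | rewrite Rabs_Ropp; lra | lia].
      * replace (4 * S i + j - 2)%nat with (4 * i + (j + 4) - 2)%nat by lia; apply Hby.
Qed.

(* Replacing H by [H + alpha W] trades a fraction alpha of the dissipation x^(2k+2) for
   [alpha * threshold k] of y^(4k+4); sigma = -1 is the time-reversed flow. *)
Lemma averaged_attractor (k s : nat) (m sigma alpha c r1 : R) (f g : R -> R -> R) :
  (1 <= k)%nat -> (1 <= s)%nat -> 0 < c -> 0 < r1 ->
  Rabs sigma = 1 ->
  (forall a b, f a b = sigma * sysf k a b) -> (forall a b, g a b = sigma * sysg s m a b) ->
  (forall a b, Rabs b <= r1 ->
    sigma * (- (1 - alpha) * a ^ (2 * (k + 1)) - alpha * threshold k * b ^ (4 * (k + 1)) +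
      m * b ^ (2 * s + 4)) <= - (c * (a ^ (2 * (k + 1)) + b ^ (4 * (k + 1))))) ->
  attractor f g.
Proof.
  intros Hk Hs Hc Hr1 Hsig Hf Hg Hmain.
  destruct (averaging_potential (k + 1) 0) as (W & Wx & Wy & K & HK & HW & HX & Hb & Hbx & Hby).
  replace (avg_ratio (k + 1) 0) with (threshold k) in HX
    by (rewrite <- avg_ratio_threshold; f_equal; lia).
  set (K2 := Rabs alpha * (K + Rabs m * K)).
  assert (HK2 : 0 <= K2).
  { apply Rmult_le_pos; [apply Rabs_pos|]; pose proof (Rabs_pos m); nra. }
  (* Small enough for the cross terms, one weight above the dissipation, to use up at most half of
     it. *)
  set (r2 := Rmin (Rmin 1 r1) (c / (2 * (K2 + 1)))).
  assert (Hr2 : 0 < r2 <= 1 /\ r2 <= r1 /\ K2 * r2 <= c / 2).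
  { assert (0 < c / (2 * (K2 + 1))) by (apply Rdiv_lt_0_compat; lra).
    assert (r2 <= Rmin 1 r1) by apply Rmin_l.
    pose proof (Rmin_l 1 r1); pose proof (Rmin_r 1 r1).
    assert (Hle : r2 <= c / (2 * (K2 + 1))) by apply Rmin_r.
    assert (0 < r2) by (repeat apply Rmin_pos; lra).
    repeat split; try lra.
    apply Rmult_le_compat_l with (r := K2 + 1) in Hle; [|lra].
    replace ((K2 + 1) * (c / (2 * (K2 + 1)))) with (c / 2) in Hle by (field; lra); lra. }
  apply (gauge_attractor f g (fun a b => alpha * W a b) (fun a b => alpha * Wx a b)
    (fun a b => alpha * Wy a b) (Rabs alpha * K) r2 (c / 2) (k + 1)); try lra.
  - apply partials_scal; exact HW.
  - intros a b Hab; rewrite Rabs_mult, Rmult_assoc.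
    apply Rmult_le_compat_l; [apply Rabs_pos|].
    eapply Rle_trans; [apply Hb|]; apply Rmult_le_compat_l; [assumption|].
    apply gauge_pow_le1; [lra|lia].
  - intros a b Hab; rewrite Hf, Hg; unfold sysf, sysg.
    pose proof (gauge_ge0 a b) as Hg0; set (r := gauge a b) in *.
    assert (Hn : a ^ (2 * (k + 1)) = a * a ^ (2 * k + 1)) by
      (replace (2 * (k + 1))%nat with (S (2 * k + 1)) by lia; reflexivity).
    assert (Hm : b ^ (2 * s + 4) = b ^ 3 * b ^ (2 * s + 1)) by
      (rewrite <- pow_add; f_equal; lia).
    (* The action of the dissipative terms on the correction. Its parts have weights 8k+3 and
       4k+2s+3, both at least 4k+5 since k and s are positive. *)
    set (h := alpha * (- (a ^ (2 * k + 1) * Wx a b) + m * (b ^ (2 * s + 1) * Wy a b))).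
    assert (Heq : (a + alpha * Wx a b) * (sigma * (b ^ 3 - a ^ (2 * k + 1))) +
      (b ^ 3 + alpha * Wy a b) * (sigma * (- a + m * b ^ (2 * s + 1))) =
      sigma * (- (1 - alpha) * a ^ (2 * (k + 1)) - alpha * threshold k * b ^ (4 * (k + 1)) +
      m * b ^ (2 * s + 4)) + sigma * h).
    { specialize (HX a b). replace (0 + 4 * (k + 1))%nat with (4 * (k + 1))%nat in HX by lia.
      simpl (b ^ 0) in HX; unfold h; rewrite Hn, Hm in *.
      assert (alpha * (Wx a b * b ^ 3 - Wy a b * a) = alpha * (a * a ^ (2 * k + 1) * 1 -
        threshold k * b ^ (4 * (k + 1)))) as HX' by (rewrite HX; reflexivity).
      assert (Hfin : forall u v, u = v -> sigma * u = sigma * v) by (intros; subst; auto).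
      match goal with |- ?l = ?r => replace l with (sigma * (
       a * (b ^ 3 - a ^ (2 * k + 1)) + b ^ 3 * (- a + m * b ^ (2 * s + 1)) +
        alpha * (Wx a b * b ^ 3 - Wy a b * a) +
        alpha * (- (a ^ (2 * k + 1) * Wx a b) + m * (b ^ (2 * s + 1) * Wy a b)))) by ring end.
      rewrite HX'; ring. }
    rewrite Heq.
    assert (Hbr : Rabs b <= r1) by (eapply Rle_trans; [apply (gauge_abs2 a)|fold r; lra]).
    pose proof (Hmain a b Hbr) as Hm1.
    pose proof (gauge_le_pows (k + 1) a b) as Hgp; fold r in Hgp.
    assert (Hh : Rabs (sigma * h) <= K2 * r ^ (4 * (k + 1) + 1)).
    { rewrite Rabs_mult, Hsig, Rmult_1_l; unfold h, K2.
      rewrite Rabs_mult, Rmult_assoc; apply Rmult_le_compat_l; [apply Rabs_pos|].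
      eapply Rle_trans; [apply Rabs_triang|].
      rewrite Rabs_Ropp, Rmult_plus_distr_r; apply Rplus_le_compat.
      - rewrite Rabs_mult.
        apply Rle_trans with (r ^ (4 * k + 2) * (K * r ^ (4 * (k + 1) + 0 - 3))).
        + apply Rmult_le_compat; auto using Rabs_pos.
          pose proof (monomial_gauge (2 * k + 1) 0 a b) as Hmg.
          rewrite pow_O, Rmult_1_r in Hmg; fold r in Hmg.
          replace (2 * (2 * k + 1) + 0)%nat with (4 * k + 2)%nat in Hmg by lia; exact Hmg.
        + replace (r ^ (4 * k + 2) * (K * r ^ (4 * (k + 1) + 0 - 3))) with
            (K * (r ^ (4 * k + 2 + (4 * (k + 1) + 0 - 3)))) by (rewrite pow_add; ring).
          apply Rmult_le_compat_l; [assumption|].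
          apply gauge_pow_le1; [fold r; lra | lia].
      - rewrite !Rabs_mult, Rmult_assoc; apply Rmult_le_compat_l; [apply Rabs_pos|].
        apply Rle_trans with (r ^ (2 * s + 1) * (K * r ^ (4 * (k + 1) + 0 - 2))).
        + apply Rmult_le_compat; auto using Rabs_pos.
          rewrite <- RPow_abs; apply pow_incr; split; [apply Rabs_pos | apply gauge_abs2].
        + replace (r ^ (2 * s + 1) * (K * r ^ (4 * (k + 1) + 0 - 2))) with
            (K * (r ^ (2 * s + 1 + (4 * (k + 1) + 0 - 2)))) by (rewrite pow_add; ring).
          apply Rmult_le_compat_l; [assumption|].
          apply gauge_pow_le1; [fold r; lra | lia]. }
    pose proof (Rle_abs (sigma * h)).
    assert (K2 * r ^ (4 * (k + 1) + 1) <= c / 2 * r ^ (4 * (k + 1))).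
    { rewrite pow_add, pow_1.
      pose proof (pow_le _ (4 * (k + 1)) Hg0).
      assert (K2 * r <= c / 2) by nra.
      nra. }
    assert (c * r ^ (4 * (k + 1)) <= c * (a ^ (2 * (k + 1)) + b ^ (4 * (k + 1)))) by
      (apply Rmult_le_compat_l; lra).
    lra.
Qed.

(** * Stability of the origin *)

Lemma threshold_pos k : 0 < threshold k.
Proof. rewrite <- avg_ratio_threshold; apply avg_ratio_pos. Qed.

Lemma pow_double_ge0 a n : 0 <= a ^ (2 * n).
Proof. rewrite pow_mult; apply pow_le, pow2_ge_0. Qed.

Lemma pow_double_le b i j : Rabs b <= 1 -> (i <= j)%nat -> b ^ (2 * j) <= b ^ (2 * i).
Proof.
  intros Hb Hij; rewrite !pow_mult.
  assert (0 <= b ^ 2 <= 1) by (rewrite <- pow2_abs; pose proof (Rabs_pos b); nra).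
  replace j with (i + (j - i))%nat by lia; rewrite pow_add.
  assert ((b ^ 2) ^ (j - i) <= 1) by (rewrite <- (pow1 (j - i)); apply pow_incr; lra).
  pose proof (pow_le (b ^ 2) i ltac:(lra)); nra.
Qed.

Lemma pow_double_gap b e i j : 0 <= e <= 1 -> Rabs b <= e -> (i < j)%nat ->
  b ^ (2 * j) <= e * b ^ (2 * i).
Proof.
  intros He Hb Hij.
  apply Rle_trans with (b ^ (2 * (i + 1))); [apply pow_double_le; [lra|lia]|].
  replace (2 * (i + 1))%nat with (2 * i + 2)%nat by lia; rewrite pow_add.
  pose proof (pow_double_ge0 b i).
  assert (b ^ 2 <= e) by (rewrite <- pow2_abs; pose proof (Rabs_pos b); nra).
  nra.
Qed.

Lemma attractor_neg k s m : (1 <= k)%nat -> (1 <= s)%nat -> (s < 2 * k)%nat -> m < 0 ->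
  attractor (sysf k) (sysg s m).
Proof.
  intros Hk Hs Hsk Hm.
  apply (averaged_attractor k s m 1 0 (Rmin 1 (- m)) 1); auto; try lra.
  - apply Rmin_pos; lra.
  - apply Rabs_R1.
  - intros; ring.
  - intros; ring.
  - intros a b Hb.
    pose proof (pow_double_ge0 a (k + 1)).
    pose proof (pow_double_le b (s + 2) (2 * (k + 1)) Hb ltac:(lia)) as H1.
    pose proof (pow_double_ge0 b (2 * (k + 1))) as H2.
    replace (2 * (s + 2))%nat with (2 * s + 4)%nat in H1 by lia.
    replace (2 * (2 * (k + 1)))%nat with (4 * (k + 1))%nat in * by lia.
    pose proof (Rmin_l 1 (- m)); pose proof (Rmin_r 1 (- m)); nra.
Qed.

Lemma small_factor A B : 0 < A -> 0 <= B -> exists e, 0 < e <= 1 /\ B * e <= A.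
Proof.
  intros HA HB; exists (Rmin 1 (A / (B + 1))).
  assert (0 < A / (B + 1)) by (apply Rdiv_lt_0_compat; lra).
  split; [split; [apply Rmin_pos; lra | apply Rmin_l]|].
  assert (Hle : Rmin 1 (A / (B + 1)) <= A / (B + 1)) by apply Rmin_r.
  assert (0 < Rmin 1 (A / (B + 1))) by (apply Rmin_pos; lra).
  apply Rmult_le_compat_l with (r := B + 1) in Hle; [|lra].
  replace ((B + 1) * (A / (B + 1))) with A in Hle by (field; lra); lra.
Qed.

(** Taking alpha = 2 reverses the sign of the x^(2k+2) term. The price, 2 [threshold k] y^(4k+4), is
    of higher degree than m y^(2s+4) and is absorbed by half of it near the origin. *)
Lemma repeller_pos k s m : (1 <= k)%nat -> (1 <= s)%nat -> (s < 2 * k)%nat -> 0 < m ->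
  repeller (sysf k) (sysg s m).
Proof.
  intros Hk Hs Hsk Hm.
  pose proof (threshold_pos k) as HT.
  destruct (small_factor (m / 2) (2 * threshold k)) as [e [He1 He2]]; try lra.
  apply (averaged_attractor k s m (-1) 2 (Rmin 1 (m / 2)) e); auto; try lra.
  - apply Rmin_pos; lra.
  - rewrite Rabs_left; lra.
  - intros; ring.
  - intros; ring.
  - intros a b Hb.
    pose proof (pow_double_ge0 a (k + 1)).
    pose proof (pow_double_gap b e (s + 2) (2 * (k + 1)) ltac:(lra) Hb ltac:(lia)) as H1.
    pose proof (pow_double_le b (s + 2) (2 * (k + 1)) ltac:(lra) ltac:(lia)) as H3.
    pose proof (pow_double_ge0 b (2 * (k + 1))) as H2.
    pose proof (pow_double_ge0 b (s + 2)) as H4.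
    replace (2 * (s + 2))%nat with (2 * s + 4)%nat in * by lia.
    replace (2 * (2 * (k + 1)))%nat with (4 * (k + 1))%nat in * by lia.
    set (u := a ^ (2 * (k + 1))) in *; set (v := b ^ (4 * (k + 1))) in *.
    set (w := b ^ (2 * s + 4)) in *.
    assert (2 * threshold k * v <= m / 2 * w).
    { apply Rle_trans with (2 * threshold k * (e * w)); [apply Rmult_le_compat_l; lra|].
      replace (2 * threshold k * (e * w)) with ((2 * threshold k * e) * w) by ring.
      apply Rmult_le_compat_r; lra. }
    assert (Rmin 1 (m / 2) * u <= 1 * u) by (apply Rmult_le_compat_r; [lra|apply Rmin_l]).
    assert (Rmin 1 (m / 2) * v <= m / 2 * v) by (apply Rmult_le_compat_r; [lra|apply Rmin_r]).
    nra.
Qed.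

(** With alpha = 1/2 the dissipation is shared between x and y; the term in m, whatever its sign, is
    of higher degree than the y part. *)
Lemma attractor_high k s m : (1 <= k)%nat -> (1 <= s)%nat -> (2 * k < s)%nat ->
  attractor (sysf k) (sysg s m).
Proof.
  intros Hk Hs Hsk.
  pose proof (threshold_pos k) as HT.
  destruct (small_factor (threshold k / 4) (Rabs m)) as [e [He1 He2]];
    [lra | apply Rabs_pos|].
  apply (averaged_attractor k s m 1 (1 / 2) (Rmin (1 / 2) (threshold k / 4)) e); auto; try lra.
  - apply Rmin_pos; lra.
  - apply Rabs_R1.
  - intros; ring.
  - intros; ring.
  - intros a b Hb.
    pose proof (pow_double_ge0 a (k + 1)).
    pose proof (pow_double_gap b e (2 * (k + 1)) (s + 2) ltac:(lra) Hb ltac:(lia)) as H1.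
    pose proof (pow_double_ge0 b (2 * (k + 1))) as H2.
    pose proof (pow_double_ge0 b (s + 2)) as H4.
    replace (2 * (s + 2))%nat with (2 * s + 4)%nat in * by lia.
    replace (2 * (2 * (k + 1)))%nat with (4 * (k + 1))%nat in * by lia.
    set (u := a ^ (2 * (k + 1))) in *; set (v := b ^ (4 * (k + 1))) in *.
    set (w := b ^ (2 * s + 4)) in *.
    assert (m * w <= threshold k / 4 * v).
    { pose proof (Rle_abs m); pose proof (Rabs_pos m).
      apply Rle_trans with (Rabs m * (e * v)); [nra|].
      replace (Rabs m * (e * v)) with ((Rabs m * e) * v) by ring.
      apply Rmult_le_compat_r; lra. }
    assert (Rmin (1 / 2) (threshold k / 4) * u <= 1 / 2 * u) by
      (apply Rmult_le_compat_r; [lra|apply Rmin_l]).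
    assert (Rmin (1 / 2) (threshold k / 4) * v <= threshold k / 4 * v) by
      (apply Rmult_le_compat_r; [lra|apply Rmin_r]).
    nra.
Qed.

(** Both y terms now have degree 4k+4. Choosing alpha T halfway between m and T makes 1 - alpha = (T
    - m)/(2T) and alpha T - m = (T - m)/2, so that both coefficients have the sign of T - m; sigma
    selects the direction of time. *)
Lemma threshold_dichotomy k m : (1 <= k)%nat ->
  (m < threshold k -> attractor (sysf k) (sysg (2 * k) m)) /\
  (threshold k < m -> repeller (sysf k) (sysg (2 * k) m)).
Proof.
  intros Hk; pose proof (threshold_pos k) as HT.
  set (T := threshold k) in *; set (alpha := (m / T + 1) / 2).
  assert (HaT : alpha * T = (m + T) / 2) by (unfold alpha; field; lra).
  assert (Hgap : forall sigma, sigma = 1 \/ sigma = -1 -> 0 < sigma * (T - m) ->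
    forall f g, (forall a b, f a b = sigma * sysf k a b) ->
    (forall a b, g a b = sigma * sysg (2 * k) m a b) -> attractor f g).
  { intros sigma Hs Hpos f g Hf Hg.
    set (c := Rmin (sigma * (1 - alpha)) (sigma * (T - m) / 2)).
    assert (0 < sigma * (1 - alpha)).
    { replace (sigma * (1 - alpha)) with (sigma * (T - m) / 2 / T)
        by (unfold alpha; field; lra).
      apply Rdiv_lt_0_compat; lra. }
    apply (averaged_attractor k (2 * k) m sigma alpha c 1); auto; try lra; try lia.
    - apply Rmin_pos; lra.
    - destruct Hs as [->| ->]; [apply Rabs_R1 | rewrite Rabs_left; lra].
    - intros a b _; fold T; rewrite HaT.
      pose proof (pow_double_ge0 a (k + 1)).
      pose proof (pow_double_ge0 b (2 * (k + 1))) as H2.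
      replace (2 * (2 * k) + 4)%nat with (4 * (k + 1))%nat by lia.
      replace (2 * (2 * (k + 1)))%nat with (4 * (k + 1))%nat in * by lia.
      set (u := a ^ (2 * (k + 1))) in *; set (v := b ^ (4 * (k + 1))) in *.
      assert (c * u <= sigma * (1 - alpha) * u) by
        (apply Rmult_le_compat_r; [lra|apply Rmin_l]).
      assert (c * v <= sigma * (T - m) / 2 * v) by
        (apply Rmult_le_compat_r; [lra|apply Rmin_r]).
      lra. }
  split; intros Hm.
  - apply (Hgap 1); try lra; intros; ring.
  - apply (Hgap (-1)); try lra; intros; ring.
Qed.

(** * The critical parameter m = 3/5 for k = 1 *)

Lemma lin_monomial_bound c i j a b n : (n <= 2 * i + j)%nat -> gauge a b <= 1 ->
  Rabs (c * a ^ i * b ^ j) <= Rabs c * gauge a b ^ n.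
Proof.
  intros Hn Hg; rewrite Rmult_assoc, Rabs_mult.
  apply Rmult_le_compat_l; [apply Rabs_pos|].
  eapply Rle_trans; [apply monomial_gauge | apply gauge_pow_le1; auto].
Qed.

Lemma Rabs_sum_le u v A B : Rabs u <= A -> Rabs v <= B -> Rabs (u + v) <= A + B.
Proof. intros; eapply Rle_trans; [apply Rabs_triang | lra]. Qed.

(** Exponents 0 and 1 are kept so that every term has the shape required by [lin_monomial_bound]. *)
Definition bautin_W (a b : R) : R :=
  1 / 50 * a ^ 0 * b ^ 10 + (- (3 / 5)) * a ^ 1 * b ^ 5 + (- (37 / 385)) * a ^ 1 * b ^ 11 +
  1 * a ^ 2 * b ^ 6 + (-1) * a ^ 3 * b ^ 1 + (- (163 / 105)) * a ^ 3 * b ^ 7 +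
  3 / 2 * a ^ 4 * b ^ 2 + (- (32 / 15)) * a ^ 5 * b ^ 3 + (-1) * a ^ 7 * b ^ 1.

Definition bautin_Wx (a b : R) : R :=
  - (3 / 5) * b ^ 5 - 37 / 385 * b ^ 11 + 2 * a * b ^ 6 - 3 * a ^ 2 * b -
  163 / 35 * a ^ 2 * b ^ 7 + 6 * a ^ 3 * b ^ 2 - 32 / 3 * a ^ 4 * b ^ 3 - 7 * a ^ 6 * b.

Definition bautin_Wy (a b : R) : R :=
  1 / 5 * b ^ 9 - 3 * a * b ^ 4 - 37 / 35 * a * b ^ 10 + 6 * a ^ 2 * b ^ 5 - a ^ 3 -
  163 / 15 * a ^ 3 * b ^ 6 + 3 * a ^ 4 * b - 32 / 5 * a ^ 5 * b ^ 2 - a ^ 7.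

(** What the corrections leave beyond the terms that decide the sign: weights 17 and 19, against a
    decay of order 16. *)
Definition bautin_rem (a b : R) : R :=
  (- (111 / 175)) * a ^ 1 * b ^ 15 + (- (12366 / 1925)) * a ^ 3 * b ^ 11 +
  143 / 175 * a ^ 5 * b ^ 7 + 32 / 3 * a ^ 7 * b ^ 3 + (- (3 / 5)) * a ^ 7 * b ^ 5 +
  7 * a ^ 9 * b ^ 1.

Lemma bautin_partials : has_partials bautin_W bautin_Wx bautin_Wy.
Proof.
  intros x y t x' y' Hx Hy; unfold bautin_W, bautin_Wx, bautin_Wy; auto_derive.
  - repeat split; try exact I; try (exists x'; exact Hx); exists y'; exact Hy.
  - replace (Derive _ t) with x' by (symmetry; apply is_derive_unique; exact Hx).
    replace (Derive _ t) with y' by (symmetry; apply is_derive_unique; exact Hy).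
    simpl INR; field.
Qed.

Lemma bautin_dot a b :
  (a + bautin_Wx a b) * - sysf 1 a b + (b ^ 3 + bautin_Wy a b) * - sysg 2 (3 / 5) a b =
  - (46 / 1925 * b ^ 14 + 2 / 5 * a ^ 6 * b ^ 2 - 7 * a ^ 6 * b ^ 4 + a ^ 8) - bautin_rem a b.
Proof.
  unfold bautin_Wx, bautin_Wy, bautin_rem, sysf, sysg; simpl Nat.mul; simpl Nat.add; field.
Qed.

(* At the critical parameter the terms of weight 8 and 11 average to zero.  The corrections
   of weight 7, 10 and 13 leave a positive definite part of weight 14, except on y = 0, where
   -x^7 y supplies x^8. *)
Lemma repeller_critical : repeller (sysf 1) (sysg 2 (3 / 5)).
Proof.
  (* 100 is a crude bound for the coefficients of W. The coefficients of the remainder sum to at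
     most 27 and 5400 = 27 * 200, so the remainder costs at most gauge^16 / 200. The same amount is
     left as decay, because 2/200 is below 46/1925 and gauge^16 <= a^8 + b^16. *)
  apply (gauge_attractor _ _ bautin_W bautin_Wx bautin_Wy 100 (1 / 5400) (1 / 200) 4);
    try lra.
  - exact bautin_partials.
  - intros a b Hg; pose proof (gauge_ge0 a b) as Hp; unfold bautin_W.
    apply Rle_trans with
      ((Rabs (1 / 50) + Rabs (- (3 / 5)) + Rabs (- (37 / 385)) + Rabs 1 + Rabs (-1) +
        Rabs (- (163 / 105)) + Rabs (3 / 2) + Rabs (- (32 / 15)) + Rabs (-1)) * gauge a b ^ 5).
    + rewrite !Rmult_plus_distr_r.
      repeat apply Rabs_sum_le; apply lin_monomial_bound; try lra; lia.
    + apply Rmult_le_compat_r; [apply pow_le; assumption|].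
      rewrite ?Rabs_Ropp, (Rabs_left (-1)), !Rabs_pos_eq by lra; lra.
  - intros a b Hg; pose proof (gauge_ge0 a b) as Hp.
    rewrite bautin_dot.
    assert (Hrem : Rabs (bautin_rem a b) <= 27 * gauge a b ^ 17).
    { unfold bautin_rem; apply Rle_trans with
      ((Rabs (- (111 / 175)) + Rabs (- (12366 / 1925)) + Rabs (143 / 175) + Rabs (32 / 3) +
        Rabs (- (3 / 5)) + Rabs 7) * gauge a b ^ 17).
      - rewrite !Rmult_plus_distr_r.
        repeat apply Rabs_sum_le; apply lin_monomial_bound; try lra; lia.
      - apply Rmult_le_compat_r; [apply pow_le; assumption|].
        rewrite ?Rabs_Ropp, !Rabs_pos_eq by lra; lra. }
    pose proof (Rle_abs (- bautin_rem a b)) as Ha; rewrite Rabs_Ropp in Ha.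
    pose proof (gauge_le_pows 4 a b) as Hr; simpl Nat.mul in *.
    assert (27 * gauge a b ^ 17 <= 1 / 200 * gauge a b ^ 16).
    { replace (gauge a b ^ 17) with (gauge a b * gauge a b ^ 16) by ring.
      pose proof (pow_le _ 16 Hp); nra. }
    assert (Hb : b ^ 2 <= 1 / 5400).
    { pose proof (gauge_abs2 a b); pose proof (Rabs_pos b); rewrite <- pow2_abs; nra. }
    pose proof (pow2_ge_0 b) as Hb0.
    assert (0 <= a ^ 6) by apply (pow_double_ge0 a 3).
    assert (0 <= a ^ 8) by apply (pow_double_ge0 a 4).
    assert (0 <= b ^ 14) by apply (pow_double_ge0 b 7).
    assert (b ^ 16 <= b ^ 14) by (replace (b ^ 16) with (b ^ 2 * b ^ 14) by ring; nra).
    assert (7 * a ^ 6 * b ^ 4 <= 2 / 5 * a ^ 6 * b ^ 2).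
    { replace (7 * a ^ 6 * b ^ 4) with (a ^ 6 * b ^ 2 * (7 * b ^ 2)) by ring.
      assert (0 <= a ^ 6 * b ^ 2) by (apply Rmult_le_pos; assumption); nra. }
    lra.
Qed.

(** * Generalized trigonometric functions *)

Lemma is_derive_eq (h : R -> R) (t l l' : R) : is_derive h t l -> l = l' -> is_derive h t l'.
Proof. intros H <-; exact H. Qed.

Lemma mean_value (h h' : R -> R) a b : (forall t, is_derive h t (h' t)) ->
  exists xi, Rmin a b <= xi <= Rmax a b /\ h b - h a = h' xi * (b - a).
Proof.
  intros Hd; destruct (MVT_gen h a b h') as [xi Hxi].
  - intros; apply Hd.
  - intros; eapply is_derive_continuity_pt, Hd.
  - exists xi; exact Hxi.
Qed.

Lemma increasing_of_derive_pos (h h' : R -> R) : (forall t, is_derive h t (h' t)) ->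
  (forall t, 0 < h' t) -> forall a b, a < b -> h a < h b.
Proof.
  intros Hd Hp a b Hab; destruct (mean_value h h' a b Hd) as [xi [_ E]].
  specialize (Hp xi); nra.
Qed.

Lemma injective_of_derive_pos (h h' : R -> R) : (forall t, is_derive h t (h' t)) ->
  (forall t, 0 < h' t) -> forall a b, h a = h b -> a = b.
Proof.
  intros Hd Hp a b Hab.
  pose proof (increasing_of_derive_pos h h' Hd Hp) as Hi.
  destruct (Rtotal_order a b) as [L|[E|L]]; [|assumption|]; apply Hi in L; lra.
Qed.

Lemma constant_of_derive_0 (h : R -> R) : (forall t, is_derive h t 0) ->
  forall a b, h a = h b.
Proof.
  intros Hd a b; destruct (mean_value h (fun _ => 0) a b Hd) as [xi [_ E]]; lra.
Qed.

Lemma is_derive_shift (h : R -> R) (t c l : R) : is_derive h (t + c) l ->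
  is_derive (fun u => h (u + c)) t l.
Proof.
  intros H; apply is_derive_eq with (1 * l); [|ring].
  apply (is_derive_comp h (fun u => u + c)); [exact H|].
  auto_derive; [exact I | reflexivity].
Qed.

(* The solution is the inverse of the primitive of 1/f. *)
Lemma autonomous_solution (f : R -> R) (w lo hi : R) :
  (forall s, continuous f s) -> 0 < lo -> (forall s, lo <= f s <= hi) -> 0 < w ->
  (forall s, f (s + w) = f s) ->
  exists (th : R -> R) (P : R), 0 < P /\ th 0 = 0 /\
    (forall t, is_derive th t (f (th t))) /\
    (forall s, exists t, th t = s) /\ (forall t, th (t + P) = th t + w).
Proof.
  intros Hf Hlo Hb Hw Hper.
  assert (Hinv : forall s, continuous (fun s => / f s) s).
  { intros s; apply (continuous_comp f Rinv); [apply Hf|].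
    specialize (Hb s); apply continuity_pt_filterlim.
    apply (continuity_pt_inv (fun u => u)); [apply continuity_pt_id | lra]. }
  set (T := (fun s => RInt (fun s => / f s) 0 s) : R -> R).
  assert (HT : forall s, is_derive T s (/ f s)).
  { intros s; apply (is_derive_RInt (fun s => / f s) T 0 s); [|apply Hinv].
    apply filter_forall; intros u; apply (RInt_correct (fun s => / f s) 0 u).
    apply (ex_RInt_continuous (fun s => / f s)); intros; apply Hinv. }
  assert (HT0 : T 0 = 0) by (unfold T; apply (RInt_point 0 (fun s => / f s))).
  assert (Hp : forall s, 0 < / f s) by (intros s; apply Rinv_0_lt_compat; specialize (Hb s); lra).
  assert (Hinj : forall a b, T a = T b -> a = b) by
    exact (injective_of_derive_pos T _ HT Hp).
  (* The mean value theorem solved for the increment of the argument. It shows that T is unbounded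
     on both sides, and it gives the difference quotient of the inverse. *)
  assert (Hmv : forall a b, exists xi, Rmin a b <= xi <= Rmax a b /\ b - a = f xi * (T b - T a)).
  { intros a b; destruct (mean_value T _ a b HT) as [xi [Hxi E]].
    exists xi; split; [assumption|]; rewrite E; field; specialize (Hb xi); lra. }
  assert (Hhi : 0 < hi) by (specialize (Hb 0); lra).
  assert (HTc : continuity T) by (intros s; eapply is_derive_continuity_pt, HT).
  assert (Hsurj : forall t, { s | T s = t }).
  { intros t.
    assert (Hend : T (- (hi * Rabs t)) <= t <= T (hi * Rabs t)).
    { pose proof (Rle_abs t); pose proof (Rle_abs (- t)); rewrite Rabs_Ropp in *.
      destruct (Hmv 0 (hi * Rabs t)) as [x1 [_ E1]].
      destruct (Hmv 0 (- (hi * Rabs t))) as [x2 [_ E2]].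
      rewrite HT0 in *; pose proof (Hb x1); pose proof (Hb x2); split; nra. }
    destruct (IVT_gen T (- (hi * Rabs t)) (hi * Rabs t) t HTc) as [s [_ Hs]].
    - split; [eapply Rle_trans; [apply Rmin_l | apply Hend] |
              eapply Rle_trans; [apply Hend | apply Rmax_r]].
    - exists s; exact Hs. }
  set (th := fun t => proj1_sig (Hsurj t)).
  assert (HTth : forall t, T (th t) = t) by (intros t; exact (proj2_sig (Hsurj t))).
  assert (HthT : forall s, th (T s) = s) by (intros s; apply Hinj, HTth).
  exists th, (T w); split; [|split; [|split; [|split]]].
  - rewrite <- HT0; apply (increasing_of_derive_pos T _ HT Hp); exact Hw.
  - rewrite <- HT0 at 1; apply HthT.
  - intros t; apply is_derive_Reals; intros eps Heps.
    pose proof (Hf (th t)) as Hc; apply continuity_pt_filterlim in Hc.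
    destruct (Hc eps Heps) as [d [Hd Hcd]].
    assert (Hdh : 0 < d / hi) by (apply Rdiv_lt_0_compat; lra).
    exists (mkposreal _ Hdh); intros h Hh Hhd; simpl in Hhd.
    destruct (Hmv (th t) (th (t + h))) as [xi [Hxi E]].
    rewrite !HTth in E; replace (t + h - t) with h in E by ring.
    replace ((th (t + h) - th t) / h) with (f xi) by (rewrite E; field; exact Hh).
    destruct (Req_dec xi (th t)) as [->|Hne];
      [unfold Rminus; rewrite Rplus_opp_r, Rabs_R0; exact Heps|].
    apply Hcd; split; [split; [exact I | intro; subst; auto]|].
    simpl; unfold Rdist.
    assert (Rabs (xi - th t) <= Rabs (th (t + h) - th t)).
    { unfold Rmin, Rmax in Hxi; destruct (Rle_dec (th t) (th (t + h)));
        [rewrite !Rabs_pos_eq by lra | rewrite !Rabs_left1 by lra]; lra. }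
    rewrite E, Rabs_mult in H; pose proof (Hb xi).
    rewrite (Rabs_pos_eq (f xi)) in H by lra.
    assert (hi * Rabs h < d).
    { apply Rmult_lt_compat_l with (r := hi) in Hhd; [|exact Hhi].
      replace (hi * (d / hi)) with d in Hhd by (field; lra); exact Hhd. }
    pose proof (Rabs_pos h); nra.
  - intros s; exists (T s); apply HthT.
  - intros t.
    (* By periodicity of f, T (s + w) - T s has zero derivative; hence T w is the time taken to
       advance by w. *)
    assert (E : forall s, T (s + w) = T s + T w).
    { intros s.
      assert (D : forall u, is_derive (fun u => T (u + w) - T u) u 0).
      { intros u; apply is_derive_eq with (/ f (u + w) - / f u);
          [|rewrite Hper; ring].
        apply (is_derive_minus (fun u => T (u + w)) T); [|apply HT].
        apply is_derive_shift, HT. }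
      pose proof (constant_of_derive_0 _ D s 0) as E; simpl in E.
      rewrite HT0, Rplus_0_l in E; lra. }
    apply Hinj; rewrite E, !HTth; reflexivity.
Qed.

(** On the unit circle 2 sin^2 + cos^4 = 1 + sin^4, so this is the weighted radius of a circle
    point, and dividing by it with weights 2 and 1 lands on the curve. *)
Definition quartic (th : R) : R := sqrt (sqrt (1 + sin th ^ 4)).

Lemma quartic_facts th : 1 <= quartic th /\ quartic th ^ 4 = 1 + sin th ^ 4.
Proof.
  pose proof (pow_double_ge0 (sin th) 2) as Hs; simpl Nat.mul in Hs.
  unfold quartic; split.
  - rewrite <- sqrt_1 at 1; apply sqrt_le_1_alt.
    rewrite <- sqrt_1 at 1; apply sqrt_le_1_alt; lra.
  - replace 4%nat with (2 * 2)%nat by reflexivity; rewrite (pow_mult _ 2 2).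
    rewrite pow2_sqrt by apply sqrt_pos; apply pow2_sqrt; simpl Nat.mul; lra.
Qed.

Lemma quartic_derive th : is_derive quartic th (sin th ^ 3 * cos th / quartic th ^ 3).
Proof.
  pose proof (pow_double_ge0 (sin th) 2) as Hs; simpl Nat.mul in Hs.
  destruct (quartic_facts th) as [H1 H2].
  assert (Hq : sqrt (1 + sin th ^ 4) = quartic th ^ 2).
  { unfold quartic; rewrite pow2_sqrt by apply sqrt_pos; reflexivity. }
  unfold quartic; auto_derive.
  - repeat split; try lra; apply sqrt_lt_R0; lra.
  - change (sin th * (sin th * (sin th * (sin th * 1)))) with (sin th ^ 4).
    fold (quartic th); rewrite Hq; field; lra.
Qed.

Lemma cos_sqr th : cos th ^ 2 = 1 - sin th ^ 2.
Proof. pose proof (sin2_cos2 th) as E; unfold Rsqr in E; lra. Qed.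

Definition curve_sin (th : R) : R := sin th / quartic th ^ 2.
Definition curve_cos (th : R) : R := cos th / quartic th.
Definition curve_speed (th : R) : R := quartic th ^ 3 / (1 + sin th ^ 2).

Lemma curve_equation th : 2 * curve_sin th ^ 2 + curve_cos th ^ 4 = 1.
Proof.
  destruct (quartic_facts th) as [H1 H2]; unfold curve_sin, curve_cos.
  replace (2 * (sin th / quartic th ^ 2) ^ 2 + (cos th / quartic th) ^ 4) with
    ((2 * sin th ^ 2 + (cos th ^ 2) ^ 2) / quartic th ^ 4) by (field; lra).
  rewrite cos_sqr, H2; field; pose proof (pow2_ge_0 (sin th ^ 2)); nra.
Qed.

Lemma curve_sin_derive th :
  is_derive curve_sin th (curve_cos th ^ 3 / curve_speed th).
Proof.
  destruct (quartic_facts th) as [H1 H2]; pose proof (pow2_ge_0 (sin th)).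
  assert (H3 : quartic th ^ 4 <> 0) by (apply pow_nonzero; lra).
  unfold curve_sin, curve_cos, curve_speed; auto_derive.
  - split; [eexists; apply quartic_derive | split; [|exact I]].
    repeat apply Rmult_integral_contrapositive_currified; lra.
  - replace (Derive _ th) with (sin th ^ 3 * cos th / quartic th ^ 3)
      by (symmetry; apply is_derive_unique, quartic_derive).
    transitivity (cos th * (quartic th ^ 4 - 2 * sin th ^ 4) / quartic th ^ 6);
      [field; lra|].
    rewrite H2; transitivity (cos th * cos th ^ 2 * (1 + sin th ^ 2) / quartic th ^ 6);
      [rewrite cos_sqr; field; lra | field; split; lra].
Qed.

Lemma curve_cos_derive th :
  is_derive curve_cos th (- curve_sin th / curve_speed th).
Proof.
  destruct (quartic_facts th) as [H1 H2]; pose proof (pow2_ge_0 (sin th)).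
  unfold curve_sin, curve_cos, curve_speed; auto_derive.
  - split; [eexists; apply quartic_derive | split; [lra | exact I]].
  - replace (Derive _ th) with (sin th ^ 3 * cos th / quartic th ^ 3)
      by (symmetry; apply is_derive_unique, quartic_derive).
    transitivity (- sin th * (quartic th ^ 4 + sin th ^ 2 * cos th ^ 2) / quartic th ^ 5);
      [field; lra|].
    rewrite H2, cos_sqr; field; split; lra.
Qed.

(** With v the square of [quartic], the equation is sin^2 + cos^2 = 1. Its left side increases with
    v, so a point of the curve determines v, and thereby sin and cos. *)
Lemma curve_radius_inj s c v v' : 0 < v -> 0 < v' ->
  s ^ 2 * v ^ 2 + c ^ 2 * v = 1 -> s ^ 2 * v' ^ 2 + c ^ 2 * v' = 1 -> v = v'.
Proof.
  intros Hv Hv' E E'.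
  assert ((v - v') * (s ^ 2 * (v + v') + c ^ 2) = 0) by nra.
  apply Rmult_integral in H as [|H]; [lra|exfalso].
  pose proof (pow2_ge_0 s); pose proof (pow2_ge_0 c).
  assert (s ^ 2 = 0) by nra; assert (c ^ 2 = 0) by nra; nra.
Qed.

Lemma curve_radius th :
  curve_sin th ^ 2 * (quartic th ^ 2) ^ 2 + curve_cos th ^ 2 * quartic th ^ 2 = 1.
Proof.
  destruct (quartic_facts th); unfold curve_sin, curve_cos.
  transitivity (sin th ^ 2 + cos th ^ 2); [field; lra | rewrite cos_sqr; ring].
Qed.

Lemma angle_exists s c : s ^ 2 + c ^ 2 = 1 -> exists th, sin th = s /\ cos th = c.
Proof.
  intros E.
  assert (Hc : -1 <= c <= 1) by (pose proof (pow2_ge_0 s); nra).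
  assert (Hs : sin (acos c) = Rabs s).
  { rewrite sin_acos by assumption; rewrite <- sqrt_Rsqr_abs; f_equal; unfold Rsqr; lra. }
  destruct (Rle_dec 0 s).
  - exists (acos c); rewrite Hs, cos_acos, Rabs_pos_eq by assumption; auto.
  - exists (- acos c); rewrite sin_neg, cos_neg, Hs, cos_acos by assumption.
    rewrite Rabs_left by lra; split; ring.
Qed.

Lemma curve_surjective s c : 2 * s ^ 2 + c ^ 4 = 1 ->
  exists th, curve_sin th = s /\ curve_cos th = c.
Proof.
  intros E; pose proof (pow2_ge_0 s) as Hs; pose proof (pow2_ge_0 c) as Hc.
  (* On the curve the discriminant c^4 + 4 s^2 equals 1 + 2 s^2. The positive root v is taken in the
     rationalized form 2 / (c^2 + w), which remains valid at s = 0. *)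
  set (w := sqrt (1 + 2 * s ^ 2)).
  assert (Hw2 : w ^ 2 = 1 + 2 * s ^ 2) by (apply pow2_sqrt; lra).
  assert (Hw : 1 <= w) by (unfold w; rewrite <- sqrt_1 at 1; apply sqrt_le_1_alt; lra).
  set (v := 2 / (c ^ 2 + w)).
  assert (Hv : 0 < v) by (apply Rdiv_lt_0_compat; lra).
  assert (Hvq : s ^ 2 * v ^ 2 + c ^ 2 * v = 1).
  { unfold v; field_simplify_eq; [|lra].
    assert (4 * s ^ 2 = w ^ 2 - c ^ 4) by lra; nra. }
  set (q := sqrt v).
  assert (Hq2 : q ^ 2 = v) by (apply pow2_sqrt; lra).
  assert (Hq : 0 < q) by (apply sqrt_lt_R0; exact Hv).
  destruct (angle_exists (s * v) (c * q)) as [th [E1 E2]].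
  { rewrite <- Hvq, <- Hq2; ring. }
  assert (Hq4 : quartic th = q).
  { unfold quartic; rewrite E1.
    replace (1 + (s * v) ^ 4) with (v ^ 2).
    - rewrite sqrt_pow2 by lra; reflexivity.
    - replace (v ^ 2) with (v ^ 2 * (2 * s ^ 2 + c ^ 4)) by (rewrite E; ring).
      assert (c ^ 2 * v = 1 - s ^ 2 * v ^ 2) as Hcv by lra.
      transitivity (2 * s ^ 2 * v ^ 2 + (c ^ 2 * v) ^ 2); [ring|].
      rewrite Hcv; ring. }
  exists th; unfold curve_sin, curve_cos; rewrite Hq4, E1, E2, Hq2; split; field; lra.
Qed.

Lemma angle_unique_mod th1 th2 : sin th1 = sin th2 -> cos th1 = cos th2 ->
  exists n : Z, th1 = th2 + IZR n * (2 * PI).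
Proof.
  intros Hs Hc.
  assert (H1 : cos (th1 - th2) = 1).
  { rewrite cos_minus, Hs, Hc; pose proof (cos_sqr th2); lra. }
  assert (H2 : sin ((th1 - th2) / 2) = 0).
  { replace (th1 - th2) with (2 * ((th1 - th2) / 2)) in H1 by field.
    rewrite cos_2a_sin in H1.
    assert (sin ((th1 - th2) / 2) * sin ((th1 - th2) / 2) = 0) by lra.
    apply Rmult_integral in H; tauto. }
  apply sin_eq_0_0 in H2 as [n Hn]; exists n; lra.
Qed.

Lemma curve_injective_mod th1 th2 : curve_sin th1 = curve_sin th2 ->
  curve_cos th1 = curve_cos th2 -> exists n : Z, th1 = th2 + IZR n * (2 * PI).
Proof.
  intros E1 E2.
  destruct (quartic_facts th1) as [P1 _]; destruct (quartic_facts th2) as [P2 _].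
  assert (Q : quartic th1 ^ 2 = quartic th2 ^ 2).
  { apply (curve_radius_inj (curve_sin th1) (curve_cos th1)); try (apply pow_lt; lra);
      [apply curve_radius | rewrite E1, E2; apply curve_radius]. }
  assert (Q1 : quartic th1 = quartic th2) by nra.
  unfold curve_sin, curve_cos in *; rewrite Q1 in *.
  assert (quartic th2 ^ 2 <> 0) by (apply pow_nonzero; lra).
  apply angle_unique_mod.
  - apply Rmult_eq_reg_r with (/ quartic th2 ^ 2);
      [exact E1 | apply Rinv_neq_0_compat; assumption].
  - apply Rmult_eq_reg_r with (/ quartic th2);
      [exact E2 | apply Rinv_neq_0_compat; lra].
Qed.

Lemma curve_speed_bounds th : 1 / 2 <= curve_speed th <= 2.
Proof.
  destruct (quartic_facts th) as [H1 H2]; unfold curve_speed.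
  pose proof (pow2_ge_0 (sin th)) as Hs; pose proof (SIN_bound th) as Hb.
  assert (sin th ^ 2 <= 1) by nra.
  assert (1 <= quartic th ^ 3) by (rewrite <- (pow1 3); apply pow_incr; lra).
  assert (quartic th ^ 3 <= 2).
  { assert (quartic th ^ 3 <= quartic th * quartic th ^ 3) by nra.
    replace (quartic th * quartic th ^ 3) with (quartic th ^ 4) in H3 by ring.
    rewrite H2 in H3; replace (sin th ^ 4) with (sin th ^ 2 * sin th ^ 2) in H3 by ring; nra. }
  split; [apply (Rle_div_r (1 / 2)) | apply Rle_div_l]; lra.
Qed.

Lemma periodic_Z (h : R -> R) w : (forall t, h (t + w) = h t) ->
  forall (n : Z) t, h (t + IZR n * w) = h t.
Proof.
  intros Hp.
  assert (Hnat : forall (n : nat) t, h (t + INR n * w) = h t).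
  { induction n; intros t; [f_equal; simpl; ring|].
    rewrite S_INR; replace (t + (INR n + 1) * w) with ((t + INR n * w) + w) by ring.
    rewrite Hp; apply IHn. }
  intros n t; destruct (Z.le_ge_cases 0 n).
  - rewrite <- (Z2Nat.id n), <- INR_IZR_INZ by assumption; apply Hnat.
  - rewrite <- (Hnat (Z.to_nat (- n)) (t + IZR n * w)); f_equal.
    rewrite INR_IZR_INZ, Z2Nat.id, opp_IZR by lia; ring.
Qed.

(* The Hamiltonian flow is realized in closed form, up to the change of time given by
   [curve_speed], by the substitution S = sin / u^2, C = cos / u with u^4 = 1 + sin^4. *)
Lemma generalized_trig : exists (S C : R -> R) (w : R), 0 < w /\ S 0 = 0 /\ C 0 = 1 /\
  (forall t, is_derive S t (C t ^ 3)) /\ (forall t, is_derive C t (- S t)) /\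
  (forall t, 2 * S t ^ 2 + C t ^ 4 = 1) /\
  (forall t, S (t + w) = S t) /\ (forall t, C (t + w) = C t) /\
  (forall s c, 2 * s ^ 2 + c ^ 4 = 1 -> exists t, S t = s /\ C t = c) /\
  (forall t1 t2, S t1 = S t2 -> C t1 = C t2 -> exists n : Z, t1 = t2 + IZR n * w).
Proof.
  assert (Hsp : forall th, curve_speed (th + 2 * PI) = curve_speed th).
  { intros th; unfold curve_speed, quartic; rewrite sin_plus, sin_2PI, cos_2PI.
    rewrite !Rmult_0_r, Rmult_1_r, Rplus_0_r; reflexivity. }
  destruct (autonomous_solution curve_speed (2 * PI) (1 / 2) 2) as
    (th & w & Hw & Hth0 & Hd & Hsurj & Hper); try lra; try assumption.
  - intros s; unfold curve_speed.
    apply continuity_pt_filterlim; eapply is_derive_continuity_pt.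
    pose proof (pow2_ge_0 (sin s)).
    auto_derive; [|reflexivity].
    split; [eexists; apply quartic_derive | split; [simpl in H; lra | exact I]].
  - apply curve_speed_bounds.
  - pose proof PI_RGT_0; lra.
  - assert (Hpi : forall s, sin (s + 2 * PI) = sin s /\ cos (s + 2 * PI) = cos s).
    { intros s; rewrite sin_plus, cos_plus, sin_2PI, cos_2PI; split; ring. }
    exists (fun t => curve_sin (th t)), (fun t => curve_cos (th t)), w.
    assert (Hsp0 : forall t, 0 < curve_speed t) by
      (intros t; pose proof (curve_speed_bounds t); lra).
    repeat match goal with |- _ /\ _ => split end; try assumption.
    + unfold curve_sin; rewrite Hth0, sin_0; unfold Rdiv; ring.
    + unfold curve_cos, quartic; rewrite Hth0, sin_0, cos_0.
      rewrite pow_i, Rplus_0_r, !sqrt_1 by lia; field.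
    + intros t; eapply is_derive_eq.
      * apply (is_derive_comp curve_sin th); [apply curve_sin_derive | apply Hd].
      * pose proof (Hsp0 (th t)); unfold scal; simpl; unfold mult; simpl; field; lra.
    + intros t; eapply is_derive_eq.
      * apply (is_derive_comp curve_cos th); [apply curve_cos_derive | apply Hd].
      * pose proof (Hsp0 (th t)); unfold scal; simpl; unfold mult; simpl; field; lra.
    + intros t; apply curve_equation.
    + intros t; rewrite Hper; unfold curve_sin, quartic.
      destruct (Hpi (th t)) as [-> _]; reflexivity.
    + intros t; rewrite Hper; unfold curve_cos, quartic.
      destruct (Hpi (th t)) as [-> ->]; reflexivity.
    + intros s c Hsc; destruct (curve_surjective s c Hsc) as [u [E1 E2]].
      destruct (Hsurj u) as [t <-]; exists t; auto.
    + intros t1 t2 E1 E2; destruct (curve_injective_mod _ _ E1 E2) as [n Hn].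
      exists n; apply (injective_of_derive_pos th _ Hd (fun t => Hsp0 (th t))).
      rewrite Hn.
      (* Removing the mean slope makes the angle periodic, which converts n turns of the angle into
         n periods of time. *)
      pose proof (periodic_Z (fun t => th t - t * (2 * PI / w)) w) as Hz; simpl in Hz.
      rewrite <- (Rplus_0_r (th (t2 + IZR n * w))).
      assert (E : th (t2 + IZR n * w) - (t2 + IZR n * w) * (2 * PI / w) =
        th t2 - t2 * (2 * PI / w)).
      { apply Hz; intros u; rewrite Hper; field; lra. }
      replace ((t2 + IZR n * w) * (2 * PI / w)) with
        (t2 * (2 * PI / w) + IZR n * (2 * PI)) in E by (field; lra).
      lra.
Qed.

(** * Scalar differential equations *)

Lemma derive_domination (h g h' g' : R -> R) : (forall t, is_derive h t (h' t)) ->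
  (forall t, is_derive g t (g' t)) -> h 0 = 0 -> g 0 = 0 ->
  (forall t, Rabs (h' t) <= g' t) -> forall t, Rabs (h t) <= Rabs (g t).
Proof.
  intros Hh Hg H0 G0 Hb t.
  destruct (mean_value (fun t => g t - h t) (fun t => g' t - h' t) 0 t) as [x1 [_ E1]].
  { intros u; apply @is_derive_minus; auto. }
  destruct (mean_value (fun t => g t + h t) (fun t => g' t + h' t) 0 t) as [x2 [_ E2]].
  { intros u; apply @is_derive_plus; auto. }
  pose proof (Hb x1) as B1; pose proof (Hb x2) as B2; apply Rabs_le_between in B1, B2.
  apply Rabs_le; destruct (Rle_dec 0 t).
  - assert (0 <= g t - h t) by nra; assert (0 <= g t + h t) by nra.
    rewrite Rabs_pos_eq; lra.
  - assert (g t - h t <= 0) by nra; assert (g t + h t <= 0) by nra.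
    rewrite Rabs_left1; lra.
Qed.

(** D^2 exp(-2Lt) does not increase; the square avoids differentiating an absolute value. *)
Lemma gronwall_forward (D D' : R -> R) L : (forall t, is_derive D t (D' t)) ->
  (forall t, Rabs (D' t) <= L * Rabs (D t)) ->
  forall s t, s <= t -> Rabs (D t) <= Rabs (D s) * exp (L * (t - s)).
Proof.
  intros HD HL s t Hst.
  set (G := fun t => D t ^ 2 * exp (- (2 * L) * t)).
  set (G' := fun t => (2 * D t * D' t - 2 * L * D t ^ 2) * exp (- (2 * L) * t)).
  assert (HG : G t <= G s + 0 * (t - s)).
  { apply (decay_of_derivative G G'); [assumption| |]; intros u _.
    - unfold G, G'; auto_derive; [exists (D' u); apply HD|].
      replace (Derive _ u) with (D' u) by (symmetry; apply is_derive_unique, HD); ring.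
    - unfold G'; pose proof (exp_pos (- (2 * L) * u)).
      assert (D u * D' u <= L * D u ^ 2); [|nra].
      rewrite <- pow2_abs; specialize (HL u); pose proof (Rabs_pos (D u)).
      eapply Rle_trans; [apply Rle_abs|]; rewrite Rabs_mult; nra. }
  unfold G in HG; rewrite Rmult_0_l, Rplus_0_r in HG.
  apply Rsqr_incr_0_var;
    [|apply Rmult_le_pos; [apply Rabs_pos | left; apply exp_pos]].
  rewrite <- (Rmult_1_r (Rsqr (Rabs (D t)))), <- exp_0.
  replace 0 with (- (2 * L) * t + 2 * L * t) by ring.
  rewrite exp_plus, <- Rmult_assoc, Rsqr_mult, <- !Rsqr_abs.
  replace (exp (L * (t - s)))² with (exp (- (2 * L) * s) * exp (2 * L * t)).
  - rewrite <- Rmult_assoc; apply Rmult_le_compat_r; [left; apply exp_pos|].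
    unfold Rsqr; replace (D t * D t) with (D t ^ 2) by ring.
    replace (D s * D s) with (D s ^ 2) by ring; exact HG.
  - unfold Rsqr; rewrite <- !exp_plus; f_equal; ring.
Qed.

Lemma gronwall (D D' : R -> R) L : (forall t, is_derive D t (D' t)) ->
  (forall t, Rabs (D' t) <= L * Rabs (D t)) ->
  forall s t, Rabs (D t) <= Rabs (D s) * exp (L * Rabs (t - s)).
Proof.
  intros HD HL s t; destruct (Rle_dec s t).
  - rewrite (Rabs_pos_eq (t - s)) by lra; apply (gronwall_forward D D'); assumption.
  - rewrite (Rabs_left (t - s)) by lra.
    replace (L * - (t - s)) with (L * (- t - - s)) by ring.
    replace (D t) with (D (- - t)) by (f_equal; ring).
    replace (D s) with (D (- - s)) by (f_equal; ring).
    apply (gronwall_forward (fun u => D (- u)) (fun u => - D' (- u))); [| |lra].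
    + intros u; apply is_derive_eq with (-1 * D' (- u)); [|ring].
      apply (is_derive_comp D (fun u => - u)); [apply HD|].
      auto_derive; [exact I | reflexivity].
    + intros u; rewrite Rabs_Ropp; apply HL.
Qed.

Lemma gronwall_unique (D D' : R -> R) L s : (forall t, is_derive D t (D' t)) ->
  (forall t, Rabs (D' t) <= L * Rabs (D t)) -> D s = 0 -> forall t, D t = 0.
Proof.
  intros HD HL H0 t; pose proof (gronwall D D' L HD HL s t) as H.
  rewrite H0, Rabs_R0, Rmult_0_l in H; apply Rabs_eq_0.
  pose proof (Rabs_pos (D t)); lra.
Qed.

(** * Global solutions by Picard iteration in a weighted norm *)

Section Picard.

Variables (F : R -> R -> R) (z0 M L : R).
Hypothesis HL : 0 < L.
Hypothesis Hlip : forall t u v, Rabs (F t u - F t v) <= L * Rabs (u - v).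
Hypothesis Hbound : forall t u, Rabs (F t u) <= M.
Hypothesis Hcont : forall z : R -> R, (forall t, continuous z t) ->
  forall t, continuous (fun t => F t (z t)) t.

Definition picard_step (z : R -> R) (t : R) : R := z0 + RInt (fun s => F s (z s)) 0 t.

Lemma picard_step_derive z : (forall t, continuous z t) ->
  forall t, is_derive (picard_step z) t (F t (z t)).
Proof.
  intros Hz t; unfold picard_step.
  apply is_derive_eq with (0 + F t (z t)); [|ring].
  apply @is_derive_plus; [apply @is_derive_const|].
  apply (is_derive_RInt (fun s => F s (z s)) _ 0 t); [|apply (Hcont z Hz)].
  apply filter_forall; intros u; apply (RInt_correct (fun s => F s (z s)) 0 u).
  apply (ex_RInt_continuous (fun s => F s (z s))); intros; apply (Hcont z Hz).
Qed.

Lemma picard_step_0 z : picard_step z 0 = z0.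
Proof.
  unfold picard_step.
  replace (RInt (fun s => F s (z s)) 0 0) with 0; [ring|].
  symmetry; apply (RInt_point 0 (fun s => F s (z s))).
Qed.

Lemma picard_step_continuous z : (forall t, continuous z t) ->
  forall t, continuous (picard_step z) t.
Proof.
  intros Hz t; apply continuity_pt_filterlim.
  eapply is_derive_continuity_pt, picard_step_derive, Hz.
Qed.

Fixpoint picard_iter (n : nat) : R -> R :=
  match n with
  | O => fun _ => z0
  | S p => picard_step (picard_iter p)
  end.

Lemma picard_iter_continuous n : forall t, continuous (picard_iter n) t.
Proof.
  induction n; intros t; simpl; [apply continuous_const | apply picard_step_continuous, IHn].
Qed.

(* The weight for which one Picard step contracts by the factor 1/2, on both sides of 0. *)
Definition picard_weight (t : R) : R := exp (2 * L * t) + exp (- (2 * L) * t).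

(** The odd primitive of the weight is (exp(2Lt) - exp(-2Lt)) / (2L), bounded in absolute value by
    weight / (2L): the Lipschitz constant cancels and 1/2 remains. *)
Lemma picard_contraction u v c : (forall t, continuous u t) -> (forall t, continuous v t) ->
  (forall t, Rabs (u t - v t) <= c * picard_weight t) ->
  forall t, Rabs (picard_step u t - picard_step v t) <= c / 2 * picard_weight t.
Proof.
  intros Hu Hv Hc t.
  assert (Hc0 : 0 <= c).
  { specialize (Hc 0); pose proof (Rabs_pos (u 0 - v 0)); unfold picard_weight in Hc.
    rewrite !Rmult_0_r, exp_0 in Hc; lra. }
  set (g := fun t => c / 2 * (exp (2 * L * t) - exp (- (2 * L) * t))).
  apply Rle_trans with (Rabs (g t)).
  - apply (derive_domination (fun t => picard_step u t - picard_step v t) g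
      (fun t => F t (u t) - F t (v t)) (fun t => L * (c * picard_weight t))).
    + intros s; apply @is_derive_minus; apply picard_step_derive; assumption.
    + intros s; unfold g, picard_weight; auto_derive; [exact I | field].
    + rewrite !picard_step_0; ring.
    + unfold g; rewrite !Rmult_0_r; ring.
    + intros s; eapply Rle_trans; [apply Hlip|]; apply Rmult_le_compat_l; [lra | apply Hc].
  - unfold g, picard_weight; rewrite Rabs_mult, (Rabs_pos_eq (c / 2)) by lra.
    apply Rmult_le_compat_l; [lra|].
    pose proof (exp_pos (2 * L * t)); pose proof (exp_pos (- (2 * L) * t)).
    apply Rabs_le; lra.
Qed.

Lemma picard_weight_pos t : 0 < picard_weight t.
Proof.
  unfold picard_weight; pose proof (exp_pos (2 * L * t)); pose proof (exp_pos (- (2 * L) * t)).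
  lra.
Qed.

Lemma Rabs_le_weight t : Rabs t <= picard_weight t / (2 * L).
Proof.
  apply Rle_div_r; [lra|].
  pose proof (exp_ineq1_le (2 * L * t)); pose proof (exp_ineq1_le (- (2 * L) * t)).
  pose proof (exp_pos (2 * L * t)); pose proof (exp_pos (- (2 * L) * t)).
  unfold picard_weight; destruct (Rle_dec 0 t);
    [rewrite Rabs_pos_eq by lra | rewrite Rabs_left by lra]; lra.
Qed.

(** The first step moves by at most M |t|, which [Rabs_le_weight] bounds by this multiple of the
    weight. *)
Let K := M / (2 * L).

Lemma picard_iter_step n t :
  Rabs (picard_iter (S n) t - picard_iter n t) <= K / 2 ^ n * picard_weight t.
Proof.
  revert t; induction n; intros t.
  - assert (HM : 0 <= M) by (eapply Rle_trans; [apply Rabs_pos | apply (Hbound 0 0)]).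
    destruct (mean_value _ _ 0 t
      (picard_step_derive (picard_iter 0) (picard_iter_continuous 0))) as [xi [_ E]].
    rewrite picard_step_0 in E.
    change (picard_iter 1 t - picard_iter 0 t = F xi z0 * (t - 0)) in E.
    rewrite E, Rabs_mult, Rminus_0_r; simpl pow.
    apply Rle_trans with (M * (picard_weight t / (2 * L))).
    + apply Rmult_le_compat; auto using Rabs_pos, Rabs_le_weight.
    + right; unfold K; field; lra.
  - replace (K / 2 ^ S n) with (K / 2 ^ n / 2) by
      (simpl; field; apply pow_nonzero; lra).
    apply (picard_contraction (picard_iter (S n)) (picard_iter n));
      auto using picard_iter_continuous.
Qed.

Lemma picard_iter_tail n p t :
  Rabs (picard_iter (n + p) t - picard_iter n t) <= 2 * K / 2 ^ n * picard_weight t.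
Proof.
  pose proof (picard_weight_pos t) as Hw.
  assert (HK : 0 <= K).
  { assert (HM : 0 <= M) by (eapply Rle_trans; [apply Rabs_pos | apply (Hbound 0 0)]).
    unfold K; apply Rdiv_le_0_compat; lra. }
  (* The factor 1 - 1/2^p is the exact geometric sum, and makes the bound inductive in p. *)
  assert (H : Rabs (picard_iter (n + p) t - picard_iter n t) <=
    2 * K / 2 ^ n * (1 - / 2 ^ p) * picard_weight t).
  { induction p.
    - rewrite Nat.add_0_r; unfold Rminus at 1; rewrite Rplus_opp_r, Rabs_R0.
      simpl; rewrite Rinv_1; right; ring.
    - replace (n + S p)%nat with (S (n + p)) by lia.
      replace (picard_iter (S (n + p)) t - picard_iter n t) with
        ((picard_iter (S (n + p)) t - picard_iter (n + p) t) +
         (picard_iter (n + p) t - picard_iter n t)) by ring.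
      eapply Rle_trans; [apply Rabs_triang|].
      pose proof (picard_iter_step (n + p) t) as Hs.
      eapply Rle_trans; [apply Rplus_le_compat; [exact Hs | exact IHp]|].
      right; rewrite pow_add; simpl; field; split; apply pow_nonzero; lra. }
  eapply Rle_trans; [exact H|].
  assert (0 < / 2 ^ p) by (apply Rinv_0_lt_compat, pow_lt; lra).
  assert (0 <= 2 * K / 2 ^ n) by (apply Rdiv_le_0_compat; [lra | apply pow_lt; lra]).
  apply Rmult_le_compat_r; [lra|]; nra.
Qed.

Lemma geometric_small c eps : 0 < eps -> exists N, forall n, (N <= n)%nat -> c / 2 ^ n < eps.
Proof.
  intros He.
  destruct (archimed_cor1 (eps / (Rabs c + 1))) as [N [HN HN0]].
  { apply Rdiv_lt_0_compat; pose proof (Rabs_pos c); lra. }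
  exists N; intros n Hn.
  assert (H2n : INR n < 2 ^ n).
  { clear; induction n; [simpl; lra|]; rewrite S_INR; simpl.
    assert (1 <= 2 ^ n) by (apply pow_R1_Rle; lra); lra. }
  assert (0 < INR N <= INR n) by (split; [apply lt_0_INR; lia | apply le_INR; lia]).
  pose proof (Rabs_pos c); pose proof (Rle_abs c).
  apply Rlt_div_l; [apply pow_lt; lra|].
  apply Rmult_lt_compat_r with (r := (Rabs c + 1) * INR N) in HN;
    [|apply Rmult_lt_0_compat; lra].
  replace (/ INR N * ((Rabs c + 1) * INR N)) with (Rabs c + 1) in HN by (field; lra).
  replace (eps / (Rabs c + 1) * ((Rabs c + 1) * INR N)) with (eps * INR N) in HN
    by (field; lra).
  nra.
Qed.

Lemma le_of_geometric (x c y : R) : (forall n : nat, x <= y + c / 2 ^ n) -> x <= y.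
Proof.
  intros H; apply Rnot_lt_le; intros Hlt.
  destruct (geometric_small c (x - y)) as [N HN]; [lra|].
  specialize (HN N (le_n N)); specialize (H N); lra.
Qed.

(** The pointwise limit inherits the Lipschitz constant M of the iterates, hence is continuous, and
    the contraction makes it a fixed point. The existential is informative so that solutions can be
    selected as a function of the initial value. *)
Theorem picard_solution : { z : R -> R | z 0 = z0 /\
  forall t, is_derive z t (F t (z t)) }.
Proof.
  assert (Hlim : forall t, { l | is_lim_seq (fun n => picard_iter n t) (Finite l) }).
  { intros t; destruct (Rcomplete.R_complete (fun n => picard_iter n t)) as [l Hl].
    - intros eps Heps.
      destruct (geometric_small (2 * (2 * K * picard_weight t)) eps Heps) as [N HN].
      exists N; intros n m Hn Hm; unfold Rdist.
      specialize (HN N (le_n N)).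
      pose proof (picard_iter_tail N (n - N) t) as H1.
      pose proof (picard_iter_tail N (m - N) t) as H2.
      replace (N + (n - N))%nat with n in H1 by lia.
      replace (N + (m - N))%nat with m in H2 by lia.
      replace (2 * K / 2 ^ N * picard_weight t) with
        (2 * (2 * K * picard_weight t) / 2 ^ N / 2) in H1, H2
        by (field; apply pow_nonzero; lra).
      apply Rabs_le_between in H1, H2; apply Rabs_def1; lra.
    - exists l; apply is_lim_seq_Reals; exact Hl. }
  set (z := fun t => proj1_sig (Hlim t)).
  assert (Hz : forall t, is_lim_seq (fun n => picard_iter n t) (Finite (z t))) by
    (intros t; exact (proj2_sig (Hlim t))).
  assert (Hzn : forall n t, Rabs (z t - picard_iter n t) <= 2 * K / 2 ^ n * picard_weight t).
  { intros n t.
    apply (is_lim_seq_le (fun p => Rabs (picard_iter (p + n) t - picard_iter n t))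
      (fun _ => 2 * K / 2 ^ n * picard_weight t)
      (Finite (Rabs (z t - picard_iter n t))) (Finite (2 * K / 2 ^ n * picard_weight t))).
    - intros p; rewrite Nat.add_comm; apply picard_iter_tail.
    - apply (is_lim_seq_abs _ (Finite (z t - picard_iter n t))).
      apply is_lim_seq_minus'; [|apply is_lim_seq_const].
      apply (is_lim_seq_incr_n (fun p => picard_iter p t)), Hz.
    - apply is_lim_seq_const. }
  assert (Hcz : forall t, continuous z t).
  { intros t; apply continuity_pt_filterlim; intros eps Heps.
    assert (HM : 0 <= M) by (eapply Rle_trans; [apply Rabs_pos | apply (Hbound 0 0)]).
    exists (eps / (M + 1)); split; [apply Rdiv_lt_0_compat; lra|].
    intros s [_ Hs]; simpl in *; unfold Rdist in *.
    assert (Hl : Rabs (z s - z t) <= M * Rabs (s - t)).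
    { apply (le_of_geometric _ (2 * K * picard_weight s + 2 * K * picard_weight t)); intros n.
      pose proof (Hzn (S n) s) as H1; pose proof (Hzn (S n) t) as H2.
      assert (H3 : Rabs (picard_iter (S n) s - picard_iter (S n) t) <= M * Rabs (s - t)).
      { simpl; destruct (mean_value _ _ t s
          (picard_step_derive (picard_iter n) (picard_iter_continuous n))) as [xi [_ E]].
        rewrite E, Rabs_mult; apply Rmult_le_compat_r; [apply Rabs_pos | apply Hbound]. }
      replace (z s - z t) with ((z s - picard_iter (S n) s) +
        (picard_iter (S n) s - picard_iter (S n) t) - (z t - picard_iter (S n) t)) by ring.
      assert (Hhalf : forall x, 0 <= 2 * K / 2 ^ S n * picard_weight x <=
        2 * K * picard_weight x / 2 ^ n).
      { intros x; pose proof (picard_weight_pos x).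
        assert (0 <= K) by (unfold K; apply Rdiv_le_0_compat; lra).
        assert (0 < / 2 ^ n) by (apply Rinv_0_lt_compat, pow_lt; lra).
        replace (2 * K / 2 ^ S n * picard_weight x) with (K * picard_weight x * / 2 ^ n)
          by (simpl; field; apply pow_nonzero; lra).
        assert (0 <= K * picard_weight x) by nra.
        split; [nra | unfold Rdiv; nra]. }
      pose proof (Hhalf s); pose proof (Hhalf t).
      rewrite Rdiv_plus_distr.
      apply Rabs_le_between in H1, H2, H3; apply Rabs_le; lra. }
    eapply Rle_lt_trans; [exact Hl|].
    apply Rmult_lt_compat_l with (r := M + 1) in Hs; [|lra].
    replace ((M + 1) * (eps / (M + 1))) with eps in Hs by (field; lra).
    pose proof (Rabs_pos (s - t)); nra. }
  assert (Heq : forall t, picard_step z t = z t).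
  { intros t.
    assert (Hd : Rabs (picard_step z t - z t) <= 0).
    { apply (le_of_geometric _ (4 * K * picard_weight t)); intros n.
      pose proof (picard_contraction z (picard_iter n) (2 * K / 2 ^ n) Hcz
        (picard_iter_continuous n) (Hzn n) t) as H1.
      pose proof (Hzn (S n) t) as H2.
      change (picard_step (picard_iter n) t) with (picard_iter (S n) t) in H1.
      replace (2 * K / 2 ^ n / 2 * picard_weight t) with (K * picard_weight t / 2 ^ n) in H1
        by (field; apply pow_nonzero; lra).
      replace (2 * K / 2 ^ S n * picard_weight t) with (K * picard_weight t / 2 ^ n) in H2
        by (simpl; field; apply pow_nonzero; lra).
      replace (4 * K * picard_weight t / 2 ^ n) with (4 * (K * picard_weight t / 2 ^ n))
        by (field; apply pow_nonzero; lra).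
      pose proof (Rabs_pos (z t - picard_iter (S n) t)).
      apply Rabs_le_between in H1, H2; apply Rabs_le; lra. }
    pose proof (Rabs_pos (picard_step z t - z t)).
    assert (Rabs (picard_step z t - z t) = 0) by lra.
    apply Rabs_eq_0 in H0; lra. }
  exists z; split.
  - rewrite <- Heq; apply picard_step_0.
  - intros t; apply is_derive_ext with (picard_step z); [exact Heq|].
    apply picard_step_derive, Hcz.
Qed.

End Picard.

(** * Coefficients of the polar equation *)

(** Along an orbit r' = r^5 p, with p = - s^4 + m c^8, and the phase moves at rate r - r^4 q = r^4
    Z. Differentiating Z = 1/r^3 - q with respect to the phase gives a = -3p - q' and b = -3pq. *)
Definition rq (m s c : R) : R := s ^ 3 * c + 2 * m * (s * c ^ 5).

Definition ra (m s c : R) : R :=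
  4 * s ^ 4 + (10 * m - 3) * (s ^ 2 * c ^ 4) - 5 * m * c ^ 8.

Definition rb (m s c : R) : R :=
  3 * (s ^ 7 * c) + 6 * m * (s ^ 5 * c ^ 5) - 3 * m * (s ^ 3 * c ^ 9) -
  6 * m ^ 2 * (s * c ^ 13).

(* The correction A: its derivative along S' = C^3, C' = - S is exactly [- rb], for all m. *)
Definition cA (m s c : R) : R :=
  3 / 2 * (s ^ 6 * c ^ 2) + (3 / 2 + m) * (s ^ 4 * c ^ 6) +
  (3 / 5 + m / 10) * (s ^ 2 * c ^ 10) + (3 / 35 + m / 70 - 3 / 7 * m ^ 2) * c ^ 14.

(** The terms of weight 22 are fitted so that, at m = 3/5 and on the curve, A a - B' becomes a
    multiple of c^2. As this vanishes at c = 0, the last term, with derivative proportional to c^4 -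
    s^2, is added to make it positive there. *)
Definition cB (s c : R) : R :=
  393 / 3250 * (s * c ^ 19) - 491 / 3250 * (s ^ 3 * c ^ 15) - 5973 / 3250 * (s ^ 5 * c ^ 11) -
  9519 / 3250 * (s ^ 7 * c ^ 7) - 2226 / 1625 * (s ^ 9 * c ^ 3) + 48 / 1625 * (s * c).

(** The first two terms form a primitive of p at m = 3/5, where p has zero mean. The last one
    replaces the drift c^8, which vanishes at c = 0, by c^8 - c^4/2 + s^2/2, which is positive on
    the whole curve. *)
Definition cP (m s c : R) : R :=
  s ^ 3 * c + 3 / 5 * (s * c ^ 5) - (3 / 5 - m) / 2 * (s * c).

(* The derivative of [cB] along S' = C^3, C' = - S. *)
Definition cB' (s c : R) : R :=
  393 / 3250 * (c ^ 22 - 19 * s ^ 2 * c ^ 18) -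
  491 / 3250 * (3 * s ^ 2 * c ^ 18 - 15 * s ^ 4 * c ^ 14) -
  5973 / 3250 * (5 * s ^ 4 * c ^ 14 - 11 * s ^ 6 * c ^ 10) -
  9519 / 3250 * (7 * s ^ 6 * c ^ 10 - 7 * s ^ 8 * c ^ 6) -
  2226 / 1625 * (9 * s ^ 8 * c ^ 6 - 3 * s ^ 10 * c ^ 2) + 48 / 1625 * (c ^ 4 - s ^ 2).

(** * Uniform bounds and signs of the coefficients *)

Definition bounded3 (h : R -> R -> R -> R) : Prop :=
  exists K, 0 <= K /\ forall m s c, Rabs m <= 1 -> Rabs s <= 1 -> Rabs c <= 1 ->
    Rabs (h m s c) <= K.

Lemma bounded3_const k : bounded3 (fun _ _ _ => k).
Proof. exists (Rabs k); split; [apply Rabs_pos | intros; lra]. Qed.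

Lemma bounded3_1 : bounded3 (fun m _ _ => m).
Proof. exists 1; split; [lra | auto]. Qed.

Lemma bounded3_2 : bounded3 (fun _ s _ => s).
Proof. exists 1; split; [lra | auto]. Qed.

Lemma bounded3_3 : bounded3 (fun _ _ c => c).
Proof. exists 1; split; [lra | auto]. Qed.

Lemma bounded3_plus f g : bounded3 f -> bounded3 g ->
  bounded3 (fun m s c => f m s c + g m s c).
Proof.
  intros [K [HK Hf]] [L [HL Hg]]; exists (K + L); split; [lra|]; intros.
  apply Rabs_sum_le; auto.
Qed.

Lemma bounded3_opp f : bounded3 f -> bounded3 (fun m s c => - f m s c).
Proof. intros [K [HK Hf]]; exists K; split; [lra|]; intros; rewrite Rabs_Ropp; auto. Qed.

Lemma bounded3_mult f g : bounded3 f -> bounded3 g ->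
  bounded3 (fun m s c => f m s c * g m s c).
Proof.
  intros [K [HK Hf]] [L [HL Hg]]; exists (K * L); split; [nra|]; intros.
  rewrite Rabs_mult; apply Rmult_le_compat; auto using Rabs_pos.
Qed.

Lemma bounded3_pow f n : bounded3 f -> bounded3 (fun m s c => f m s c ^ n).
Proof.
  intros [K [HK Hf]]; exists (K ^ n); split; [apply pow_le; lra|]; intros.
  rewrite <- RPow_abs; apply pow_incr; split; [apply Rabs_pos | auto].
Qed.

Ltac bounded3_tac :=
  unfold rq, ra, rb, cA, cB, cP, cB', Rminus, Rdiv;
  repeat first [ apply bounded3_const | apply bounded3_1 | apply bounded3_2
               | apply bounded3_3 | apply bounded3_plus | apply bounded3_opp
               | apply bounded3_mult | apply bounded3_pow ].

Definition on_curve (s c : R) : Prop := 2 * s ^ 2 + c ^ 4 = 1.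

Lemma curve_bounds s c : on_curve s c -> Rabs s <= 1 /\ Rabs c <= 1.
Proof.
  unfold on_curve; intros E; pose proof (pow2_ge_0 s); pose proof (pow2_ge_0 (c ^ 2)).
  assert (c ^ 2 <= 1) by nra.
  split; apply Rabs_le; nra.
Qed.

Lemma kappa_identity m s c : cA m s c * ra m s c - cB' s c =
  96 / 1625 * (c ^ 2 * (2 * s ^ 2 + c ^ 4) ^ 5) + 48 / 1625 * (s ^ 2 - c ^ 4) +
  (m - 3 / 5) * (
    (3 / 10 + 17 / 14 * m + 15 / 7 * m ^ 2) * c ^ 22 -
    (111 / 35 + 23 / 14 * m + 30 / 7 * m ^ 2) * (s ^ 2 * c ^ 18) -
    (181 / 35 + 40 / 7 * m) * (s ^ 4 * c ^ 14) +
    (109 / 10 + 10 * m) * (s ^ 6 * c ^ 10) + 19 * (s ^ 8 * c ^ 6)).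
Proof. unfold cA, ra, cB'; field. Qed.

(* The integral of Aa over the curve is the second focal value at m = 3/5; it is positive,
   and [cB] is chosen so that Aa - B' is positive pointwise. *)
Lemma kappa_lower : exists mu, 0 < mu /\ forall m s c, on_curve s c ->
  Rabs (m - 3 / 5) <= mu -> 1 / 100 <= cA m s c * ra m s c - cB' s c.
Proof.
  assert (HR : bounded3 (fun m s c =>
    (3 / 10 + 17 / 14 * m + 15 / 7 * m ^ 2) * c ^ 22 -
    (111 / 35 + 23 / 14 * m + 30 / 7 * m ^ 2) * (s ^ 2 * c ^ 18) -
    (181 / 35 + 40 / 7 * m) * (s ^ 4 * c ^ 14) +
    (109 / 10 + 10 * m) * (s ^ 6 * c ^ 10) + 19 * (s ^ 8 * c ^ 6))) by bounded3_tac.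
  destruct HR as [K [HK HR]].
  (* At m = 3/5 the minimum over the curve is 24/1625, reached at c = 0; an error of 1/500 still
     leaves 1/100. *)
  destruct (small_factor (1 / 500) K) as [e [He1 He2]]; try lra.
  exists (Rmin (1 / 5) e); split; [apply Rmin_pos; lra|]; intros m s c Hsc Hm.
  pose proof (Rmin_l (1 / 5) e); pose proof (Rmin_r (1 / 5) e).
  destruct (curve_bounds s c Hsc) as [Hs Hc].
  assert (Hm1 : Rabs m <= 1).
  { apply Rabs_le_between in Hm; apply Rabs_le; lra. }
  specialize (HR m s c Hm1 Hs Hc).
  rewrite kappa_identity.
  match goal with |- _ <= _ + (m - 3 / 5) * ?r => set (R0 := r) in * end.
  assert (Hprod : Rabs ((m - 3 / 5) * R0) <= e * K).
  { rewrite Rabs_mult; apply Rmult_le_compat; auto using Rabs_pos; lra. }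
  rewrite Hsc, pow1, Rmult_1_r.
  pose proof (pow2_ge_0 c).
  assert (c ^ 2 <= 1) by (unfold on_curve in Hsc; pose proof (pow2_ge_0 s); nra).
  unfold on_curve in Hsc; apply Rabs_le_between in Hprod.
  replace (c ^ 4) with (c ^ 2 * c ^ 2) in * by ring; nra.
Qed.

(* Logarithmic derivative, up to the factor w1 w2 > 0, of the renormalized distance [spread]
   below, with wi = 1 / Zi. *)
Definition spread_rate (m s c w1 w2 : R) : R :=
  (cA m s c * ra m s c - cB' s c) * (w1 + w2) + cA m s c * rb m s c * (w1 ^ 2 + w2 ^ 2) +
  cB s c * (2 * w1 ^ 2 * (ra m s c + rb m s c * w1) + w1 * w2 * (ra m s c + rb m s c * w2) +
    2 * w2 ^ 2 * (ra m s c + rb m s c * w2) + w1 * w2 * (ra m s c + rb m s c * w1)).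

(* Derivative of the corrected variable [zeta] below, with w = 1 / Z. *)
Definition zeta_rate (m s c w : R) : R :=
  3 * (3 / 5 - m) * (c ^ 8 - c ^ 4 / 2 + s ^ 2 / 2) - w ^ 2 * (cA m s c * ra m s c - cB' s c) -
  w ^ 3 * (cA m s c * rb m s c + 2 * cB s c * ra m s c) - 2 * w ^ 4 * (cB s c * rb m s c).

Lemma coefficient_bound : exists K, 1 <= K /\ forall m s c, Rabs m <= 1 ->
  Rabs s <= 1 -> Rabs c <= 1 ->
  Rabs (rq m s c) <= K /\ Rabs (ra m s c) <= K /\ Rabs (rb m s c) <= K /\
  Rabs (cA m s c) <= K /\ Rabs (cB s c) <= K /\
  Rabs (cA m s c * ra m s c - cB' s c) <= K /\
  Rabs (cA m s c * rb m s c) <= K /\ Rabs (cB s c * ra m s c) <= K /\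
  Rabs (cB s c * rb m s c) <= K.
Proof.
  assert (Hq : bounded3 rq) by bounded3_tac.
  assert (Ha : bounded3 ra) by bounded3_tac.
  assert (Hb : bounded3 rb) by bounded3_tac.
  assert (HA : bounded3 cA) by bounded3_tac.
  assert (HB : bounded3 (fun _ s c => cB s c)) by bounded3_tac.
  assert (HB' : bounded3 (fun _ s c => cB' s c)) by bounded3_tac.
  assert (Hk : bounded3 (fun m s c => cA m s c * ra m s c + - cB' s c)) by
    (apply bounded3_plus; [apply bounded3_mult | apply bounded3_opp]; assumption).
  pose proof (bounded3_mult _ _ HA Hb) as HAb.
  pose proof (bounded3_mult _ _ HB Ha) as HBa.
  pose proof (bounded3_mult _ _ HB Hb) as HBb.
  destruct Hq as [K1 [P1 Hq]], Ha as [K2 [P2 Ha]], Hb as [K3 [P3 Hb]], HA as [K4 [P4 HA]],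
    HB as [K5 [P5 HB]], Hk as [K6 [P6 Hk]], HAb as [K7 [P7 HAb]], HBa as [K8 [P8 HBa]],
    HBb as [K9 [P9 HBb]].
  exists (1 + K1 + K2 + K3 + K4 + K5 + K6 + K7 + K8 + K9); split; [lra|].
  intros m s c Hm Hs Hc.
  specialize (Hq m s c Hm Hs Hc); specialize (Ha m s c Hm Hs Hc);
  specialize (Hb m s c Hm Hs Hc); specialize (HA m s c Hm Hs Hc);
  specialize (HB m s c Hm Hs Hc); specialize (Hk m s c Hm Hs Hc);
  specialize (HAb m s c Hm Hs Hc); specialize (HBa m s c Hm Hs Hc);
  specialize (HBb m s c Hm Hs Hc); cbv beta in *.
  unfold Rminus; repeat split; lra.
Qed.

Lemma Rabs_mult_le u v A B : Rabs u <= A -> Rabs v <= B -> - (A * B) <= u * v <= A * B.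
Proof.
  intros; apply Rabs_le_between; rewrite Rabs_mult.
  apply Rmult_le_compat; auto using Rabs_pos.
Qed.

(** No constant depends on m, so the region of validity can be fixed before m approaches 3/5. *)
Lemma rates : exists K w0 mu k1, 1 <= K /\ 0 < w0 <= 1 /\ 0 < mu <= 2 / 5 /\ 0 < k1 /\
  (forall m s c, Rabs m <= 1 -> on_curve s c ->
    Rabs (rq m s c) <= K /\ Rabs (ra m s c) <= K /\ Rabs (rb m s c) <= K /\
    Rabs (cA m s c) <= K) /\
  (forall m s c w1 w2, on_curve s c -> Rabs (m - 3 / 5) <= mu -> 0 < w1 <= w0 ->
    0 < w2 <= w0 -> 0 < spread_rate m s c w1 w2) /\
  (forall m s c w, on_curve s c -> 3 / 5 - mu <= m < 3 / 5 -> 0 <= w <= w0 ->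
    zeta_rate m s c w <= 6 * (3 / 5 - m) - k1 * w ^ 2 /\
    3 / 10 * (3 / 5 - m) - K * w ^ 2 <= zeta_rate m s c w).
Proof.
  destruct coefficient_bound as [K [HK HB]].
  destruct kappa_lower as [mu [Hmu Hkap]].
  (* Then K w0 <= 1/10000, and all terms of higher order in w cost at most a tenth of the 1/100 from
     [kappa_lower]. *)
  destruct (small_factor (1 / 500) (20 * K)) as [w0 [Hw0 Hw0K]]; try lra.
  exists (10 * K), w0, (Rmin mu (2 / 5)), (1 / 200).
  pose proof (Rmin_l mu (2 / 5)); pose proof (Rmin_r mu (2 / 5)).
  repeat match goal with |- _ /\ _ => split end; try lra; try (apply Rmin_pos; lra).
  - intros m s c Hm Hsc; destruct (curve_bounds s c Hsc) as [Hs Hc].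
    destruct (HB m s c Hm Hs Hc) as (B1 & B2 & B3 & B4 & _); repeat split; lra.
  - intros m s c w1 w2 Hsc Hm Hw1 Hw2; destruct (curve_bounds s c Hsc) as [Hs Hc].
    assert (Hm1 : Rabs m <= 1) by (apply Rabs_le_between in Hm; apply Rabs_le; lra).
    specialize (Hkap m s c Hsc ltac:(lra)).
    destruct (HB m s c Hm1 Hs Hc) as (B1 & B2 & B3 & B4 & B5 & B6 & B7 & B8 & B9).
    unfold spread_rate.
    set (kap := cA m s c * ra m s c - cB' s c) in *.
    set (Ab := cA m s c * rb m s c) in *.
    replace (cB s c * _) with ((cB s c * ra m s c) * (2 * w1 ^ 2 + 2 * w1 * w2 + 2 * w2 ^ 2) +
      (cB s c * rb m s c) * (2 * w1 ^ 3 + w1 * w2 ^ 2 + 2 * w2 ^ 3 + w1 ^ 2 * w2)) by ring.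
    set (Ba := cB s c * ra m s c) in *; set (Bb := cB s c * rb m s c) in *.
    assert (Hsum : w1 ^ 2 + w2 ^ 2 <= w0 * (w1 + w2)) by nra.
    assert (Hsum2 : 2 * w1 ^ 2 + 2 * w1 * w2 + 2 * w2 ^ 2 <= 3 * (w0 * (w1 + w2))) by nra.
    assert (Hsq : w1 ^ 2 <= w1 * w0 /\ w2 ^ 2 <= w2 * w0) by (split; nra).
    assert (Hsum3 : 2 * w1 ^ 3 + w1 * w2 ^ 2 + 2 * w2 ^ 3 + w1 ^ 2 * w2 <=
      6 * (w0 * (w1 + w2))).
    { assert (w1 ^ 3 <= w1 * w0) by (replace (w1 ^ 3) with (w1 * w1 ^ 2) by ring; nra).
      assert (w2 ^ 3 <= w2 * w0) by (replace (w2 ^ 3) with (w2 * w2 ^ 2) by ring; nra).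
      assert (w1 * w2 ^ 2 <= w2 * w0) by nra.
      assert (w1 ^ 2 * w2 <= w1 * w0) by nra.
      nra. }
    assert (P1 : Rabs (w1 ^ 2 + w2 ^ 2) <= w0 * (w1 + w2)) by (rewrite Rabs_pos_eq; nra).
    assert (P2 : Rabs (2 * w1 ^ 2 + 2 * w1 * w2 + 2 * w2 ^ 2) <= 3 * (w0 * (w1 + w2)))
      by (rewrite Rabs_pos_eq; nra).
    assert (P3 : Rabs (2 * w1 ^ 3 + w1 * w2 ^ 2 + 2 * w2 ^ 3 + w1 ^ 2 * w2) <=
      6 * (w0 * (w1 + w2))).
    { rewrite Rabs_pos_eq; [exact Hsum3|].
      assert (0 < w1 ^ 3) by (apply pow_lt; lra); assert (0 < w2 ^ 3) by (apply pow_lt; lra).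
      assert (0 < w1 ^ 2) by (apply pow_lt; lra); assert (0 < w2 ^ 2) by (apply pow_lt; lra).
      nra. }
    pose proof (Rabs_mult_le _ _ _ _ B7 P1); pose proof (Rabs_mult_le _ _ _ _ B8 P2).
    pose proof (Rabs_mult_le _ _ _ _ B9 P3).
    assert (1 / 100 * (w1 + w2) <= kap * (w1 + w2)) by nra.
    assert (10 * K * (w0 * (w1 + w2)) <= 1 / 1000 * (w1 + w2)) by nra.
    nra.
  - intros m s c w Hsc Hm Hw; destruct (curve_bounds s c Hsc) as [Hs Hc].
    assert (Hm1 : Rabs m <= 1) by (apply Rabs_le; lra).
    assert (Hm2 : Rabs (m - 3 / 5) <= mu) by (apply Rabs_le; lra).
    specialize (Hkap m s c Hsc Hm2).
    destruct (HB m s c Hm1 Hs Hc) as (B1 & B2 & B3 & B4 & B5 & B6 & B7 & B8 & B9).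
    unfold zeta_rate.
    set (kap := cA m s c * ra m s c - cB' s c) in *.
    set (Ab := cA m s c * rb m s c) in *.
    replace (2 * cB s c * ra m s c) with (2 * (cB s c * ra m s c)) by ring.
    set (Ba := cB s c * ra m s c) in *; set (Bb := cB s c * rb m s c) in *.
    (* On the curve this is (c^4 - 3/8)^2 + 7/64. Multiplied by 3, the two bounds give the constants
       3/10 and 6. *)
    assert (HG : 1 / 10 <= c ^ 8 - c ^ 4 / 2 + s ^ 2 / 2 <= 2).
    { unfold on_curve in Hsc; pose proof (pow2_ge_0 s); pose proof (pow2_ge_0 (c ^ 2)).
      replace (c ^ 8) with (c ^ 4 * c ^ 4) by ring.
      replace ((c ^ 2) ^ 2) with (c ^ 4) in * by ring.
      pose proof (pow2_ge_0 (c ^ 4 - 3 / 8)); split; nra. }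
    set (G := c ^ 8 - c ^ 4 / 2 + s ^ 2 / 2) in *.
    pose proof (pow2_ge_0 w) as Hw2.
    assert (P3 : Rabs (w ^ 3) <= w0 * w ^ 2).
    { rewrite Rabs_pos_eq by (apply pow_le; lra); replace (w ^ 3) with (w * w ^ 2) by ring.
      nra. }
    assert (P4 : Rabs (w ^ 4) <= w0 * w ^ 2).
    { rewrite Rabs_pos_eq by (apply pow_le; lra).
      replace (w ^ 4) with (w * w * w ^ 2) by ring; assert (w * w <= w0) by nra; nra. }
    pose proof (Rabs_mult_le _ _ _ _ B7 P3); pose proof (Rabs_mult_le _ _ _ _ B8 P3).
    pose proof (Rabs_mult_le _ _ _ _ B9 P4).
    assert (5 * K * (w0 * w ^ 2) <= 1 / 1000 * w ^ 2) by nra.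
    apply Rabs_le_between in B6.
    assert (1 / 100 * w ^ 2 <= w ^ 2 * kap <= K * w ^ 2) by (split; nra).
    replace (w ^ 3 * (Ab + 2 * Ba)) with (Ab * w ^ 3 + 2 * (Ba * w ^ 3)) by ring.
    replace (2 * w ^ 4 * Bb) with (2 * (Bb * w ^ 4)) by ring.
    split; nra.
Qed.

(** * Derivatives along the phase *)

Section PathDerivatives.

Variables (S C : R -> R) (t g m : R).
Hypothesis HS : is_derive S t (C t ^ 3 * g).
Hypothesis HC : is_derive C t (- S t * g).

Ltac path_derive :=
  auto_derive;
  [ repeat match goal with |- _ /\ _ => split | |- True => exact I end;
    first [ eexists; exact HS | eexists; exact HC ]
  | replace (Derive _ t) with (C t ^ 3 * g) by (symmetry; apply is_derive_unique, HS);
    replace (Derive _ t) with (- S t * g) by (symmetry; apply is_derive_unique, HC);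
    field ].

(** The factor g is the phase speed: 1 when the phase is the independent variable, [polar_g] along
    an orbit in time. Both uses share these derivatives. *)
Lemma cA_path : is_derive (fun u => cA m (S u) (C u)) t (- rb m (S t) (C t) * g).
Proof. unfold cA, rb; path_derive. Qed.

Lemma cB_path : is_derive (fun u => cB (S u) (C u)) t (cB' (S t) (C t) * g).
Proof. unfold cB, cB'; path_derive. Qed.

Lemma rq_cP_path : is_derive (fun u => rq m (S u) (C u) + 3 * cP m (S u) (C u)) t
  ((3 * (3 / 5 - m) * (C t ^ 8 - C t ^ 4 / 2 + S t ^ 2 / 2) - ra m (S t) (C t)) * g).
Proof. unfold rq, cP, ra; path_derive. Qed.

Lemma rq_path : is_derive (fun u => rq m (S u) (C u)) t
  ((- ra m (S t) (C t) - 3 * (- S t ^ 4 + m * C t ^ 8)) * g).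
Proof. unfold rq, ra; path_derive. Qed.

(** The term q + 3P cancels a up to a multiple of 3/5 - m, A/Z cancels b/Z, and B/Z^2 replaces the
    resulting coefficient - A a of 1/Z^2 by B' - A a, of constant sign near m = 3/5. *)
Lemma zeta_path (Z : R -> R) : Z t <> 0 ->
  is_derive Z t ((ra m (S t) (C t) + rb m (S t) (C t) / Z t) * g) ->
  is_derive (fun u => Z u + (rq m (S u) (C u) + 3 * cP m (S u) (C u)) +
    cA m (S u) (C u) / Z u + cB (S u) (C u) / Z u ^ 2) t
    (zeta_rate m (S t) (C t) (/ Z t) * g).
Proof.
  intros Hne HZ.
  pose proof cA_path as HA; pose proof cB_path as HB; pose proof rq_cP_path as HQ.
  set (A := fun u => cA m (S u) (C u)) in *; set (B := fun u => cB (S u) (C u)) in *.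
  set (Q := fun u => rq m (S u) (C u) + 3 * cP m (S u) (C u)) in *.
  change (is_derive (fun u => Z u + Q u + A u / Z u + B u / Z u ^ 2) t
    (zeta_rate m (S t) (C t) (/ Z t) * g)).
  apply is_derive_eq with
    ((ra m (S t) (C t) + rb m (S t) (C t) / Z t) * g +
     (3 * (3 / 5 - m) * (C t ^ 8 - C t ^ 4 / 2 + S t ^ 2 / 2) - ra m (S t) (C t)) * g +
     (- rb m (S t) (C t) * g / Z t -
      A t * ((ra m (S t) (C t) + rb m (S t) (C t) / Z t) * g) / Z t ^ 2) +
     (cB' (S t) (C t) * g / Z t ^ 2 -
      2 * B t * ((ra m (S t) (C t) + rb m (S t) (C t) / Z t) * g) / Z t ^ 3)).
  - auto_derive.
    + repeat match goal with |- _ /\ _ => split | |- True => exact I end;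
      first [ eexists; exact HZ | eexists; exact HQ | eexists; exact HA | eexists; exact HB
            | assumption
            | repeat apply Rmult_integral_contrapositive_currified; try assumption; lra ].
    + replace (Derive (fun x => Z x) t) with ((ra m (S t) (C t) + rb m (S t) (C t) / Z t) * g)
        by (symmetry; apply is_derive_unique, HZ).
      replace (Derive (fun x => Q x) t) with
        ((3 * (3 / 5 - m) * (C t ^ 8 - C t ^ 4 / 2 + S t ^ 2 / 2) - ra m (S t) (C t)) * g)
        by (symmetry; apply is_derive_unique, HQ).
      replace (Derive (fun x => A x) t) with (- rb m (S t) (C t) * g)
        by (symmetry; apply is_derive_unique, HA).
      replace (Derive (fun x => B x) t) with (cB' (S t) (C t) * g)
        by (symmetry; apply is_derive_unique, HB).
      field; assumption.
  - unfold zeta_rate, A, B; field; assumption.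
Qed.

(* The quotient by the exponential removes, at every order but one, the oscillating part of
   the logarithmic derivative -b / (Z1 Z2) of the distance between two orbits. *)
Definition spread (Z1 Z2 : R -> R) (u : R) : R :=
  (Z2 u - Z1 u) * exp (- (cA m (S u) (C u) * (/ Z1 u * / Z2 u)) -
    cB (S u) (C u) * (/ Z1 u ^ 2 * / Z2 u + / Z1 u * / Z2 u ^ 2)).

Lemma spread_path (Z1 Z2 : R -> R) : Z1 t <> 0 -> Z2 t <> 0 ->
  is_derive Z1 t ((ra m (S t) (C t) + rb m (S t) (C t) / Z1 t) * g) ->
  is_derive Z2 t ((ra m (S t) (C t) + rb m (S t) (C t) / Z2 t) * g) ->
  is_derive (spread Z1 Z2) t (spread Z1 Z2 t *
    (spread_rate m (S t) (C t) (/ Z1 t) (/ Z2 t) * (/ Z1 t * / Z2 t) * g)).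
Proof.
  intros Hne1 Hne2 HZ1 HZ2; unfold spread.
  pose proof cA_path as HA; pose proof cB_path as HB.
  set (A := fun u => cA m (S u) (C u)) in *; set (B := fun u => cB (S u) (C u)) in *.
  change (is_derive (fun u => (Z2 u - Z1 u) * exp (- (A u * (/ Z1 u * / Z2 u)) -
    B u * (/ Z1 u ^ 2 * / Z2 u + / Z1 u * / Z2 u ^ 2))) t
   ((Z2 t - Z1 t) * exp (- (A t * (/ Z1 t * / Z2 t)) -
    B t * (/ Z1 t ^ 2 * / Z2 t + / Z1 t * / Z2 t ^ 2)) *
    (spread_rate m (S t) (C t) (/ Z1 t) (/ Z2 t) * (/ Z1 t * / Z2 t) * g))).
  auto_derive.
  - repeat match goal with |- _ /\ _ => split | |- True => exact I end;
      first [ eexists; exact HZ1 | eexists; exact HZ2 | eexists; exact HA | eexists; exact HB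
            | assumption
            | repeat apply Rmult_integral_contrapositive_currified; try assumption; lra ].
  - replace (Derive (fun x => Z1 x) t) with ((ra m (S t) (C t) + rb m (S t) (C t) / Z1 t) * g)
      by (symmetry; apply is_derive_unique, HZ1).
    replace (Derive (fun x => Z2 x) t) with ((ra m (S t) (C t) + rb m (S t) (C t) / Z2 t) * g)
      by (symmetry; apply is_derive_unique, HZ2).
    replace (Derive (fun x => A x) t) with (- rb m (S t) (C t) * g)
      by (symmetry; apply is_derive_unique, HA).
    replace (Derive (fun x => B x) t) with (cB' (S t) (C t) * g)
      by (symmetry; apply is_derive_unique, HB).
    match goal with |- context [exp ?e] => set (X := exp e) end.
    match goal with |- context [exp ?e] => replace (exp e) with X by
      (unfold X; f_equal; field; split; assumption) end.
    unfold spread_rate; fold (A t) (B t).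
    generalize (cB' (S t) (C t)) (ra m (S t) (C t)) (rb m (S t) (C t)); intros.
    change (cA m (S t) (C t)) with (A t); change (cB (S t) (C t)) with (B t).
    field; split; assumption.
Qed.

End PathDerivatives.

(** * Periodic solutions of the polar equation *)

Lemma Rmax_lipschitz b u v : Rabs (Rmax u b - Rmax v b) <= Rabs (u - v).
Proof.
  pose proof (Rle_abs (u - v)) as H1; pose proof (Rle_abs (- (u - v))) as H2.
  rewrite Rabs_Ropp in H2; apply Rabs_le.
  unfold Rmax; destruct (Rle_dec u b), (Rle_dec v b); lra.
Qed.

Lemma continuous_Rmax (z : R -> R) b t : continuous z t ->
  continuous (fun s => Rmax (z s) b) t.
Proof.
  intros Hz; apply continuity_pt_filterlim; apply continuity_pt_filterlim in Hz.
  intros eps Heps; destruct (Hz eps Heps) as [d [Hd Hs]]; exists d; split; [exact Hd|].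
  intros s Hsd; eapply Rle_lt_trans; [apply Rmax_lipschitz | exact (Hs s Hsd)].
Qed.

Lemma quotient_lipschitz b K r u v : 1 <= b -> Rabs r <= K ->
  Rabs (r / Rmax u b - r / Rmax v b) <= K * Rabs (u - v).
Proof.
  intros Hb Hr.
  pose proof (Rmax_r u b) as Hu; pose proof (Rmax_r v b) as Hv.
  replace (r / Rmax u b - r / Rmax v b) with
    (r * ((Rmax v b - Rmax u b) / (Rmax u b * Rmax v b))) by (field; lra).
  rewrite Rabs_mult; apply Rmult_le_compat; auto using Rabs_pos.
  rewrite Rabs_div by nra; rewrite (Rabs_pos_eq (Rmax u b * Rmax v b)) by nra.
  pose proof (Rmax_lipschitz b v u); rewrite (Rabs_minus_sym u v).
  apply Rle_div_l; [nra|]; pose proof (Rabs_pos (v - u)).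
  assert (1 <= Rmax u b * Rmax v b) by nra; nra.
Qed.

Lemma reduce_period (w t : R) : 0 < w -> exists n : Z, 0 <= t + IZR n * w <= w.
Proof.
  intros Hw; destruct (archimed (t / w)) as [H1 H2].
  exists (1 - up (t / w))%Z; rewrite minus_IZR.
  apply Rmult_lt_compat_r with (r := w) in H1; [|exact Hw].
  apply Rmult_le_compat_r with (r := w) in H2; [|lra].
  replace (t / w * w) with t in H1 by (field; lra).
  replace ((IZR (up (t / w)) - t / w) * w) with (IZR (up (t / w)) * w - t) in H2
    by (field; lra).
  lra.
Qed.

Section PeriodicRadius.

Variables (S C : R -> R) (per : R).
Hypothesis Hper : 0 < per.
Hypothesis HS : forall t, is_derive S t (C t ^ 3).
Hypothesis HC : forall t, is_derive C t (- S t).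
Hypothesis Hcurve : forall t, on_curve (S t) (C t).
Hypothesis HSper : forall t, S (t + per) = S t.
Hypothesis HCper : forall t, C (t + per) = C t.

Variables K w0 mu k1 : R.
Hypothesis HK : 1 <= K.
Hypothesis Hw0 : 0 < w0 <= 1.
Hypothesis Hmu : 0 < mu <= 2 / 5.
Hypothesis Hk1 : 0 < k1.
Hypothesis Hbounds : forall m s c, Rabs m <= 1 -> on_curve s c ->
  Rabs (rq m s c) <= K /\ Rabs (ra m s c) <= K /\ Rabs (rb m s c) <= K /\
  Rabs (cA m s c) <= K.
Hypothesis Hzeta : forall m s c w, on_curve s c -> 3 / 5 - mu <= m < 3 / 5 ->
  0 <= w <= w0 ->
  zeta_rate m s c w <= 6 * (3 / 5 - m) - k1 * w ^ 2 /\
  3 / 10 * (3 / 5 - m) - K * w ^ 2 <= zeta_rate m s c w.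

Variable Zb : R.
Hypothesis HZb : 2 * K <= Zb.
Hypothesis HZw : / w0 <= Zb.

(** Cutting Z off at Zb makes the field bounded and globally Lipschitz, as Picard iteration
    requires. The periodic solution stays above Zb, where the cut is invisible. *)
Definition cut_field (m t z : R) : R :=
  ra m (S t) (C t) + rb m (S t) (C t) / Rmax z Zb.

Lemma cut_field_lipschitz m t u v : Rabs m <= 1 ->
  Rabs (cut_field m t u - cut_field m t v) <= K * Rabs (u - v).
Proof.
  intros Hm; destruct (Hbounds m _ _ Hm (Hcurve t)) as (_ & _ & Hb & _).
  unfold cut_field; replace (ra m (S t) (C t) + rb m (S t) (C t) / Rmax u Zb -
    (ra m (S t) (C t) + rb m (S t) (C t) / Rmax v Zb)) with
    (rb m (S t) (C t) / Rmax u Zb - rb m (S t) (C t) / Rmax v Zb) by ring.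
  apply quotient_lipschitz; [lra | exact Hb].
Qed.

Lemma cut_field_bound m t z : Rabs m <= 1 -> Rabs (cut_field m t z) <= 2 * K.
Proof.
  intros Hm; destruct (Hbounds m _ _ Hm (Hcurve t)) as (_ & Ha & Hb & _).
  pose proof (Rmax_r z Zb).
  unfold cut_field; eapply Rle_trans; [apply Rabs_triang|].
  assert (Rabs (rb m (S t) (C t) / Rmax z Zb) <= K).
  { rewrite Rabs_div by lra; rewrite (Rabs_pos_eq (Rmax z Zb)) by lra.
    apply Rle_div_l; [lra|]; nra. }
  lra.
Qed.

Lemma cut_field_continuous m (z : R -> R) : (forall t, continuous z t) ->
  forall t, continuous (fun t => cut_field m t (z t)) t.
Proof.
  intros Hz t; unfold cut_field.
  assert (ES : ex_derive S t) by (eexists; apply HS).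
  assert (EC : ex_derive C t) by (eexists; apply HC).
  apply (continuous_plus (fun t => ra m (S t) (C t))).
  - apply @ex_derive_continuous; unfold ra; auto_derive.
    repeat match goal with |- _ /\ _ => split | |- True => exact I end;
      first [exact ES | exact EC].
  - apply (continuous_mult (fun t => rb m (S t) (C t)) (fun t => / Rmax (z t) Zb)).
    + apply @ex_derive_continuous; unfold rb; auto_derive.
      repeat match goal with |- _ /\ _ => split | |- True => exact I end;
        first [exact ES | exact EC].
    + apply continuity_pt_filterlim.
      apply (continuity_pt_inv (fun t => Rmax (z t) Zb)).
      * apply continuity_pt_filterlim, continuous_Rmax, Hz.
      * pose proof (Rmax_r (z t) Zb); lra.
Qed.

Definition solves_radius (m : R) (Z : R -> R) : Prop :=
  forall t, is_derive Z t (cut_field m t (Z t)).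

Lemma radius_exists m z0 : Rabs m <= 1 -> { Z : R -> R | Z 0 = z0 /\ solves_radius m Z }.
Proof.
  intros Hm; apply (picard_solution (cut_field m) z0 (2 * K) K); try lra.
  - intros; apply cut_field_lipschitz, Hm.
  - intros; apply cut_field_bound, Hm.
  - intros z Hz; apply cut_field_continuous, Hz.
Qed.

(** In this variable the motion over a turn is bounded independently of Z and m; [2 * K * per] is
    the safety margin in the estimates of the return map. *)
Lemma radius_close m Z t : Rabs m <= 1 -> solves_radius m Z -> 0 <= t <= per ->
  Rabs (Z t - Z 0) <= 2 * K * per.
Proof.
  intros Hm HZ Ht; destruct (mean_value Z _ 0 t HZ) as [xi [_ E]].
  rewrite E, Rminus_0_r, Rabs_mult, (Rabs_pos_eq t) by lra.
  apply Rmult_le_compat; try lra; [apply Rabs_pos | apply cut_field_bound, Hm].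
Qed.

Lemma radius_dependence m Z1 Z2 t : Rabs m <= 1 -> solves_radius m Z1 ->
  solves_radius m Z2 -> Rabs (Z1 t - Z2 t) <= Rabs (Z1 0 - Z2 0) * exp (K * Rabs t).
Proof.
  intros Hm H1 H2.
  pose proof (gronwall (fun t => Z1 t - Z2 t)
    (fun t => cut_field m t (Z1 t) - cut_field m t (Z2 t)) K) as G.
  rewrite <- (Rminus_0_r t) at 3; apply G.
  - intros u; apply @is_derive_minus; auto.
  - intros u; apply cut_field_lipschitz, Hm.
Qed.

Lemma radius_field m Z t : Zb <= Z t -> solves_radius m Z ->
  is_derive Z t ((ra m (S t) (C t) + rb m (S t) (C t) / Z t) * 1).
Proof.
  intros Hz H; specialize (H t); unfold cut_field in H.
  rewrite Rmax_left in H by exact Hz; rewrite Rmult_1_r; exact H.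
Qed.

Definition zeta (m : R) (Z : R -> R) (u : R) : R :=
  Z u + (rq m (S u) (C u) + 3 * cP m (S u) (C u)) + cA m (S u) (C u) / Z u +
  cB (S u) (C u) / Z u ^ 2.

Lemma zeta_derive m Z t : Zb <= Z t -> solves_radius m Z ->
  is_derive (zeta m Z) t (zeta_rate m (S t) (C t) (/ Z t)).
Proof.
  intros Hz H; rewrite <- (Rmult_1_r (zeta_rate _ _ _ _)); apply zeta_path; try lra.
  - rewrite Rmult_1_r; apply HS.
  - rewrite Rmult_1_r; apply HC.
  - apply radius_field; assumption.
Qed.

Hypothesis HS0 : S 0 = 0.

(** Over a turn the periodic terms cancel, and at S = 0 the correction B vanishes as well. What
    remains is the increment of Z times 1 - A / (Z0 Z1), positive because |A| <= K and Z >= 2K: the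
    drift of zeta decides the direction of the return map. *)
Lemma zeta_increment m Z : Rabs m <= 1 -> Zb <= Z 0 -> Zb <= Z per ->
  exists k, 0 < k /\ zeta m Z per - zeta m Z 0 = k * (Z per - Z 0).
Proof.
  intros Hm H0 H1.
  assert (HS1 : S per = 0) by (rewrite <- (Rplus_0_l per), HSper; exact HS0).
  assert (HC1 : C per = C 0) by (rewrite <- (Rplus_0_l per) at 1; apply HCper).
  destruct (Hbounds m _ _ Hm (Hcurve 0)) as (_ & _ & _ & HA).
  exists (1 - cA m (S 0) (C 0) * (/ Z per * / Z 0)).
  assert (E1 : 0 < / Z per * / Z 0 <= / (2 * K) * / (2 * K)).
  { split; [apply Rmult_lt_0_compat; apply Rinv_0_lt_compat; lra|].
    apply Rmult_le_compat; try (left; apply Rinv_0_lt_compat; lra);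
      apply Rinv_le_contravar; lra. }
  assert (E2 : K * (/ (2 * K) * / (2 * K)) <= 1 / 4).
  { replace (K * (/ (2 * K) * / (2 * K))) with (1 / 4 * / K) by (field; lra).
    rewrite <- (Rmult_1_r (1 / 4)) at 2; apply Rmult_le_compat_l; [lra|].
    rewrite <- Rinv_1; apply Rinv_le_contravar; lra. }
  split.
  - pose proof (Rle_abs (cA m (S 0) (C 0))); nra.
  - unfold zeta; rewrite HS1, HC1, HS0.
    replace (cB 0 (C 0)) with 0 by (unfold cB; ring).
    field; lra.
Qed.

Lemma inv_le_w0 z : Zb <= z -> 0 <= / z <= w0.
Proof.
  intros Hz; split; [left; apply Rinv_0_lt_compat; lra|].
  rewrite <- (Rinv_inv w0); apply Rinv_le_contravar; [apply Rinv_0_lt_compat; lra | lra].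
Qed.

Lemma return_map_sign m Z : 3 / 5 - mu <= m < 3 / 5 -> solves_radius m Z ->
  Zb + 2 * K * per <= Z 0 ->
  (6 * (3 / 5 - m) < k1 * (/ (Z 0 + 2 * K * per)) ^ 2 -> Z per < Z 0) /\
  (K * (/ (Z 0 - 2 * K * per)) ^ 2 < 3 / 10 * (3 / 5 - m) -> Z 0 < Z per).
Proof.
  intros Hm HZ H0.
  assert (Hm1 : Rabs m <= 1) by (apply Rabs_le; lra).
  assert (HKp : 0 < 2 * K * per) by nra.
  assert (Hin : forall t, 0 <= t <= per -> Z 0 - 2 * K * per <= Z t <= Z 0 + 2 * K * per).
  { intros t Ht; pose proof (radius_close m Z t Hm1 HZ Ht) as E.
    apply Rabs_le_between in E; lra. }
  destruct (zeta_increment m Z Hm1) as [k [Hk E]];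
    [lra | specialize (Hin per ltac:(lra)); lra|].
  assert (Hmv : exists xi, 0 <= xi <= per /\
    k * (Z per - Z 0) = zeta_rate m (S xi) (C xi) (/ Z xi) * per).
  { destruct (MVT_gen (zeta m Z) 0 per (fun t => zeta_rate m (S t) (C t) (/ Z t)))
      as [xi [Hxi Exi]]; rewrite ?Rmin_left, ?Rmax_right in * by lra.
    - intros t Ht; apply zeta_derive; [specialize (Hin t ltac:(lra)); lra | exact HZ].
    - intros t Ht; eapply is_derive_continuity_pt, zeta_derive;
        [specialize (Hin t ltac:(lra)); lra | exact HZ].
    - exists xi; split; [exact Hxi|]; rewrite <- E, Exi; ring. }
  destruct Hmv as [xi [Hxi Exi]]; specialize (Hin xi Hxi).
  destruct (Hzeta m (S xi) (C xi) (/ Z xi) (Hcurve xi) Hm (inv_le_w0 (Z xi) ltac:(lra)))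
    as [R1 R2].
  split; intros Hs.
  - assert (zeta_rate m (S xi) (C xi) (/ Z xi) < 0).
    { assert (/ (Z 0 + 2 * K * per) ^ 2 <= / Z xi ^ 2) by
        (apply Rinv_le_contravar; [apply pow_lt; lra | apply pow_incr; lra]).
      rewrite pow_inv in *; nra. }
    nra.
  - assert (0 < zeta_rate m (S xi) (C xi) (/ Z xi)).
    { assert (/ Z xi ^ 2 <= / (Z 0 - 2 * K * per) ^ 2) by
        (apply Rinv_le_contravar; [apply pow_lt; lra | apply pow_incr; lra]).
      rewrite pow_inv in *; nra. }
    nra.
Qed.

Theorem periodic_radius : exists eps, 0 < eps <= mu /\
  forall m, 3 / 5 - eps < m < 3 / 5 -> exists (Z : R -> R) (ZM : R),
    (forall t, is_derive Z t (ra m (S t) (C t) + rb m (S t) (C t) / Z t)) /\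
    (forall t, Z (t + per) = Z t) /\ (forall t, Zb <= Z t <= ZM).
Proof.
  assert (HKp : 0 < 2 * K * per) by nra.
  set (z1 := Zb + 2 * K * per).
  (* The negative part of the drift at z1, free of m: once 6 (3/5 - m) is below it, the return map
     decreases at z1. *)
  set (e1 := k1 * (/ (z1 + 2 * K * per)) ^ 2).
  assert (He1 : 0 < e1).
  { unfold e1; apply Rmult_lt_0_compat; [lra|].
    apply pow_lt, Rinv_0_lt_compat; unfold z1; lra. }
  exists (Rmin mu (e1 / 6)); split.
  { split; [apply Rmin_pos; lra | apply Rmin_l]. }
  intros m Hm.
  pose proof (Rmin_l mu (e1 / 6)); pose proof (Rmin_r mu (e1 / 6)).
  assert (Hm1 : Rabs m <= 1) by (apply Rabs_le; lra).
  set (Phi := fun z => proj1_sig (radius_exists m z Hm1)).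
  assert (HPhi : forall z, Phi z 0 = z /\ solves_radius m (Phi z)) by
    (intros z; exact (proj2_sig (radius_exists m z Hm1))).
  set (h := fun z => Phi z per - z).
  assert (Hh : continuity h).
  { intros z; apply continuity_pt_minus; [|apply continuity_pt_id].
    intros eta Heta; set (L := exp (K * Rabs per)).
    assert (HL : 0 < L) by apply exp_pos.
    exists (eta / L); split; [apply Rdiv_lt_0_compat; lra|].
    intros z' [_ Hz']; simpl in *; unfold Rdist in *.
    destruct (HPhi z) as [I1 J1]; destruct (HPhi z') as [I2 J2].
    eapply Rle_lt_trans; [apply (radius_dependence m _ _ per Hm1 J2 J1)|].
    rewrite I1, I2; fold L.
    apply Rmult_lt_compat_r with (r := L) in Hz'; [|exact HL].
    replace (eta / L * L) with eta in Hz' by (field; lra); exact Hz'. }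
  (* The return map increases at z as soon as (z - 2 K per)^2 > X. Taking z - 2 K per = Zb + X + 1
     avoids a square root. *)
  set (X := 10 * K / (3 * (3 / 5 - m))).
  assert (HX : 0 < X) by (apply Rdiv_lt_0_compat; lra).
  assert (HX2 : K = 3 / 10 * (3 / 5 - m) * X) by (unfold X; field; lra).
  set (z2 := z1 + X + 1).
  assert (Hneg : h z1 < 0).
  { destruct (HPhi z1) as [I1 J1]; unfold h.
    destruct (return_map_sign m (Phi z1)) as [G _]; try assumption; try lra.
    - rewrite I1; unfold z1; lra.
    - rewrite I1 in G; fold e1 in G; lra. }
  assert (Hpos : 0 < h z2).
  { destruct (HPhi z2) as [I1 J1]; unfold h.
    destruct (return_map_sign m (Phi z2)) as [_ G]; try assumption; try lra.
    - rewrite I1; unfold z2, z1; lra.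
    - rewrite I1 in G; assert (z2 < Phi z2 per); [apply G|lra].
      replace (z2 - 2 * K * per) with (Zb + X + 1) by (unfold z2, z1; ring).
      rewrite HX2 at 1.
      assert (X < (Zb + X + 1) ^ 2) by nra.
      rewrite pow_inv, Rmult_assoc.
      rewrite <- (Rmult_1_r (3 / 10 * (3 / 5 - m))) at 2.
      apply Rmult_lt_compat_l; [lra|].
      apply (Rlt_div_l X); [apply pow_lt; lra | lra]. }
  destruct (IVT_gen h z1 z2 0 Hh) as [z [Hz Hz0]].
  { split; [eapply Rle_trans; [apply Rmin_l | lra] | eapply Rle_trans; [|apply Rmax_r]; lra]. }
  assert (Hz12 : z1 <= z2) by (unfold z2; lra).
  rewrite Rmin_left, Rmax_right in Hz by exact Hz12.
  destruct (HPhi z) as [I J]; set (Z := Phi z) in *.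
  assert (HZper : forall t, Z (t + per) = Z t).
  { intros t.
    (* The translate by [per] solves the same equation and agrees with Z at 0, so uniqueness turns
       the fixed point into a period. *)
    assert (D : Z (t + per) - Z t = 0); [|lra].
    apply (gronwall_unique (fun t => Z (t + per) - Z t)
      (fun t => cut_field m t (Z (t + per)) - cut_field m t (Z t)) K 0).
    - intros u; apply (is_derive_minus (fun u => Z (u + per)) Z); [|apply J].
      apply is_derive_shift.
      pose proof (J (u + per)) as E; unfold cut_field in *; rewrite HSper, HCper in E.
      exact E.
    - intros u; apply cut_field_lipschitz, Hm1.
    - rewrite Rplus_0_l, I; exact Hz0. }
  assert (HZin : forall t, Zb <= Z t <= z2 + 2 * K * per).
  { intros t; destruct (reduce_period per t Hper) as [n Hn].
    rewrite <- (periodic_Z Z per HZper n t).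
    pose proof (radius_close m Z _ Hm1 J Hn) as E; apply Rabs_le_between in E.
    unfold z1 in Hz; lra. }
  exists Z, (z2 + 2 * K * per); split; [|split; assumption].
  intros t; rewrite <- (Rmult_1_r (_ + _)); apply radius_field; [apply HZin | exact J].
Qed.

End PeriodicRadius.

(** * The periodic orbit *)

Definition rp (m s c : R) : R := - s ^ 4 + m * c ^ 8.

Lemma rb_rp_rq m s c : rb m s c = - 3 * rp m s c * rq m s c.
Proof. unfold rb, rp, rq; ring. Qed.

(** The perturbation (- s^3, m c^5) is p times the weighted radial vector (2s, c) minus q times the
    Hamiltonian vector (c^3, - s). This is the first component; the next lemma is the second. *)
Lemma curve_relation_x m s c : on_curve s c -> 2 * rp m s c * s + s ^ 3 = c ^ 3 * rq m s c.
Proof.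
  unfold on_curve, rp, rq; intros E.
  replace (2 * (- s ^ 4 + m * c ^ 8) * s + s ^ 3) with
    (s ^ 3 * (2 * s ^ 2 + c ^ 4) - 2 * s ^ 5 + 2 * m * (s * c ^ 8)) by (rewrite E; ring).
  ring.
Qed.

Lemma curve_relation_y m s c : on_curve s c -> m * c ^ 5 - rp m s c * c = s * rq m s c.
Proof.
  unfold on_curve, rp, rq; intros E.
  replace (m * c ^ 5) with (m * c ^ 5 * (2 * s ^ 2 + c ^ 4)) by (rewrite E; ring).
  ring.
Qed.

Lemma cube_root_unique a b : 0 < a -> 0 < b -> a ^ 3 = b ^ 3 -> a = b.
Proof.
  intros Ha Hb E.
  assert (F : (a - b) * (a ^ 2 + a * b + b ^ 2) = 0) by (ring_simplify; lra).
  apply Rmult_integral in F as [F|F]; [lra|nra].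
Qed.

Lemma fourth_power_le a b : 0 <= a -> 0 <= b -> a ^ 4 <= b ^ 4 -> a <= b.
Proof.
  intros Ha Hb H; apply Rnot_lt_le; intros L.
  assert (b ^ 2 < a ^ 2) by nra.
  assert ((b ^ 2) ^ 2 < (a ^ 2) ^ 2) by (pose proof (pow2_ge_0 b); nra).
  nra.
Qed.

Section OrbitOfRadius.

Variables (S C : R -> R) (per : R).
Hypothesis Hper : 0 < per.
Hypothesis HS : forall t, is_derive S t (C t ^ 3).
Hypothesis HC : forall t, is_derive C t (- S t).
Hypothesis Hcurve : forall t, on_curve (S t) (C t).
Hypothesis HSper : forall t, S (t + per) = S t.
Hypothesis HCper : forall t, C (t + per) = C t.
Hypothesis Hsurj : forall s c, on_curve s c -> exists t, S t = s /\ C t = c.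

Variables (m K Zb ZM : R) (Z : R -> R).
Hypothesis HK : 1 <= K.
Hypothesis Hq : forall s c, on_curve s c -> Rabs (rq m s c) <= K.
Hypothesis HZ : forall t, is_derive Z t (ra m (S t) (C t) + rb m (S t) (C t) / Z t).
Hypothesis HZper : forall t, Z (t + per) = Z t.
Hypothesis HZin : forall t, Zb <= Z t <= ZM.
Hypothesis HZb : 2 * K <= Zb.

(** The positive solution of r^3 (Z + q) = 1; as an exponential it is visibly positive and
    differentiable. *)
Definition radius (u : R) : R := exp (- (1 / 3) * ln (Z u + rq m (S u) (C u))).

Lemma cube_inverse_bounds u : Zb - K <= Z u + rq m (S u) (C u) <= ZM + K.
Proof.
  pose proof (Hq _ _ (Hcurve u)) as B; apply Rabs_le_between in B.
  specialize (HZin u); lra.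
Qed.

Lemma radius_cube u : 0 < radius u /\ radius u ^ 3 * (Z u + rq m (S u) (C u)) = 1.
Proof.
  pose proof (cube_inverse_bounds u); unfold radius; split; [apply exp_pos|].
  set (z := Z u + rq m (S u) (C u)) in *.
  rewrite <- (exp_ln z) at 2 by lra; simpl pow; rewrite Rmult_1_r, <- !exp_plus.
  transitivity (exp 0); [f_equal; field | apply exp_0].
Qed.

(** Since r <= 1, r^4 >= r^6 = (r^3)^2, which avoids fractional powers. The lower bound keeps the
    orbit away from the origin and its phase speed away from zero. *)
Lemma radius_bounds u : 0 < radius u <= 1 /\ (/ (ZM + K)) ^ 2 <= radius u ^ 4.
Proof.
  destruct (radius_cube u) as [H1 H2]; pose proof (cube_inverse_bounds u) as Hz.
  set (z := Z u + rq m (S u) (C u)) in *.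
  assert (Hle : radius u <= 1).
  { apply Rnot_lt_le; intros L.
    assert (1 < radius u ^ 3) by (apply Rlt_pow_R1; [exact L | lia]); nra. }
  split; [lra|].
  assert (E : radius u ^ 3 = / z) by
    (apply Rmult_eq_reg_r with z; [rewrite Rinv_l; lra | lra]).
  apply Rle_trans with (radius u ^ 6).
  - replace (radius u ^ 6) with ((radius u ^ 3) ^ 2) by ring; rewrite E.
    apply pow_incr; split; [left; apply Rinv_0_lt_compat; lra | apply Rinv_le_contravar; lra].
  - assert (0 < radius u ^ 4) by (apply pow_lt; lra).
    replace (radius u ^ 6) with (radius u ^ 4 * (radius u * radius u)) by ring.
    rewrite <- (Rmult_1_r (radius u ^ 4)) at 2; apply Rmult_le_compat_l; nra.
Qed.

Lemma radius_small u r0 : 0 < r0 -> r0 ^ 3 * (Zb - K) = 1 -> radius u <= r0.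
Proof.
  intros Hr0 E; destruct (radius_cube u) as [H1 H2]; pose proof (cube_inverse_bounds u) as Hz.
  apply Rnot_lt_le; intros L.
  assert (r0 ^ 3 < radius u ^ 3).
  { assert (r0 ^ 2 < radius u ^ 2) by nra.
    replace (r0 ^ 3) with (r0 * r0 ^ 2) by ring.
    replace (radius u ^ 3) with (radius u * radius u ^ 2) by ring.
    pose proof (pow2_ge_0 r0); nra. }
  assert (r0 ^ 3 * (Zb - K) < radius u ^ 3 * (Zb - K)) by (apply Rmult_lt_compat_r; lra).
  assert (0 < radius u ^ 3) by (apply pow_lt; lra).
  assert (radius u ^ 3 * (Zb - K) <= radius u ^ 3 * (Z u + rq m (S u) (C u))) by
    (apply Rmult_le_compat_l; lra).
  lra.
Qed.

Lemma radius_derive u :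
  is_derive radius u (radius u * rp m (S u) (C u) / Z u).
Proof.
  pose proof (cube_inverse_bounds u) as Hz; pose proof (HZin u).
  assert (HQ : is_derive (fun u => rq m (S u) (C u)) u
    ((- ra m (S u) (C u) - 3 * (- S u ^ 4 + m * C u ^ 8)) * 1)).
  { apply rq_path; rewrite Rmult_1_r; [apply HS | apply HC]. }
  pose proof (HZ u) as HZu; unfold radius.
  set (Q := fun u => rq m (S u) (C u)) in *.
  change (is_derive (fun u => exp (- (1 / 3) * ln (Z u + Q u))) u
    (exp (- (1 / 3) * ln (Z u + Q u)) * rp m (S u) (C u) / Z u)).
  change (Zb - K <= Z u + Q u <= ZM + K) in Hz.
  auto_derive.
  - split; [eexists; exact HZu | split; [eexists; exact HQ | split; [lra | exact I]]].
  - replace (Derive (fun x => Z x) u) with (ra m (S u) (C u) + rb m (S u) (C u) / Z u)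
      by (symmetry; apply is_derive_unique, HZu).
    replace (Derive (fun x => Q x) u) with
      ((- ra m (S u) (C u) - 3 * (- S u ^ 4 + m * C u ^ 8)) * 1)
      by (symmetry; apply is_derive_unique, HQ).
    rewrite rb_rp_rq; fold (rp m (S u) (C u)); change (rq m (S u) (C u)) with (Q u).
    replace (- (1 / 3) * ln (Z u + Q u)) with (- (1 / 3) * ln (Z u + Q u)) by ring.
    field; lra.
Qed.

Definition orbit_x (u : R) : R := radius u ^ 2 * S u.
Definition orbit_y (u : R) : R := radius u * C u.
(** The phase speed r - r^4 q with respect to time. *)
Definition orbit_speed (u : R) : R := radius u ^ 4 * Z u.

Lemma orbit_x_derive u : is_derive orbit_x u
  (sysf 1 (orbit_x u) (orbit_y u) / orbit_speed u).
Proof.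
  pose proof (radius_derive u) as HR; pose proof (HS u) as HSu.
  destruct (radius_cube u) as [R1 R2]; pose proof (HZin u) as Hz.
  pose proof (curve_relation_x m _ _ (Hcurve u)) as E.
  unfold orbit_x at 1; apply is_derive_eq with
    (2 * radius u * (radius u * rp m (S u) (C u) / Z u) * S u + radius u ^ 2 * C u ^ 3).
  - auto_derive.
    + split; [eexists; exact HR | split; [eexists; exact HSu | exact I]].
    + replace (Derive (fun x => radius x) u) with (radius u * rp m (S u) (C u) / Z u)
        by (symmetry; apply is_derive_unique, HR).
      replace (Derive (fun x => S x) u) with (C u ^ 3)
        by (symmetry; apply is_derive_unique, HSu).
      field; lra.
  - unfold orbit_speed, orbit_x, orbit_y, sysf; simpl Nat.mul; simpl Nat.add.
    set (r := radius u) in *; set (q := rq m (S u) (C u)) in *; set (p := rp m (S u) (C u)) in *.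
    replace ((r * C u) ^ 3) with (r ^ 3 * C u ^ 3 * (r ^ 3 * (Z u + q))) by (rewrite R2; ring).
    transitivity (r ^ 2 * (2 * p * S u + S u ^ 3 + Z u * C u ^ 3 - S u ^ 3) / Z u);
      [field; lra|].
    rewrite E; field; lra.
Qed.

Lemma orbit_y_derive u : is_derive orbit_y u
  (sysg 2 m (orbit_x u) (orbit_y u) / orbit_speed u).
Proof.
  pose proof (radius_derive u) as HR; pose proof (HC u) as HCu.
  destruct (radius_cube u) as [R1 R2]; pose proof (HZin u) as Hz.
  pose proof (curve_relation_y m _ _ (Hcurve u)) as E.
  unfold orbit_y at 1; apply is_derive_eq with
    ((radius u * rp m (S u) (C u) / Z u) * C u + radius u * - S u).
  - auto_derive.
    + split; [eexists; exact HR | split; [eexists; exact HCu | exact I]].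
    + replace (Derive (fun x => radius x) u) with (radius u * rp m (S u) (C u) / Z u)
        by (symmetry; apply is_derive_unique, HR).
      replace (Derive (fun x => C x) u) with (- S u)
        by (symmetry; apply is_derive_unique, HCu).
      field; lra.
  - unfold orbit_speed, orbit_x, orbit_y, sysg; simpl Nat.mul; simpl Nat.add.
    set (r := radius u) in *; set (q := rq m (S u) (C u)) in *; set (p := rp m (S u) (C u)) in *.
    replace (- (r ^ 2 * S u)) with (- (r ^ 2 * S u * (r ^ 3 * (Z u + q)))) by (rewrite R2; ring).
    transitivity (r * (m * C u ^ 5 - (m * C u ^ 5 - p * C u) - S u * Z u) / Z u);
      [field; lra|].
    rewrite E; field; lra.
Qed.

Lemma orbit_energy u : energy (orbit_x u) (orbit_y u) = radius u ^ 4.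
Proof.
  unfold energy, orbit_x, orbit_y.
  transitivity (radius u ^ 4 * (2 * S u ^ 2 + C u ^ 4)); [ring|].
  rewrite (Hcurve u); ring.
Qed.

(** The radius being a function of the phase, the phase itself solves an autonomous scalar equation
    in time. Surjectivity of [th] is exported so that a point given by its phase can be found on the
    orbit. *)
Theorem periodic_orbit_of_radius : exists (x y th : R -> R),
  periodic_orbit (sysf 1) (sysg 2 m) x y /\ (forall s, exists t, th t = s) /\
  (forall t, x t = orbit_x (th t) /\ y t = orbit_y (th t)).
Proof.
  assert (Hrper : forall u, radius (u + per) = radius u) by
    (intros u; unfold radius; rewrite HZper, HSper, HCper; reflexivity).
  assert (Hzm : 0 < ZM) by (pose proof (HZin 0); lra).
  assert (Hlo : 0 < (/ (ZM + K)) ^ 2) by (apply pow_lt, Rinv_0_lt_compat; lra).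
  destruct (autonomous_solution orbit_speed per ((/ (ZM + K)) ^ 2) ZM) as
    (th & P & HP & _ & Hth & Hths & Hthp); auto.
  - intros s; apply @ex_derive_continuous; unfold orbit_speed.
    assert (ER : ex_derive radius s) by (eexists; apply radius_derive).
    assert (EZ : ex_derive Z s) by (eexists; apply HZ).
    auto_derive; split; [exact ER | split; [exact EZ | exact I]].
  - intros s; unfold orbit_speed; destruct (radius_bounds s) as [R1 R2].
    specialize (HZin s).
    assert (radius s ^ 4 <= 1) by (rewrite <- (pow1 4); apply pow_incr; lra).
    split; nra.
  - intros s; unfold orbit_speed; rewrite Hrper, HZper; reflexivity.
  - assert (Hsp : forall u, 0 < orbit_speed u).
    { intros u; destruct (radius_bounds u) as [R1 R2]; unfold orbit_speed.
      apply Rmult_lt_0_compat; [lra | specialize (HZin u); lra]. }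
    exists (fun t => orbit_x (th t)), (fun t => orbit_y (th t)), th.
    split; [|split; [exact Hths | auto]].
    split; [|split].
    + intros t; split; apply is_derive_Reals; eapply is_derive_eq.
      * apply (is_derive_comp orbit_x th); [apply orbit_x_derive | apply Hth].
      * pose proof (Hsp (th t)); unfold scal; simpl; unfold mult; simpl; field; lra.
      * apply (is_derive_comp orbit_y th); [apply orbit_y_derive | apply Hth].
      * pose proof (Hsp (th t)); unfold scal; simpl; unfold mult; simpl; field; lra.
    + exists P; split; [exact HP|]; intros t; rewrite Hthp; unfold orbit_x, orbit_y.
      rewrite Hrper, HSper, HCper; auto.
    + destruct (Hsurj 0 1) as [u1 [A1 B1]]; [unfold on_curve; ring|].
      destruct (Hsurj (sqrt (1 / 2)) 0) as [u2 [A2 B2]].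
      { unfold on_curve; rewrite pow2_sqrt by lra; field. }
      destruct (Hths u1) as [t1 E1]; destruct (Hths u2) as [t2 E2]; exists t1, t2; left.
      rewrite E1, E2; unfold orbit_x; rewrite A1, A2.
      destruct (radius_cube u2) as [R _].
      assert (0 < sqrt (1 / 2)) by (apply sqrt_lt_R0; lra).
      assert (0 < radius u2 ^ 2) by (apply pow_lt; lra); nra.
Qed.

End OrbitOfRadius.

(** * Polar coordinates of an orbit *)

Section PolarCoordinates.

Variables (m : R) (x y : R -> R).
Hypothesis Hsol : forall t, is_sol (sysf 1) (sysg 2 m) x y t.
Hypothesis Hpos : forall t, 0 < energy (x t) (y t).

Definition polar_r (t : R) : R := sqrt (sqrt (energy (x t) (y t))).
(** The angle is represented by a point of the curve, so that no continuous choice of phase is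
    needed yet. *)
Definition polar_s (t : R) : R := x t / polar_r t ^ 2.
Definition polar_c (t : R) : R := y t / polar_r t.
Definition polar_Z (t : R) : R := / polar_r t ^ 3 - rq m (polar_s t) (polar_c t).
Definition polar_g (t : R) : R := polar_r t ^ 4 * polar_Z t.

Lemma polar_r_pos t : 0 < polar_r t.
Proof. unfold polar_r; repeat apply sqrt_lt_R0; apply Hpos. Qed.

Lemma polar_r4 t : polar_r t ^ 4 = energy (x t) (y t).
Proof.
  unfold polar_r; replace 4%nat with (2 * 2)%nat by reflexivity; rewrite pow_mult.
  rewrite pow2_sqrt by apply sqrt_pos; apply pow2_sqrt; left; apply Hpos.
Qed.

Lemma polar_x t : x t = polar_r t ^ 2 * polar_s t.
Proof. unfold polar_s; field; apply Rgt_not_eq, polar_r_pos. Qed.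

Lemma polar_y t : y t = polar_r t * polar_c t.
Proof. unfold polar_c; field; apply Rgt_not_eq, polar_r_pos. Qed.

Lemma polar_curve t : on_curve (polar_s t) (polar_c t).
Proof.
  pose proof (polar_r_pos t) as Hr; pose proof (polar_r4 t) as E.
  unfold on_curve, polar_s, polar_c, energy in *.
  transitivity ((2 * x t ^ 2 + y t ^ 4) / polar_r t ^ 4); [field; lra|].
  rewrite <- E; field; lra.
Qed.

Lemma polar_r_derive t :
  is_derive polar_r t (polar_r t ^ 5 * rp m (polar_s t) (polar_c t)).
Proof.
  destruct (is_sol_is_derive _ _ _ _ _ (Hsol t)) as [Dx Dy].
  pose proof (partials_energy x y t _ _ Dx Dy) as DN; simpl in DN.
  pose proof (Hpos t) as HN; pose proof (polar_r_pos t) as Hr.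
  assert (Hr2 : sqrt (energy (x t) (y t)) = polar_r t ^ 2).
  { unfold polar_r; rewrite pow2_sqrt by apply sqrt_pos; reflexivity. }
  set (N := fun u => energy (x u) (y u)) in *.
  change (is_derive (fun u => sqrt (sqrt (N u))) t
    (polar_r t ^ 5 * rp m (polar_s t) (polar_c t))).
  auto_derive.
  - split; [eexists; exact DN|]; split; [exact HN|]; split; [|exact I].
    apply sqrt_lt_R0; exact HN.
  - replace (Derive (fun u => N u) t) with
      (4 * x t * sysf 1 (x t) (y t) + 4 * (y t * (y t * (y t * 1))) * sysg 2 m (x t) (y t))
      by (symmetry; apply is_derive_unique; exact DN).
    change (sqrt (sqrt (N t))) with (polar_r t); unfold N; rewrite Hr2.
    unfold sysf, sysg, rp; simpl Nat.mul; simpl Nat.add.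
    rewrite (polar_x t), (polar_y t); field; lra.
Qed.

Lemma polar_g_eq t : polar_g t = polar_r t - polar_r t ^ 4 * rq m (polar_s t) (polar_c t).
Proof. unfold polar_g, polar_Z; field; apply Rgt_not_eq, polar_r_pos. Qed.

Lemma polar_s_derive t : is_derive polar_s t (polar_c t ^ 3 * polar_g t).
Proof.
  destruct (is_sol_is_derive _ _ _ _ _ (Hsol t)) as [Dx _].
  pose proof (polar_r_derive t) as Dr; pose proof (polar_r_pos t) as Hr.
  apply is_derive_eq with (sysf 1 (x t) (y t) / polar_r t ^ 2 -
    2 * x t * (polar_r t ^ 5 * rp m (polar_s t) (polar_c t)) / polar_r t ^ 3).
  - unfold polar_s at 1; auto_derive.
    + split; [eexists; exact Dx | split; [eexists; exact Dr | split; [|exact I]]].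
      repeat apply Rmult_integral_contrapositive_currified; lra.
    + replace (Derive (fun u => x u) t) with (sysf 1 (x t) (y t))
        by (symmetry; apply is_derive_unique; exact Dx).
      replace (Derive (fun u => polar_r u) t) with
        (polar_r t ^ 5 * rp m (polar_s t) (polar_c t))
        by (symmetry; apply is_derive_unique; exact Dr).
      field; lra.
  - rewrite polar_g_eq; pose proof (curve_relation_x m _ _ (polar_curve t)) as E.
    unfold sysf; simpl Nat.mul; simpl Nat.add; rewrite (polar_x t), (polar_y t).
    transitivity (polar_r t * polar_c t ^ 3 - polar_r t ^ 4 *
      (2 * rp m (polar_s t) (polar_c t) * polar_s t + polar_s t ^ 3)); [field; lra|].
    rewrite E; ring.
Qed.

Lemma polar_c_derive t : is_derive polar_c t (- polar_s t * polar_g t).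
Proof.
  destruct (is_sol_is_derive _ _ _ _ _ (Hsol t)) as [_ Dy].
  pose proof (polar_r_derive t) as Dr; pose proof (polar_r_pos t) as Hr.
  apply is_derive_eq with (sysg 2 m (x t) (y t) / polar_r t -
    y t * (polar_r t ^ 5 * rp m (polar_s t) (polar_c t)) / polar_r t ^ 2).
  - unfold polar_c at 1; auto_derive.
    + split; [eexists; exact Dy | split; [eexists; exact Dr | split; [lra | exact I]]].
    + replace (Derive (fun u => y u) t) with (sysg 2 m (x t) (y t))
        by (symmetry; apply is_derive_unique; exact Dy).
      replace (Derive (fun u => polar_r u) t) with
        (polar_r t ^ 5 * rp m (polar_s t) (polar_c t))
        by (symmetry; apply is_derive_unique; exact Dr).
      field; lra.
  - rewrite polar_g_eq; pose proof (curve_relation_y m _ _ (polar_curve t)) as E.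
    unfold sysg; simpl Nat.mul; simpl Nat.add; rewrite (polar_x t), (polar_y t).
    transitivity (- polar_r t * polar_s t + polar_r t ^ 4 *
      (m * polar_c t ^ 5 - rp m (polar_s t) (polar_c t) * polar_c t)); [field; lra|].
    rewrite E; ring.
Qed.

Lemma polar_Z_derive t : polar_Z t <> 0 -> is_derive polar_Z t
  ((ra m (polar_s t) (polar_c t) + rb m (polar_s t) (polar_c t) / polar_Z t) * polar_g t).
Proof.
  intros Hne.
  pose proof (polar_r_derive t) as Dr; pose proof (polar_r_pos t) as Hr.
  pose proof (rq_path _ _ _ _ m (polar_s_derive t) (polar_c_derive t)) as Dq.
  fold (rp m (polar_s t) (polar_c t)) in Dq.
  set (Q := fun u => rq m (polar_s u) (polar_c u)) in *.
  apply is_derive_eq with (- 3 * (polar_r t ^ 5 * rp m (polar_s t) (polar_c t)) / polar_r t ^ 4 -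
    (- ra m (polar_s t) (polar_c t) - 3 * rp m (polar_s t) (polar_c t)) * polar_g t).
  - change (is_derive (fun u => / polar_r u ^ 3 - Q u) t
      (- 3 * (polar_r t ^ 5 * rp m (polar_s t) (polar_c t)) / polar_r t ^ 4 -
      (- ra m (polar_s t) (polar_c t) - 3 * rp m (polar_s t) (polar_c t)) * polar_g t)).
    auto_derive.
    + split; [eexists; exact Dr | split; [|split; [eexists; exact Dq | exact I]]].
      repeat apply Rmult_integral_contrapositive_currified; lra.
    + replace (Derive (fun u => polar_r u) t) with
        (polar_r t ^ 5 * rp m (polar_s t) (polar_c t))
        by (symmetry; apply is_derive_unique; exact Dr).
      replace (Derive (fun u => Q u) t) with
        ((- ra m (polar_s t) (polar_c t) - 3 * rp m (polar_s t) (polar_c t)) * polar_g t)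
        by (symmetry; apply is_derive_unique; exact Dq).
      field; lra.
  - rewrite rb_rp_rq; unfold polar_g.
    assert (E : polar_r t ^ 3 * (polar_Z t + rq m (polar_s t) (polar_c t)) = 1)
      by (unfold polar_Z; field; lra).
    set (Zt := polar_Z t) in *; set (q := rq m (polar_s t) (polar_c t)) in *.
    transitivity (- 3 * (polar_r t * (polar_r t ^ 3 * (Zt + q))) * rp m (polar_s t) (polar_c t) +
      (ra m (polar_s t) (polar_c t) + 3 * rp m (polar_s t) (polar_c t)) *
        (polar_r t ^ 4 * Zt)).
    + rewrite E; field; lra.
    + field; exact Hne.
Qed.

End PolarCoordinates.

(** * Isolation of the periodic orbit *)

(** The squared distance has derivative 2 (S1 - S2) (C1 - C2) (C1^2 + C1 C2 + C2^2 - 1) g, where the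
    cubic difference has been factored. On the curve the last bracket is bounded, so Gronwall's
    inequality applies. *)
Lemma curve_flow_unique (S1 C1 S2 C2 g : R -> R) (G : R) :
  (forall t, is_derive S1 t (C1 t ^ 3 * g t)) -> (forall t, is_derive C1 t (- S1 t * g t)) ->
  (forall t, is_derive S2 t (C2 t ^ 3 * g t)) -> (forall t, is_derive C2 t (- S2 t * g t)) ->
  (forall t, on_curve (S1 t) (C1 t)) -> (forall t, on_curve (S2 t) (C2 t)) ->
  (forall t, Rabs (g t) <= G) -> S1 0 = S2 0 -> C1 0 = C2 0 ->
  forall t, S1 t = S2 t /\ C1 t = C2 t.
Proof.
  intros DS1 DC1 DS2 DC2 On1 On2 Hg HS0 HC0 t.
  assert (E : (S1 t - S2 t) ^ 2 + (C1 t - C2 t) ^ 2 = 0).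
  { apply (gronwall_unique (fun t => (S1 t - S2 t) ^ 2 + (C1 t - C2 t) ^ 2)
      (fun t => 2 * (S1 t - S2 t) * (C1 t - C2 t) *
         (C1 t ^ 2 + C1 t * C2 t + C2 t ^ 2 - 1) * g t) (4 * G) 0).
    - intros u; pose proof (DS1 u) as D1; pose proof (DC1 u) as D2.
      pose proof (DS2 u) as D3; pose proof (DC2 u) as D4; auto_derive.
      + repeat match goal with |- _ /\ _ => split | |- True => exact I end;
          first [eexists; exact D1 | eexists; exact D2 | eexists; exact D3 | eexists; exact D4].
      + replace (Derive (fun u => S1 u) u) with (C1 u ^ 3 * g u)
          by (symmetry; apply is_derive_unique; exact D1).
        replace (Derive (fun u => C1 u) u) with (- S1 u * g u)
          by (symmetry; apply is_derive_unique; exact D2).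
        replace (Derive (fun u => S2 u) u) with (C2 u ^ 3 * g u)
          by (symmetry; apply is_derive_unique; exact D3).
        replace (Derive (fun u => C2 u) u) with (- S2 u * g u)
          by (symmetry; apply is_derive_unique; exact D4).
        ring.
    - intros u; destruct (curve_bounds _ _ (On1 u)) as [_ B1].
      destruct (curve_bounds _ _ (On2 u)) as [_ B2].
      apply Rabs_le_between in B1, B2.
      set (d1 := S1 u - S2 u); set (d2 := C1 u - C2 u).
      set (k := C1 u ^ 2 + C1 u * C2 u + C2 u ^ 2 - 1).
      assert (Hk : Rabs k <= 4) by (unfold k; apply Rabs_le; split; nra).
      rewrite !Rabs_mult, (Rabs_pos_eq 2) by lra.
      pose proof (Rabs_pos d1); pose proof (Rabs_pos d2); pose proof (Rabs_pos k).
      pose proof (Rabs_pos (g u)); pose proof (Hg u).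
      rewrite (Rabs_pos_eq (d1 ^ 2 + d2 ^ 2)) by (pose proof (pow2_ge_0 d1);
        pose proof (pow2_ge_0 d2); lra).
      rewrite <- (pow2_abs d1), <- (pow2_abs d2).
      assert (H4 : 2 * Rabs d1 * Rabs d2 <= Rabs d1 ^ 2 + Rabs d2 ^ 2) by
        (pose proof (pow2_ge_0 (Rabs d1 - Rabs d2)); nra).
      assert (0 <= 2 * Rabs d1 * Rabs d2) by nra.
      assert (Rabs k * Rabs (g u) <= 4 * G) by (apply Rmult_le_compat; assumption).
      rewrite Rmult_assoc, (Rmult_comm (4 * G)).
      apply Rmult_le_compat; auto; apply Rmult_le_pos; assumption.
    - rewrite HS0, HC0; ring. }
  pose proof (pow2_ge_0 (S1 t - S2 t)); pose proof (pow2_ge_0 (C1 t - C2 t)).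
  assert (A : (S1 t - S2 t) ^ 2 = 0) by lra; assert (B : (C1 t - C2 t) ^ 2 = 0) by lra.
  rewrite <- Rsqr_pow2 in A, B; apply Rsqr_0_uniq in A, B; lra.
Qed.

Lemma primitive_exists (g : R -> R) (c : R) : (forall t, continuous g t) ->
  exists G : R -> R, G 0 = c /\ forall t, is_derive G t (g t).
Proof.
  intros Hg; exists (fun t => c + RInt g 0 t); split.
  - replace (RInt g 0 0) with 0 by (symmetry; apply (RInt_point 0 g)); ring.
  - intros t; apply is_derive_eq with (0 + g t); [|ring].
    apply @is_derive_plus; [apply @is_derive_const|].
    apply (is_derive_RInt g _ 0 t); [|apply Hg].
    apply filter_forall; intros u; apply (RInt_correct g 0 u).
    apply (ex_RInt_continuous g); intros; apply Hg.
Qed.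

Section Isolation.

Variables (S C : R -> R) (per : R).
Hypothesis HS : forall t, is_derive S t (C t ^ 3).
Hypothesis HC : forall t, is_derive C t (- S t).
Hypothesis Hcurve : forall t, on_curve (S t) (C t).
Hypothesis Hsurj : forall s c, on_curve s c -> exists t, S t = s /\ C t = c.
Hypothesis Hinj : forall t1 t2, S t1 = S t2 -> C t1 = C t2 ->
  exists n : Z, t1 = t2 + IZR n * per.

Variables (m K w0 : R) (Z : R -> R).
Hypothesis Hw0 : 0 < w0 <= 1.
Hypothesis Hbounds : forall s c, on_curve s c ->
  Rabs (rq m s c) <= K /\ Rabs (rb m s c) <= K.
Hypothesis Hspread : forall s c w1 w2, on_curve s c -> 0 < w1 <= w0 -> 0 < w2 <= w0 ->
  0 < spread_rate m s c w1 w2.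
Hypothesis HZ : forall t, is_derive Z t (ra m (S t) (C t) + rb m (S t) (C t) / Z t).
Hypothesis HZper : forall t, Z (t + per) = Z t.
Hypothesis HZin : forall t, / w0 <= Z t.

Variables (x y : R -> R).
Hypothesis Hsol : forall t, is_sol (sysf 1) (sysg 2 m) x y t.
Hypothesis Hpos : forall t, 0 < energy (x t) (y t).
Hypothesis Hr1 : forall t, polar_r x y t <= 1.
Hypothesis HZ2 : forall t, / w0 <= polar_Z m x y t.
Variable P : R.
Hypothesis HP : 0 < P.
Hypothesis Hxyper : forall t, x (t + P) = x t /\ y (t + P) = y t.

Lemma inv_w0_ge1 : 1 <= / w0.
Proof. rewrite <- Rinv_1; apply Rinv_le_contravar; lra. Qed.

Lemma polar_g_bounds t : 0 < polar_g m x y t <= 1 + K.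
Proof.
  pose proof (polar_r_pos x y Hpos t) as Hr; pose proof (Hr1 t) as Hr'.
  pose proof inv_w0_ge1; split.
  - unfold polar_g; apply Rmult_lt_0_compat; [apply pow_lt; lra|].
    specialize (HZ2 t); lra.
  - rewrite (polar_g_eq m x y Hpos).
    destruct (Hbounds _ _ (polar_curve x y Hpos t)) as [B _].
    assert (Hp : Rabs (polar_r x y t ^ 4) <= 1).
    { rewrite Rabs_pos_eq by (apply pow_le; lra).
      rewrite <- (pow1 4); apply pow_incr; lra. }
    pose proof (Rabs_mult_le _ _ _ _ Hp B); lra.
Qed.

(* The orbit is lifted to the phase of [S], [C]; there its distance to [Z] has a strictly
   monotone renormalization, which a periodic function can only have if it vanishes. *)
Theorem periodic_orbit_unique : exists phi : R -> R, forall t,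
  S (phi t) = polar_s x y t /\ C (phi t) = polar_c x y t /\ Z (phi t) = polar_Z m x y t.
Proof.
  set (s := polar_s x y); set (c := polar_c x y); set (Z2 := polar_Z m x y).
  set (g := polar_g m x y).
  pose proof inv_w0_ge1 as Hinv.
  assert (Ds : forall t, is_derive s t (c t ^ 3 * g t)) by
    (intros t; apply polar_s_derive; assumption).
  assert (Dc : forall t, is_derive c t (- s t * g t)) by
    (intros t; apply polar_c_derive; assumption).
  assert (Hon : forall t, on_curve (s t) (c t)) by (intros t; apply polar_curve, Hpos).
  assert (HZ2' : forall t, / w0 <= Z2 t) by exact HZ2.
  assert (DZ2 : forall t, is_derive Z2 t ((ra m (s t) (c t) + rb m (s t) (c t) / Z2 t) * g t)).
  { intros t; apply polar_Z_derive; try assumption.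
    specialize (HZ2 t); lra. }
  assert (Hg : forall t, 0 < g t <= 1 + K) by (intros; apply polar_g_bounds).
  (* The lifted phase is the primitive of the phase speed from a phase of the initial point; (S, C)
     composed with it solves the same equation as (s, c). *)
  destruct (Hsurj (s 0) (c 0) (Hon 0)) as [phi0 [A0 B0]].
  destruct (primitive_exists g phi0) as [phi [Hphi0 Dphi]].
  { intros t; apply @ex_derive_continuous; unfold g, polar_g.
    assert (E1 : ex_derive (polar_r x y) t) by
      (eexists; apply (polar_r_derive m); assumption).
    assert (E2 : ex_derive (polar_Z m x y) t) by (eexists; apply DZ2).
    auto_derive; split; [exact E1 | split; [exact E2 | exact I]]. }
  assert (Hlift : forall t, S (phi t) = s t /\ C (phi t) = c t).
  { apply (curve_flow_unique _ _ _ _ g (1 + K)); try assumption.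
    - intros t; apply is_derive_eq with (g t * C (phi t) ^ 3); [|ring].
      apply (is_derive_comp S phi); [apply HS | apply Dphi].
    - intros t; apply is_derive_eq with (g t * - S (phi t)); [|ring].
      apply (is_derive_comp C phi); [apply HC | apply Dphi].
    - intros t; apply Hcurve.
    - intros t; rewrite Rabs_pos_eq; specialize (Hg t); lra.
    - rewrite Hphi0; exact A0.
    - rewrite Hphi0; exact B0. }
  set (Z1 := fun t => Z (phi t)).
  assert (DZ1 : forall t, is_derive Z1 t ((ra m (s t) (c t) + rb m (s t) (c t) / Z1 t) * g t)).
  { intros t; destruct (Hlift t) as [E1 E2]; rewrite <- E1, <- E2.
    apply is_derive_eq with (g t * (ra m (S (phi t)) (C (phi t)) +
      rb m (S (phi t)) (C (phi t)) / Z (phi t))); [|unfold Z1; ring].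
    apply (is_derive_comp Z phi); [apply HZ | apply Dphi]. }
  assert (HZ1 : forall t, / w0 <= Z1 t) by (intros t; apply HZin).
  assert (Hw : forall z, / w0 <= z -> 0 < / z <= w0).
  { intros z Hz; split; [apply Rinv_0_lt_compat; lra|].
    rewrite <- (Rinv_inv w0); apply Rinv_le_contravar; lra. }
  set (E := spread s c m Z1 Z2).
  set (q := fun t => spread_rate m (s t) (c t) (/ Z1 t) (/ Z2 t) * (/ Z1 t * / Z2 t) * g t).
  assert (Hq : forall t, 0 < q t).
  { intros t; pose proof (Hw _ (HZ1 t)); pose proof (Hw _ (HZ2' t)).
    unfold q; apply Rmult_lt_0_compat; [|apply Hg].
    apply Rmult_lt_0_compat; [apply Hspread; auto|].
    apply Rmult_lt_0_compat; lra. }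
  assert (DE : forall t, is_derive E t (E t * q t)).
  { intros t; apply spread_path; auto.
    - specialize (HZ1 t); lra.
    - specialize (HZ2' t); lra. }
  assert (Hper : s P = s 0 /\ c P = c 0 /\ Z2 P = Z2 0).
  { destruct (Hxyper 0) as [X Y]; rewrite Rplus_0_l in X, Y.
    unfold s, c, Z2, polar_Z, polar_s, polar_c, polar_r; rewrite X, Y; auto. }
  destruct Hper as [Ps [Pc PZ]].
  (* The period P of the orbit need not be related to [per], but equal points of the curve have
     phases differing by a multiple of [per]. *)
  assert (PZ1 : Z1 P = Z1 0).
  { destruct (Hlift P) as [a1 b1]; destruct (Hlift 0) as [a2 b2].
    destruct (Hinj (phi P) (phi 0)) as [n Hn]; [congruence | congruence |].
    unfold Z1; rewrite Hn; apply periodic_Z, HZper. }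
  assert (PE : E P = E 0) by (unfold E, spread; rewrite Ps, Pc, PZ, PZ1; reflexivity).
  (* E' = q E with q > 0, so E^2 can take equal values at 0 and P only if E vanishes somewhere; from
     that point, uniqueness spreads the coincidence to all times. *)
  destruct (mean_value (fun t => E t ^ 2) (fun t => 2 * E t ^ 2 * q t) 0 P) as [xi [_ Hxi]].
  { intros t; pose proof (DE t) as D; auto_derive; [eexists; exact D|].
    replace (Derive (fun u => E u) t) with (E t * q t)
      by (symmetry; apply is_derive_unique; exact D).
    ring. }
  rewrite PE, Rminus_0_r in Hxi.
  assert (Exi : E xi = 0).
  { specialize (Hq xi).
    assert (F : E xi ^ 2 * (2 * (q xi * P)) = 0) by lra.
    apply Rmult_integral in F as [F|F]; [|nra].
    rewrite <- Rsqr_pow2 in F; apply Rsqr_0_uniq in F; exact F. }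
  assert (Dxi : Z2 xi - Z1 xi = 0).
  { unfold E, spread in Exi; apply Rmult_integral in Exi as [Exi|Exi]; [exact Exi|].
    exfalso; eapply Rgt_not_eq; [apply exp_pos | exact Exi]. }
  assert (Hall : forall t, Z2 t - Z1 t = 0).
  { apply (gronwall_unique (fun t => Z2 t - Z1 t)
      (fun t => (ra m (s t) (c t) + rb m (s t) (c t) / Z2 t) * g t -
                (ra m (s t) (c t) + rb m (s t) (c t) / Z1 t) * g t) (K * (1 + K)) xi);
      [| |exact Dxi].
    - intros t; apply @is_derive_minus; auto.
    - intros t; specialize (HZ1 t); specialize (HZ2' t); specialize (Hg t).
      destruct (Hbounds _ _ (Hon t)) as [_ Hb].
      replace ((ra m (s t) (c t) + rb m (s t) (c t) / Z2 t) * g t -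
        (ra m (s t) (c t) + rb m (s t) (c t) / Z1 t) * g t) with
        ((rb m (s t) (c t) / Z2 t - rb m (s t) (c t) / Z1 t) * g t) by ring.
      pose proof (quotient_lipschitz 1 K _ (Z2 t) (Z1 t) (Rle_refl 1) Hb) as Q.
      rewrite !Rmax_left in Q by lra.
      rewrite Rabs_mult, (Rabs_pos_eq (g t)) by lra.
      replace (K * (1 + K) * Rabs (Z2 t - Z1 t)) with (K * Rabs (Z2 t - Z1 t) * (1 + K)) by ring.
      apply Rmult_le_compat; try lra; apply Rabs_pos. }
  exists phi; intros t; destruct (Hlift t) as [E1 E2].
  split; [exact E1|split; [exact E2|]].
  specialize (Hall t); unfold Z1 in Hall; lra.
Qed.

End Isolation.

(** * The limit cycle *)

Lemma Rabs_lt_of_sqr u e : 0 < e -> u ^ 2 < e ^ 2 -> Rabs u < e.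
Proof. intros He H; apply Rabs_def1; nra. Qed.

Lemma energy_close a b a' b' e : 0 < e <= 1 -> Rabs a <= 1 -> Rabs b <= 1 ->
  (a' - a) ^ 2 + (b' - b) ^ 2 < e ^ 2 -> Rabs (energy a' b' - energy a b) <= 21 * e.
Proof.
  intros He Ha Hb H; pose proof (pow2_ge_0 (a' - a)); pose proof (pow2_ge_0 (b' - b)).
  assert (Hda : Rabs (a' - a) <= e) by (left; apply Rabs_lt_of_sqr; lra).
  assert (Hdb : Rabs (b' - b) <= e) by (left; apply Rabs_lt_of_sqr; lra).
  set (u := a' - a) in *; set (v := b' - b) in *.
  replace (energy a' b' - energy a b) with
    (u * (4 * a + 2 * u) + v * (4 * b ^ 3 + 6 * b ^ 2 * v + 4 * b * v ^ 2 + v ^ 3))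
    by (unfold energy, u, v; ring).
  assert (Ba : Rabs (4 * a + 2 * u) <= 6).
  { apply Rabs_le_between in Ha, Hda; apply Rabs_le; lra. }
  assert (Bb : Rabs (4 * b ^ 3 + 6 * b ^ 2 * v + 4 * b * v ^ 2 + v ^ 3) <= 15).
  { assert (M : forall i j, Rabs (b ^ i * v ^ j) <= 1).
    { intros i j; rewrite Rabs_mult, <- !RPow_abs, <- (Rmult_1_l 1).
      apply Rmult_le_compat; try (apply pow_le, Rabs_pos);
        [rewrite <- (pow1 i) | rewrite <- (pow1 j)]; apply pow_incr;
        split; try apply Rabs_pos; lra. }
    pose proof (M 3%nat 0%nat) as M1; pose proof (M 2%nat 1%nat) as M2.
    pose proof (M 1%nat 2%nat) as M3; pose proof (M 0%nat 3%nat) as M4.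
    apply Rabs_le_between in M1, M2, M3, M4; apply Rabs_le.
    replace (b ^ 3 * v ^ 0) with (b ^ 3) in M1 by ring.
    replace (b ^ 2 * v ^ 1) with (b ^ 2 * v) in M2 by ring.
    replace (b ^ 1 * v ^ 2) with (b * v ^ 2) in M3 by ring.
    replace (b ^ 0 * v ^ 3) with (v ^ 3) in M4 by ring.
    lra. }
  pose proof (Rabs_mult_le _ _ _ _ Hda Ba); pose proof (Rabs_mult_le _ _ _ _ Hdb Bb).
  apply Rabs_le; lra.
Qed.

(** The factor 8 = 2^3 allows neighbouring orbits a radius up to 2 r0 while their Z remains above 1
    / w0. *)
Lemma small_radius K w0 rho : 1 <= K -> 0 < w0 <= 1 -> 0 < rho ->
  exists r0, 0 < r0 <= 1 / 2 /\ 8 * r0 ^ 3 * (/ w0 + K) <= 1 /\ r0 < rho.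
Proof.
  intros HK Hw Hrho.
  assert (Hi : 0 < / w0) by (apply Rinv_0_lt_compat; lra).
  destruct (small_factor (1 / 8) (/ w0 + K)) as [e [He1 He2]]; try lra.
  set (r0 := Rmin e (Rmin (1 / 2) (rho / 2))).
  assert (r0 <= e) by apply Rmin_l.
  assert (r0 <= Rmin (1 / 2) (rho / 2)) by apply Rmin_r.
  pose proof (Rmin_l (1 / 2) (rho / 2)); pose proof (Rmin_r (1 / 2) (rho / 2)).
  assert (0 < r0) by (repeat apply Rmin_pos; lra).
  exists r0; repeat split; try lra.
  assert (r0 ^ 3 <= r0).
  { assert (r0 ^ 2 <= 1) by nra; replace (r0 ^ 3) with (r0 * r0 ^ 2) by ring; nra. }
  assert ((/ w0 + K) * r0 ^ 3 <= (/ w0 + K) * e) by (apply Rmult_le_compat_l; lra).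
  lra.
Qed.

Lemma limit_cycle_near_critical rho : 0 < rho -> exists eps, 0 < eps /\
  forall m, 3 / 5 - eps < m < 3 / 5 ->
    exists x y : R -> R, limit_cycle (sysf 1) (sysg 2 m) x y /\
      forall t, (x t) ^ 2 + (y t) ^ 2 < rho.
Proof.
  intros Hrho.
  destruct generalized_trig as (S & C & per & Hper & HS0 & _ & HS & HC & Hon & HSp & HCp &
    Hsurj & Hinj).
  destruct rates as (K & w0 & mu & k1 & HK & Hw0 & Hmu & Hk1 & Hbd & Hspr & Hzeta).
  destruct (small_radius K w0 rho HK Hw0 Hrho) as (r0 & Hr0 & Hr0K & Hr0rho).
  assert (Hr3 : 0 < r0 ^ 3) by (apply pow_lt; lra).
  assert (Hiw : 0 < / w0) by (apply Rinv_0_lt_compat; lra).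
  (* Since |q| <= K, this keeps 1/r^3 = Z + q at least 1 / r0^3, that is r <= r0. *)
  set (Zb := / r0 ^ 3 + K).
  assert (HZb : 8 * (/ w0 + K) <= / r0 ^ 3).
  { apply Rmult_le_reg_l with (r0 ^ 3); [exact Hr3|]; rewrite Rinv_r by lra; lra. }
  destruct (periodic_radius S C per Hper HS HC Hon HSp HCp K w0 mu k1 HK Hw0 Hmu Hk1 Hbd Hzeta
    Zb) as [eps [Heps Hrad]]; try (unfold Zb; lra); try assumption.
  exists eps; split; [lra|]; intros m Hm.
  destruct (Hrad m Hm) as (Z & ZM & HZ & HZp & HZin).
  assert (Hm1 : Rabs m <= 1) by (apply Rabs_le; lra).
  assert (Hm2 : Rabs (m - 3 / 5) <= mu) by (apply Rabs_le; lra).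
  assert (Hq : forall s c, on_curve s c -> Rabs (rq m s c) <= K).
  { intros s c H; destruct (Hbd m s c Hm1 H) as [H1 _]; exact H1. }
  assert (Hqb : forall s c, on_curve s c -> Rabs (rq m s c) <= K /\ Rabs (rb m s c) <= K).
  { intros s c H; destruct (Hbd m s c Hm1 H) as (H1 & _ & H2 & _); auto. }
  assert (HZb2 : 2 * K <= Zb) by (unfold Zb; lra).
  destruct (periodic_orbit_of_radius S C per Hper HS HC Hon HSp HCp Hsurj m K Zb ZM Z HK Hq HZ
    HZp HZin HZb2) as (x & y & th & Hpo & Hths & Hxy).
  set (rad := radius S C m Z).
  assert (Hrc : forall u, 0 < rad u /\ rad u ^ 3 * (Z u + rq m (S u) (C u)) = 1) by
    (intros u; apply (radius_cube S C Hon m K Zb ZM Z HK Hq HZin HZb2)).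
  assert (Hrb : forall u, (/ (ZM + K)) ^ 2 <= rad u ^ 4) by
    (intros u; apply (radius_bounds S C Hon m K Zb ZM Z HK Hq HZin HZb2)).
  assert (Hrs : forall u, rad u <= r0).
  { intros u; apply (radius_small S C Hon m K Zb ZM Z HK Hq HZin HZb2); [lra|].
    unfold Zb; field; lra. }
  assert (Hen : forall t, energy (x t) (y t) = rad (th t) ^ 4).
  { intros t; destruct (Hxy t) as [-> ->]; apply orbit_energy; exact Hon. }
  set (Nmin := (/ (ZM + K)) ^ 2).
  assert (HN : 0 < Nmin) by (apply pow_lt, Rinv_0_lt_compat; specialize (HZin 0); lra).
  assert (Hr4 : forall u, Nmin <= rad u ^ 4 <= r0 ^ 4).
  { intros u; split; [apply Hrb|]; apply pow_incr; split;
      [left; apply Hrc | apply Hrs]. }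
  assert (Hr41 : r0 ^ 4 <= r0).
  { assert (r0 ^ 2 <= 1) by nra; assert (r0 ^ 3 <= 1) by
      (rewrite <- (pow1 3); apply pow_incr; lra).
    replace (r0 ^ 4) with (r0 * r0 ^ 3) by ring; nra. }
  assert (Hsize : forall t, Rabs (x t) <= rad (th t) ^ 2 /\ Rabs (y t) <= rad (th t)).
  { intros t; destruct (Hxy t) as [-> ->]; unfold orbit_x, orbit_y; fold rad.
    destruct (curve_bounds _ _ (Hon (th t))) as [Bs Bc]; destruct (Hrc (th t)) as [Hp _].
    rewrite !Rabs_mult, (Rabs_pos_eq (rad (th t))) by lra.
    rewrite (Rabs_pos_eq (rad (th t) ^ 2)) by (apply pow_le; lra).
    assert (0 < rad (th t) ^ 2) by (apply pow_lt; lra); split; nra. }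
  exists x, y; split; [split; [exact Hpo|]|].
  (* By [energy_close], orbits within e differ in energy by at most 21 e = Nmin / 2, so a neighbour
     stays away from the origin and polar coordinates apply to it; [near_orbit] measures squared
     distances, hence e^2. *)
  - set (e := Nmin / 42).
    assert (He : 0 < e <= 1).
    { specialize (Hr4 0); unfold e; lra. }
    exists (e ^ 2); split; [apply pow_lt; lra|].
    intros x' y' (Hsol & (P & HP & Hxyp) & _) Hnear.
    assert (Hen' : forall t, Nmin / 2 <= energy (x' t) (y' t) <= 2 * r0 ^ 4).
    { intros t; destruct (Hnear t) as [u Hu]; destruct (Hsize u) as [Sx Sy].
      destruct (Hrc (th u)) as [Hp _]; pose proof (Hrs (th u)).
      assert (rad (th u) ^ 2 <= 1) by nra.
      pose proof (energy_close (x u) (y u) (x' t) (y' t) e He ltac:(lra) ltac:(lra) Hu) as Hc.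
      rewrite Hen in Hc; apply Rabs_le_between in Hc; specialize (Hr4 (th u)).
      unfold e in Hc; lra. }
    assert (Hpos : forall t, 0 < energy (x' t) (y' t)) by
      (intros t; specialize (Hen' t); lra).
    assert (Hpr : forall t, polar_r x' y' t <= 2 * r0).
    { intros t; apply fourth_power_le; [left; apply polar_r_pos, Hpos | lra|].
      rewrite (polar_r4 x' y' Hpos); replace ((2 * r0) ^ 4) with (16 * r0 ^ 4) by ring.
      assert (0 < r0 ^ 4) by (apply pow_lt; lra); specialize (Hen' t); lra. }
    assert (HZ' : forall t, / w0 <= polar_Z m x' y' t).
    { intros t; unfold polar_Z.
      pose proof (Hq _ _ (polar_curve x' y' Hpos t)) as B; apply Rabs_le_between in B.
      pose proof (polar_r_pos x' y' Hpos t) as Hp.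
      assert (/ (2 * r0) ^ 3 <= / polar_r x' y' t ^ 3).
      { apply Rinv_le_contravar; [apply pow_lt; lra|].
        apply pow_incr; split; [lra | apply Hpr]. }
      replace (/ (2 * r0) ^ 3) with (1 / 8 * / r0 ^ 3) in H by (field; lra).
      lra. }
    destruct (periodic_orbit_unique S C per HS HC Hon Hsurj Hinj m K w0 Z Hw0 Hqb) with
      (x := x') (y := y') (P := P) as [phi Hphi]; try assumption.
    + intros s c w1 w2 Hsc H1 H2; apply Hspr; assumption.
    + intros t; specialize (HZin t); unfold Zb in HZin; lra.
    + intros t; specialize (Hpr t); lra.
    + intros t; destruct (Hphi t) as (E1 & E2 & E3); destruct (Hths (phi t)) as [u Hu].
      exists u; destruct (Hxy u) as [-> ->]; rewrite Hu; unfold orbit_x, orbit_y; fold rad.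
      (* Equal Z and equal phase give equal 1/r^3 = Z + q, hence equal radii. *)
      assert (Er : polar_r x' y' t = rad (phi t)).
      { destruct (Hrc (phi t)) as [Hp Ec]; pose proof (polar_r_pos x' y' Hpos t) as Hp'.
        apply cube_root_unique; [exact Hp' | exact Hp|].
        rewrite E1, E2, E3 in Ec; unfold polar_Z in Ec.
        replace (/ polar_r x' y' t ^ 3 - rq m (polar_s x' y' t) (polar_c x' y' t) +
          rq m (polar_s x' y' t) (polar_c x' y' t)) with (/ polar_r x' y' t ^ 3) in Ec by ring.
        assert (polar_r x' y' t ^ 3 <> 0) by (apply pow_nonzero; lra).
        apply Rmult_eq_reg_r with (/ polar_r x' y' t ^ 3);
          [rewrite Ec; apply Rinv_r; assumption | apply Rinv_neq_0_compat; assumption]. }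
      rewrite E1, E2, <- Er; split; [apply polar_x | apply polar_y]; exact Hpos.
  - intros t; destruct (Hsize t) as [Sx Sy]; destruct (Hrc (th t)) as [Hp _].
    pose proof (Hrs (th t)); rewrite <- (pow2_abs (x t)), <- (pow2_abs (y t)).
    pose proof (Rabs_pos (x t)); pose proof (Rabs_pos (y t)).
    set (r := rad (th t)) in *.
    assert (Rabs (x t) <= r) by nra.
    nra.
Qed.

Theorem theorem1p3 :
  (* (i) *)
  (forall (k s : nat) (m : R), (1 <= k)%nat -> (1 <= s)%nat -> (s < 2 * k)%nat ->
     (m < 0 -> attractor (sysf k) (sysg s m)) /\
     (0 < m -> repeller (sysf k) (sysg s m))) /\
  (* (ii) *)
  (forall (k s : nat) (m : R), (1 <= k)%nat -> (1 <= s)%nat -> (2 * k < s)%nat ->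
     attractor (sysf k) (sysg s m)) /\
  (* (iii) *)
  (forall (k : nat) (m : R), (1 <= k)%nat ->
     (m < threshold k -> attractor (sysf k) (sysg (2 * k) m)) /\
     (threshold k < m -> repeller (sysf k) (sysg (2 * k) m))) /\
  repeller (sysf 1) (sysg 2 (3 / 5)) /\
  (forall rho, 0 < rho -> exists eps, 0 < eps /\
     forall m, 3 / 5 - eps < m < 3 / 5 ->
       exists x y : R -> R, limit_cycle (sysf 1) (sysg 2 m) x y /\
         forall t, (x t) ^ 2 + (y t) ^ 2 < rho).
Proof.
  split; [|split; [|split; [|split]]].
  - intros k s m Hk Hs Hsk; split; intros Hm.
    + apply attractor_neg; assumption.
    + apply repeller_pos; assumption.
  - exact attractor_high.
  - exact threshold_dichotomy.
  - exact repeller_critical.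
  - exact limit_cycle_near_critical.
Qed.
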